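(* Let $e\ge3$ and let $A$ and $B$ be arm sequences. Then for every $n\in\mathbb N$ the crystals $\mathcal R_A^{(n)}$ and $\mathcal R_B^{(n)}$ are isomorphic, and the crystals $\mathcal R_A$ and $\mathcal R_B$ are isomorphic.
   Context: An arm sequence is an integer sequence $A=(A_1,A_2,\dots)$ with $t-1\le A_t\le(e-1)t$ and $A_{t+u}\in\{A_t+A_u,A_t+A_u+1\}$ for all $t,u\ge1$. A partition is $A$-regular if it has no hook of length $et$ and arm length $A_t$ for any $t\ge1$ (hook at $(r,c)$ has length $\lambda_r-c+\lambda'_c-r+1$ and arm length $\lambda_r-c$). The crystal $\mathcal R_A$ is the directed graph on $A$-regular partitions with arrows $\lambda\xrightarrow{i}f_i\lambda$, $i\in\mathbb Z/e\mathbb Z$, where: the residue of node $(r,c)$ is $c-r+e\mathbb Z$; for distinct $i$-nodes $(r,c),(s,d)$, write $s-r+c-d=et$, swapping if needed so $t\ge0$, and put $(r,c)\prec(s,d)$ iff $c-d\le A_t$ ($A_0:=0$); list the addable and removable $i$-nodes of $\lambda$ in decreasing $\prec$-order as a word in $+$ (addable) and $-$ (removable), delete adjacent pairs $+-$ repeatedly; $f_i\lambda$ is $\lambda$ with the node of the first remaining $+$ added (or $0$ if none). $\mathcal R_A^{(n)}$ is the induced subgraph on partitions of size at most $ne$. A crystal isomorphism is a bijection of vertex sets preserving labelled arrows in both directions. *)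

(* Defs.v *)
From mathcomp Require Import all_boot all_order all_algebra.
Set Implicit Arguments. Unset Strict Implicit. Unset Printing Implicit Defensive.
Import GRing.Theory Num.Theory.

(* A partition is a weakly decreasing sequence of positive integers
   [lambda_1; lambda_2; ...]; rows and columns are 1-indexed. *)
Definition is_partition (l : seq nat) : bool :=
  sorted geq l && all (fun x => 0 < x) l.

Definition part (l : seq nat) (r : nat) : nat := nth 0 l r.-1.

Definition conjp (l : seq nat) (c : nat) : nat := count (fun x => c <= x) l.

Definition is_node (l : seq nat) (r c : nat) : Prop :=
  1 <= r /\ 1 <= c <= part l r.

Definition arm_len (l : seq nat) (r c : nat) : nat := part l r - c.

Definition hook_len (l : seq nat) (r c : nat) : int :=
  (Posz (part l r) - Posz c + Posz (conjp l c) - Posz r + 1)%R.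

(* Arm sequences; A_0 is irrelevant here, the convention A_0 := 0 is used
   explicitly in [Aext] below. *)
Definition arm_seq (e : nat) (A : nat -> nat) : Prop :=
  (forall t, 1 <= t -> t.-1 <= A t <= (e - 1) * t) /\
  (forall t u, 1 <= t -> 1 <= u ->
     A (t + u) = A t + A u \/ A (t + u) = (A t + A u).+1).

Definition Aext (A : nat -> nat) (t : nat) : int :=
  if t == 0 then 0%R else Posz (A t).

Definition A_regular (e : nat) (A : nat -> nat) (l : seq nat) : Prop :=
  is_partition l /\
  forall r c, is_node l r c -> forall t, 1 <= t ->
    ~ (hook_len l r c = Posz (e * t) /\ arm_len l r c = A t).

Definition res (e : nat) (x : nat * nat) : int :=
  ((Posz x.2 - Posz x.1)%R %% Posz e)%Z.

(* The order on i-nodes: for (r,c),(s,d) with s - r + c - d = e t,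
   t >= 0, put (r,c) < (s,d) iff c - d <= A_t, and (s,d) < (r,c) otherwise;
   if t < 0 the roles of the two nodes are swapped.  (prec x y is the
   reflexive version "x <= y"; it is only used on distinct i-nodes.) *)
Definition prec (e : nat) (A : nat -> nat) (x y : nat * nat) : bool :=
  let: (r, c) := x in let: (s, d) := y in
  let k : int := (Posz s - Posz r + Posz c - Posz d)%R in
  if (0 <= k)%R then (Posz c - Posz d <= Aext A `|(k %/ Posz e)%Z|%N)%R
  else ~~ (Posz d - Posz c <= Aext A `|((- k)%R %/ Posz e)%Z|%N)%R.

(* addable / removable i-nodes, tagged true (= "+") / false (= "-") *)
Definition addable_nodes (e : nat) (i : 'I_e) (l : seq nat)
  : seq (bool * (nat * nat)) :=
  [seq (true, (r, (part l r).+1)) | r <- iota 1 (size l).+1 &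
     ((r == 1) || (part l r < part l r.-1)) &&
     (res e (r, (part l r).+1) == Posz (i : nat))].

Definition removable_nodes (e : nat) (i : 'I_e) (l : seq nat)
  : seq (bool * (nat * nat)) :=
  [seq (false, (r, part l r)) | r <- iota 1 (size l) &
     (part l r.+1 < part l r) && (res e (r, part l r) == Posz (i : nat))].

Fixpoint del_pm (w : seq (bool * (nat * nat))) : seq (bool * (nat * nat)) :=
  match w with
  | x :: ((y :: w') as tl) => if x.1 && ~~ y.1 then w' else x :: del_pm tl
  | _ => w
  end.

(* delete adjacent "+ -" pairs repeatedly (size w steps suffice) *)
Definition reduce_word (w : seq (bool * (nat * nat))) :=
  iter (size w) del_pm w.

Definition signature (e : nat) (A : nat -> nat) (i : 'I_e) (l : seq nat) :=
  sort (fun x y : bool * (nat * nat) => prec e A y.2 x.2)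
       (addable_nodes i l ++ removable_nodes i l).

(* f_i l : None stands for 0 *)
Definition fop (e : nat) (A : nat -> nat) (i : 'I_e) (l : seq nat)
  : option (seq nat) :=
  match [seq x <- reduce_word (signature A i l) | x.1] with
  | x :: _ => Some (incr_nth l x.2.1.-1)
  | [::] => None
  end.

Definition crystal_arrow (e : nat) (A : nat -> nat) (i : 'I_e)
  (l m : seq nat) : Prop := fop A i l = Some m.

Definition RA_vert (e : nat) (A : nat -> nat) (l : seq nat) : Prop :=
  A_regular e A l.
Definition RAn_vert (e : nat) (A : nat -> nat) (n : nat) (l : seq nat) : Prop :=
  A_regular e A l /\ sumn l <= n * e.

Definition crystal_iso (I : Type) (V1 V2 : seq nat -> Prop)
  (E1 E2 : I -> seq nat -> seq nat -> Prop) : Prop :=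
  exists (phi psi : seq nat -> seq nat),
    (forall l, V1 l -> V2 (phi l)) /\
    (forall l, V2 l -> V1 (psi l)) /\
    (forall l, V1 l -> psi (phi l) = l) /\
    (forall l, V2 l -> phi (psi l) = l) /\
    (forall i l m, V1 l -> V1 m -> (E1 i l m <-> E2 i (phi l) (phi m))).

(* Main.v *)
(* Both crystals are connected and graded, with the empty partition as unique
   source, so by Stembridge's argument they are isomorphic as soon as they obey
   the same local relations: the partition built by a word in the f_i in one
   crystal is matched with the one built by the same word in the other.

   An arm sequence A defines a translation-invariant total order on Z^2 which
   restricts to the order on i-nodes, and a partition is A-regular iff no end x
   of a row and end z of a column of suitable contents satisfy
   z - (0,1) < x < z + (1,0). Hence, if m is removable, s is addable, both have
   the same residue and m < s, then m <= s - (1,1). This and a variant for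
   corners show that e_i and f_i preserve A-regularity, that a nonempty A-regular
   partition has a good removable node, and that the orders on nodes of adjacent
   residues are compatible enough for Stembridge's relations on e_i, e_j to hold.
   The relations on f_i, f_j follow by rotating the complement of the partition
   by a half turn. *)
Require Import Defs.
From mathcomp Require Import all_boot all_order all_algebra zify.
From Stdlib Require Import FunctionalExtensionality ClassicalEpsilon.
Set Implicit Arguments. Unset Strict Implicit. Unset Printing Implicit Defensive.
Import Order.TTheory GRing.Theory Num.Theory.
Local Open Scope ring_scope.

(** * Uniqueness of graded crystals satisfying Stembridge's local relations *)

Section Uniqueness.
Variables (I : eqType) (T : Type) (cartan : I -> I -> int).

(* The axioms are only required up to size n; phi - eps plays the role of the
   weight. *)
Record crystal_axioms (n : nat) (top : T) (V : T -> Prop) (size : T -> nat)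
    (arr : I -> T -> T -> Prop) (eps phi : I -> T -> int) : Prop := {
  ca_top : V top;
  ca_size_top : size top = 0%N;
  ca_top_uniq x : V x -> size x = 0%N -> x = top;
  ca_fun i x y z : arr i x y -> arr i x z -> y = z;
  ca_inj i x y z : V y -> V z -> arr i y x -> arr i z x -> y = z;
  ca_V i x y : V x -> arr i x y -> V y;
  ca_size i x y : V x -> arr i x y -> size y = (size x).+1;
  ca_conn x : V x -> (0 < size x <= n)%N -> exists i y, V y /\ arr i y x;
  ca_eps0 i x : 0 <= eps i x;
  ca_eps i x : V x -> (size x <= n)%N -> 0 < eps i x ->
    exists y, V y /\ arr i y x;
  ca_epsS i x y : V x -> arr i x y -> (size y <= n)%N ->
    eps i y = eps i x + 1;
  ca_phi i x : V x -> (size x <= n)%N -> 0 < phi i x -> exists y, arr i x y;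
  ca_phiS i x y : V x -> arr i x y -> (size x <= n)%N -> 0 < phi i x;
  ca_wt i j x y : V x -> arr j x y -> (size y <= n)%N ->
    phi i y - eps i y = phi i x - eps i x - cartan i j;
  ca_e i j x1 x2 y : i != j -> V x1 -> V x2 -> (size y <= n)%N ->
    arr i x1 y -> arr j x2 y ->
    (exists z, [/\ V z, arr j z x1, arr i z x2
        & phi j x2 = phi j z \/ phi i x1 = phi i z]) \/
    (exists z c1 c2 d1 d2, [/\ V z, arr i z c1, arr j c1 c2 & arr j c2 x1] /\
       [/\ arr j z d1, arr i d1 d2, arr i d2 x2,
           phi j c1 <> phi j z & phi i d1 <> phi i z]);
  ca_f i j z x1 x2 : i != j -> V z -> (size z < n)%N ->
    arr i z x1 -> arr j z x2 ->
    phi j x1 = phi j z \/ phi i x2 = phi i z ->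
    exists y, arr j x1 y /\ arr i x2 y;
  ca_f4 i j z x1 x2 : i != j -> V z -> (size z + 3 < n.+1)%N ->
    arr i z x1 -> arr j z x2 ->
    phi j x1 <> phi j z -> phi i x2 <> phi i z ->
    exists a1 a2 b1 b2 y,
    [/\ arr j x1 a1, arr j a1 a2 & arr i a2 y] /\
    [/\ arr i x2 b1, arr i b1 b2 & arr j b2 y] }.

Inductive linked (top1 top2 : T) (arr1 arr2 : I -> T -> T -> Prop) :
    T -> T -> Prop :=
  | Linked_top : linked top1 top2 arr1 arr2 top1 top2
  | Linked_arr i x y x' y' : linked top1 top2 arr1 arr2 x y ->
      arr1 i x x' -> arr2 i y y' -> linked top1 top2 arr1 arr2 x' y'.

Lemma linked_sym top1 top2 arr1 arr2 x y :
  linked top1 top2 arr1 arr2 x y -> linked top2 top1 arr2 arr1 y x.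
Proof.
elim=> [|i x0 y0 x' y' _ R a1 a2]; first exact: Linked_top.
exact: Linked_arr R a2 a1.
Qed.

Variables (top : T) (size : T -> nat).

Definition matched (V1 V2 : T -> Prop) (arr1 arr2 : I -> T -> T -> Prop)
    (phi1 phi2 eps1 eps2 : I -> T -> int) (m : nat) : Prop :=
  [/\ forall x, V1 x -> (size x <= m)%N -> exists y, linked top top arr1 arr2 x y,
      forall x y, linked top top arr1 arr2 x y -> (size x <= m)%N ->
        [/\ V1 x, V2 y, size y = size x,
            forall i, phi1 i x = phi2 i y & forall i, eps1 i x = eps2 i y] &
      forall x y y', linked top top arr1 arr2 x y ->
        linked top top arr1 arr2 x y' -> (size x <= m)%N -> y = y'].

Section Step.
Variables (n m : nat) (V1 V2 : T -> Prop) (arr1 arr2 : I -> T -> T -> Prop).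
Variables (eps1 phi1 eps2 phi2 : I -> T -> int).
Hypothesis C1 : crystal_axioms n top V1 size arr1 eps1 phi1.
Hypothesis C2 : crystal_axioms n top V2 size arr2 eps2 phi2.
Hypothesis mn : (m < n)%N.
Hypothesis M : matched V1 V2 arr1 arr2 phi1 phi2 eps1 eps2 m.
Local Notation R := (linked top top arr1 arr2).

Lemma linked_lift i x x' y : R x y -> (size x <= m)%N -> arr1 i x x' ->
  exists2 y', arr2 i y y' & R x' y'.
Proof.
case: M => Mex Minv Muniq Rxy sx ax.
have [Vx Vy sy Ephi Eeps] := Minv _ _ Rxy sx.
have px : 0 < phi1 i x by apply: (ca_phiS C1 Vx ax); lia.
have sy' : (size y <= n)%N by lia.
have py : 0 < phi2 i y by rewrite -Ephi.
have [y' ay] := ca_phi C2 Vy sy' py.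
by exists y' => //; apply: Linked_arr Rxy ax ay.
Qed.

Lemma linked_inv x y : R x y -> (size x <= m.+1)%N ->
  [/\ V1 x, V2 y & size y = size x].
Proof.
move=> Rxy; elim: Rxy => [|i x0 y0 x' y' Rxy IH ax ay] sx.
  by split=> //; [apply: (ca_top C1) | apply: (ca_top C2)].
case: M => Mex Minv Muniq.
suff: [/\ V1 x0, V2 y0 & size y0 = size x0].
  case=> V0 W0 E; split; first exact: (ca_V C1 V0 ax).
    exact: (ca_V C2 W0 ay).
  by rewrite (ca_size C1 V0 ax) (ca_size C2 W0 ay) E.
case: (leqP (size x0) m.+1) => s0; first exact: IH.
exfalso; clear IH.
have: forall x y, R x y -> V1 x.
  move=> a b; elim=> [|? ? ? ? ? _ V a1 _]; first exact: (ca_top C1).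
  exact: (ca_V C1 V a1).
by move=> /(_ _ _ Rxy) V0; move: sx; rewrite (ca_size C1 V0 ax); lia.
Qed.

Lemma linked_last x y : R x y -> (0 < size x <= m.+1)%N ->
  exists i x0 y0, [/\ R x0 y0, arr1 i x0 x & arr2 i y0 y] /\
    [/\ V1 x0, V2 y0 & size x = (size x0).+1].
Proof.
case=> [|i x0 y0 x' y' Rxy ax ay]; first by rewrite (ca_size_top C1).
move=> /andP[_ sx].
have V0 : V1 x0.
  elim: Rxy => [|? ? ? ? ? _ V a1 _]; first exact: (ca_top C1).
  exact: (ca_V C1 V a1).
have sz := ca_size C1 V0 ax.
have [|_ W0 _] := linked_inv Rxy; first by lia.
by exists i, x0, y0.
Qed.

Lemma linked_uniq x y y' : R x y -> R x y' -> (size x <= m.+1)%N -> y = y'.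
Proof.
case: (M) => Mex Minv Muniq Rxy Rxy' sx.
case: (posnP (size x)) => [s0|sp].
  by apply: Muniq Rxy Rxy' _; rewrite s0.
have [|i [x1 [y1 [[R1 ax1 ay1] [V1' W1 s1]]]]] := linked_last Rxy; first by lia.
have [|j [x2 [y2 [[R2 ax2 ay2] [V2' W2 s2]]]]] := linked_last Rxy'; first by lia.
have lift : forall k a b a' b', R a b -> arr1 k a a' -> R a' b' ->
    (size a' <= m)%N -> arr2 k b b'.
  move=> k a b a' b' Rab aa Rab' sa.
  have Va : V1 a.
    elim: Rab => [|? ? ? ? ? _ V a1 _]; first exact: (ca_top C1).
    exact: (ca_V C1 V a1).
  have sza := ca_size C1 Va aa.
  have [|b2 ab Rb2] := linked_lift Rab _ aa; first by lia.
  by rewrite (Muniq _ _ _ Rab' Rb2 sa).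
case: (eqVneq i j) => [ij|nij].
  move: ax2 ay2; rewrite -ij => ax2 ay2.
  have E : x1 = x2 by apply: (ca_inj C1 V1' V2' ax1 ax2).
  have E' : y1 = y2 by apply: (Muniq x1) => //; [rewrite E|lia].
  by apply: (ca_fun C2 ay1); rewrite E'.
have [|[z [Vz az1 az2 N1]]|] := ca_e C1 nij V1' V2' _ ax1 ax2; first by lia.
  have sz := ca_size C1 Vz az1.
  have [|z' Rz] := Mex z Vz; first by lia.
  have bz1 : arr2 j z' y1 by apply: lift Rz az1 R1 _; lia.
  have bz2 : arr2 i z' y2 by apply: lift Rz az2 R2 _; lia.
  have [|_ Wz szz Ez _] := Minv _ _ Rz; first by lia.
  have [|_ _ _ E1 _] := Minv _ _ R1; first by lia.
  have [|_ _ _ E2 _] := Minv _ _ R2; first by lia.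
  have [| |w [bw1 bw2]] := ca_f C2 nij Wz _ bz2 bz1; first by lia.
    by rewrite -!Ez -E1 -E2.
  by rewrite (ca_fun C2 ay1 bw2) (ca_fun C2 ay2 bw1).
case=> z [c1 [c2 [d1 [d2 [[Vz ac1 ac2 ac3] [ad1 ad2 ad3 Nj Ni]]]]]].
have Vc1 := ca_V C1 Vz ac1; have Vc2 := ca_V C1 Vc1 ac2.
have Vd1 := ca_V C1 Vz ad1; have Vd2 := ca_V C1 Vd1 ad2.
have sc1 := ca_size C1 Vz ac1; have sc2 := ca_size C1 Vc1 ac2.
have sc3 := ca_size C1 Vc2 ac3.
have sd1 := ca_size C1 Vz ad1; have sd2 := ca_size C1 Vd1 ad2.
have [|z' Rz] := Mex z Vz; first by lia.
have [|c1' Rc1] := Mex c1 Vc1; first by lia.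
have [|c2' Rc2] := Mex c2 Vc2; first by lia.
have [|d1' Rd1] := Mex d1 Vd1; first by lia.
have [|d2' Rd2] := Mex d2 Vd2; first by lia.
have bc1 : arr2 i z' c1' by apply: lift Rz ac1 Rc1 _; lia.
have bc2 : arr2 j c1' c2' by apply: lift Rc1 ac2 Rc2 _; lia.
have bc3 : arr2 j c2' y1 by apply: lift Rc2 ac3 R1 _; lia.
have bd1 : arr2 j z' d1' by apply: lift Rz ad1 Rd1 _; lia.
have bd2 : arr2 i d1' d2' by apply: lift Rd1 ad2 Rd2 _; lia.
have bd3 : arr2 i d2' y2 by apply: lift Rd2 ad3 R2 _; lia.
have [|_ Wz szz Ez _] := Minv _ _ Rz; first by lia.
have [|_ _ _ Ec _] := Minv _ _ Rc1; first by lia.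
have [|_ _ _ Ed _] := Minv _ _ Rd1; first by lia.
have [| | |a1 [a2 [b1 [b2 [w [[g1 g2 g3] [h1 h2 h3]]]]]]] :=
  ca_f4 C2 nij Wz _ bc1 bd1; first by lia.
- by rewrite -Ec -Ez.
- by rewrite -Ed -Ez.
have E1 := ca_fun C2 g1 bc2; subst a1; have E2 := ca_fun C2 g2 bc3; subst a2.
have E3 := ca_fun C2 h1 bd2; subst b1; have E4 := ca_fun C2 h2 bd3; subst b2.
by rewrite (ca_fun C2 ay1 g3) (ca_fun C2 ay2 h3).
Qed.

Lemma linked_exists x : V1 x -> (size x <= m.+1)%N -> exists y, R x y.
Proof.
case: (M) => Mex Minv Muniq Vx sx.
case: (posnP (size x)) => [s0|sp]; first by apply: Mex; rewrite ?s0.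
have [|i [x0 [V0 ax]]] := ca_conn C1 Vx; first by lia.
have s0 := ca_size C1 V0 ax.
have [|y0 R0] := Mex x0 V0; first by lia.
have [|y ay Ry] := linked_lift R0 _ ax; first by lia.
by exists y.
Qed.

Lemma linked_eps_le i x y : R x y -> (size x <= m.+1)%N -> 0 < eps1 i x ->
  eps1 i x = eps2 i y.
Proof.
case: (M) => Mex Minv Muniq Rxy sx ex.
have [Vx Vy sy] := linked_inv Rxy sx.
have [|x0 [V0 ax]] := ca_eps C1 Vx _ ex; first by lia.
have s0 := ca_size C1 V0 ax.
have [|y0 R0] := Mex x0 V0; first by lia.
have [|y1 ay Ry] := linked_lift R0 _ ax; first by lia.
have E := linked_uniq Rxy Ry sx; subst y1.
have [|_ W0 sy0 _ Ee] := Minv _ _ R0; first by lia.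
by rewrite (ca_epsS C1 V0 ax) ?(ca_epsS C2 W0 ay) ?Ee //; lia.
Qed.

Lemma linked_wt i x y : R x y -> (size x <= m.+1)%N ->
  phi1 i top - eps1 i top = phi2 i top - eps2 i top ->
  phi1 i x - eps1 i x = phi2 i y - eps2 i y.
Proof.
move=> Rxy sx Etop; elim: Rxy sx => [//|j x0 y0 x' y' R0 IH ax ay] sx.
have V0 : V1 x0.
  elim: {IH} R0 => [|? ? ? ? ? _ V a1 _]; first exact: (ca_top C1).
  exact: (ca_V C1 V a1).
have s0 := ca_size C1 V0 ax.
have [|_ W0 sy0] := linked_inv R0; first by lia.
have s1 := ca_size C2 W0 ay.
rewrite (ca_wt C1 i V0 ax) ?(ca_wt C2 i W0 ay) ?IH //; lia.
Qed.
End Step.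

Lemma matched_all n V1 V2 arr1 arr2 eps1 phi1 eps2 phi2 :
  crystal_axioms n top V1 size arr1 eps1 phi1 ->
  crystal_axioms n top V2 size arr2 eps2 phi2 ->
  (forall i, phi1 i top - eps1 i top = phi2 i top - eps2 i top) ->
  forall m, (m <= n)%N ->
  matched V1 V2 arr1 arr2 phi1 phi2 eps1 eps2 m /\
  matched V2 V1 arr2 arr1 phi2 phi1 eps2 eps1 m.
Proof.
have base W1 W2 b1 b2 e1 p1 e2 p2 : crystal_axioms n top W1 size b1 e1 p1 ->
    crystal_axioms n top W2 size b2 e2 p2 ->
    (forall i, p1 i top - e1 i top = p2 i top - e2 i top) ->
    matched W1 W2 b1 b2 p1 p2 e1 e2 0.
  move=> D1 D2 Etop.
  have top0 W b e p : crystal_axioms n top W size b e p -> forall i, e i top = 0.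
    move=> D i; apply/eqP; rewrite eq_le (ca_eps0 D) andbT leNgt.
    apply/negP => /(ca_eps D (ca_top D)); rewrite (ca_size_top D) => /(_ isT).
    by case=> y [Vy /(ca_size D Vy)]; rewrite (ca_size_top D).
  have lnk0 x y : linked top top b1 b2 x y -> (size x <= 0)%N -> x = top /\ y = top.
    case=> [//|i x0 y0 x' y' R0 ax ay].
    have V0 : W1 x0.
      elim: R0 => [|? ? ? ? ? _ V a1 _]; first exact: (ca_top D1).
      exact: (ca_V D1 V a1).
    by rewrite (ca_size D1 V0 ax).
  split.
  - move=> x Vx sx; exists top; rewrite (ca_top_uniq D1 Vx) //; first exact: Linked_top.
    by lia.
  - move=> x y Rxy sx; have [-> ->] := lnk0 _ _ Rxy sx.
    split=> //; [exact: (ca_top D1)|exact: (ca_top D2)| |]; move=> i.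
      by move: (Etop i); rewrite (top0 _ _ _ _ D1) (top0 _ _ _ _ D2) !subr0.
    by rewrite (top0 _ _ _ _ D1) (top0 _ _ _ _ D2).
  move=> x y y' Rxy Rxy' sx.
  by have [_ ->] := lnk0 _ _ Rxy sx; have [_ ->] := lnk0 _ _ Rxy' sx.
have step W1 W2 b1 b2 e1 p1 e2 p2 m : crystal_axioms n top W1 size b1 e1 p1 ->
    crystal_axioms n top W2 size b2 e2 p2 ->
    (forall i, p1 i top - e1 i top = p2 i top - e2 i top) -> (m < n)%N ->
    matched W1 W2 b1 b2 p1 p2 e1 e2 m -> matched W2 W1 b2 b1 p2 p1 e2 e1 m ->
    matched W1 W2 b1 b2 p1 p2 e1 e2 m.+1.
  move=> D1 D2 Etop mn M M'; split.
  - exact: linked_exists D1 D2 mn M.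
  - move=> x y Rxy sx; have [Vx Vy sy] := linked_inv D1 D2 mn M Rxy sx.
    have Ee i : e1 i x = e2 i y.
      have Ryx : linked top top b2 b1 y x by exact: linked_sym.
      case: (ltP 0 (e1 i x)) => [p|le1].
        exact: (linked_eps_le D1 D2 mn M Rxy).
      case: (ltP 0 (e2 i y)) => [p|le2].
        by apply/esym/(linked_eps_le D2 D1 mn M' Ryx) => //; lia.
      by have := ca_eps0 D1 i x; have := ca_eps0 D2 i y; lia.
    split=> // i.
    by have := linked_wt D1 D2 mn M Rxy sx (Etop i); rewrite (Ee i); lia.
  - exact: linked_uniq D1 D2 mn M.
move=> D1 D2 Etop; elim=> [|m IH] mn; first by split; apply: base.
by have [M M'] := IH (ltnW mn); split; apply: step.
Qed.
End Uniqueness.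

Section Isomorphism.
Variables (I : eqType) (cartan : I -> I -> int) (top : seq nat) (size : seq nat -> nat).
Variables (V1 V2 : seq nat -> Prop) (arr1 arr2 : I -> seq nat -> seq nat -> Prop).
Hypothesis crystals : forall n : nat, exists eps1 phi1 eps2 phi2,
  [/\ crystal_axioms cartan n top V1 size arr1 eps1 phi1,
      crystal_axioms cartan n top V2 size arr2 eps2 phi2 &
      forall i, phi1 i top - eps1 i top = phi2 i top - eps2 i top].

Lemma crystal_iso_of_axioms :
  exists (f g : seq nat -> seq nat),
   [/\ forall l, V1 l -> V2 (f l) /\ size (f l) = size l,
       forall l, V2 l -> V1 (g l) /\ size (g l) = size l,
       forall l, V1 l -> g (f l) = l,
       forall l, V2 l -> f (g l) = l &
       forall i l m, V1 l -> V1 m -> (arr1 i l m <-> arr2 i (f l) (f m))].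
Proof.
pose R := linked top top arr1 arr2.
have Rtot x : V1 x -> exists y, R x y.
  move=> Vx; have [? [? [? [? [D1 D2 E]]]]] := crystals (size x).
  by have [[h _ _] _] := matched_all D1 D2 E (leqnn _); apply: h.
have Rtot' y : V2 y -> exists x, R x y.
  move=> Vy; have [? [? [? [? [D1 D2 E]]]]] := crystals (size y).
  have [_ [h _ _]] := matched_all D1 D2 E (leqnn _).
  by have [x Rx] := h _ Vy (leqnn _); exists x; apply: linked_sym.
have Rinv x y : R x y -> [/\ V1 x, V2 y & size y = size x].
  move=> Rxy; have [? [? [? [? [D1 D2 E]]]]] := crystals (size x).
  by have [[_ h _] _] := matched_all D1 D2 E (leqnn _); have [] := h _ _ Rxy (leqnn _).
have Runiq x y y' : R x y -> R x y' -> y = y'.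
  move=> Rxy Rxy'; have [? [? [? [? [D1 D2 E]]]]] := crystals (size x).
  by have [[_ _ h] _] := matched_all D1 D2 E (leqnn _); apply: h Rxy Rxy' _.
have Runiq' x x' y : R x y -> R x' y -> x = x'.
  move=> Rxy Rxy'; have [? [? [? [? [D1 D2 E]]]]] := crystals (size y).
  have [_ [_ _ h]] := matched_all D1 D2 E (leqnn _).
  by apply: h (linked_sym Rxy) (linked_sym Rxy') _.
pose f x := epsilon (inhabits top) (R x).
pose g y := epsilon (inhabits top) (fun x => R x y).
have fP x : V1 x -> R x (f x) by move=> /Rtot h; apply: epsilon_spec.
have gP y : V2 y -> R (g y) y by move=> /Rtot' h; apply: (epsilon_spec _ _ h).
have arrP i x x' y y' : R x y -> R x' y' -> arr1 i x x' -> arr2 i y y'.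
  move=> Rxy Rxy' ax.
  have [? [? [? [? [D1 D2 E]]]]] := crystals (size x).+1.
  have [M _] := matched_all D1 D2 E (leqnSn _).
  have [y2 ay R2] := linked_lift D1 D2 (ltnSn _) M Rxy (leqnn _) ax.
  by rewrite (Runiq _ _ _ Rxy' R2).
have arrP' i x x' y y' : R x y -> R x' y' -> arr2 i y y' -> arr1 i x x'.
  move=> Rxy Rxy' ay.
  have [? [? [? [? [D1 D2 E]]]]] := crystals (size y).+1.
  have [_ M] := matched_all D1 D2 E (leqnSn _).
  have [x2 ax R2] := linked_lift D2 D1 (ltnSn _) M (linked_sym Rxy) (leqnn _) ay.
  by rewrite (Runiq' _ _ _ Rxy' (linked_sym R2)).
exists f, g; split.
- by move=> l /fP/Rinv[].
- by move=> l /gP/Rinv[].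
- by move=> l Vl; have h := fP _ Vl; have [_ W _] := Rinv _ _ h; apply: Runiq' (gP _ W) h.
- by move=> l Vl; have h := gP _ Vl; have [W _ _] := Rinv _ _ h; apply: Runiq (fP _ W) h.
move=> i l m Vl Vm; split; first exact: arrP (fP _ Vl) (fP _ Vm).
exact: arrP' (fP _ Vl) (fP _ Vm).
Qed.
End Isomorphism.

(** * Order ideals in an ordered lattice *)

Notation point := (int * int)%type.
Definition east : point := (0, 1).
Definition south : point := (1, 0).
Definition content (w : point) : int := w.2 - w.1.

Ltac clear_props :=
  repeat match goal with H : ?T |- _ => match type of T with Prop => clear H end end.
Ltac lia_goal := clear_props; lia.
Ltac vec := clear_props; apply: injective_projections; rewrite /east /south /=; lia.

Ltac ptneq :=
  clear_props; let h := fresh in apply/eqP => h; have := congr1 fst h; have := congr1 snd h; clear h;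
  rewrite /east /south /=; lia.

(* Positive cones of total group orders on Z^2 for which both unit vectors are
   positive; only such an order is needed from an arm sequence. *)
Record good_order (pos : point -> bool) : Prop := {
  pos_add a b : pos a -> pos b -> pos (a + b);
  pos_opp a : a != 0 -> pos (- a) = ~~ pos a;
  pos_zero : pos 0 = false;
  pos_east : pos east;
  pos_south : pos south }.

Definition unit_pair (u v : point) : Prop :=
  (u = east /\ v = south) \/ (u = south /\ v = east).

Lemma unit_pair_sym u v : unit_pair u v -> unit_pair v u.
Proof. by case=> -[-> ->]; [right|left]. Qed.

Section Order.
Variable pos : point -> bool.
Hypothesis O : good_order pos.

Definition leq_pt (x y : point) : bool := (y == x) || pos (y - x).
Local Notation "x ⪯ y" := (leq_pt x y) (at level 70).
Local Notation "x ≺ y" := (pos (y - x)) (at level 70).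

Lemma pos_neq0 a : pos a -> a = 0 -> False.
Proof. by move=> + E; rewrite E (pos_zero O). Qed.
Lemma pos_sum2_neq0 a b : pos a -> pos b -> a + b = 0 -> False.
Proof. by move=> /(pos_add O) h /h /pos_neq0. Qed.
Lemma pos_sum3_neq0 a b c : pos a -> pos b -> pos c -> a + b + c = 0 -> False.
Proof. by move=> /(pos_add O) h /h; apply: pos_sum2_neq0. Qed.
Lemma pos_sum4_neq0 a b c d : pos a -> pos b -> pos c -> pos d -> a + b + c + d = 0 -> False.
Proof. by move=> /(pos_add O) h /h; apply: pos_sum3_neq0. Qed.

Lemma pos_eq a b : pos a -> a = b -> pos b.
Proof. by move=> h <-. Qed.
Lemma pos_add_eq a b c : pos a -> pos b -> a + b = c -> pos c.
Proof. by move=> /(pos_add O) h /h h' <-. Qed.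

Lemma pt_lt_or x y : [\/ x ≺ y, y ≺ x | x = y].
Proof.
case: (eqVneq x y) => [->|n]; first by constructor 3.
have := @pos_opp _ O (x - y); rewrite subr_eq0 n opprB => /(_ isT).
by case: (pos (x - y)) => /= h; [constructor 2|constructor 1].
Qed.

Lemma pt_ltNle x y : (x ≺ y) = ~~ (y ⪯ x).
Proof.
rewrite /leq_pt; case: (eqVneq x y) => [->|n] /=; first by rewrite subrr (pos_zero O).
by rewrite -(pos_opp O) ?opprB // subr_eq0.
Qed.

Lemma pt_leNlt x y : (x ⪯ y) = ~~ (y ≺ x).
Proof. by rewrite pt_ltNle negbK. Qed.

Lemma pt_lexx x : x ⪯ x. Proof. by rewrite /leq_pt eqxx. Qed.
Lemma pt_ltW x y : x ≺ y -> x ⪯ y. Proof. by rewrite /leq_pt => ->; rewrite orbT. Qed.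
Lemma pt_ltxx x : x ≺ x = false. Proof. by rewrite subrr (pos_zero O). Qed.

Lemma pt_lt_trans y x z : x ≺ y -> y ≺ z -> x ≺ z.
Proof. by move=> a b; apply: (pos_add_eq a b); vec. Qed.
Lemma pt_lt_le_trans y x z : x ≺ y -> y ⪯ z -> x ≺ z.
Proof. by move=> a /orP[/eqP->//|]; apply: pt_lt_trans a. Qed.
Lemma pt_le_lt_trans y x z : x ⪯ y -> y ≺ z -> x ≺ z.
Proof. by move=> /orP[/eqP->//|a]; apply: pt_lt_trans a. Qed.
Lemma pt_le_trans y x z : x ⪯ y -> y ⪯ z -> x ⪯ z.
Proof. by move=> a /orP[/eqP->//|b]; apply/pt_ltW/(pt_le_lt_trans a b). Qed.
Lemma pt_lt_geF x y : x ≺ y -> (y ⪯ x) = false.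
Proof. by rewrite pt_ltNle => /negbTE. Qed.
Lemma pt_neq_lt x y : x ≺ y -> (x == y) = false.
Proof. by case: eqVneq => // ->; rewrite pt_ltxx. Qed.
Lemma pt_neq_gt x y : x ≺ y -> (y == x) = false.
Proof. by rewrite eq_sym => /pt_neq_lt. Qed.

Lemma min_seq (s : seq point) : s != [::] -> exists2 m, m \in s & forall w, w \in s -> m ⪯ w.
Proof.
elim: s => // x s IH _; case: (altP (s =P [::])) => [->|/IH [m ms h]].
  by exists x => [|w]; rewrite !inE // => /eqP->; apply: pt_lexx.
case: (boolP (x ⪯ m)) => xm.
  exists x; first exact: mem_head.
  by move=> w; rewrite inE => /orP[/eqP->|/h]; [apply: pt_lexx|apply: pt_le_trans].
exists m; first by rewrite inE ms orbT.
move=> w; rewrite inE => /orP[/eqP->|/h //].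
by apply: pt_ltW; rewrite pt_ltNle.
Qed.

Lemma max_seq (s : seq point) : s != [::] -> exists2 m, m \in s & forall w, w \in s -> w ⪯ m.
Proof.
elim: s => // x s IH _; case: (altP (s =P [::])) => [->|/IH [m ms h]].
  by exists x => [|w]; rewrite !inE // => /eqP->; apply: pt_lexx.
case: (boolP (m ⪯ x)) => xm.
  exists x; first exact: mem_head.
  move=> w; rewrite inE => /orP[/eqP->|/h h1]; first exact: pt_lexx.
  exact: pt_le_trans h1 xm.
exists m; first by rewrite inE ms orbT.
move=> w; rewrite inE => /orP[/eqP->|/h //].
by apply: pt_ltW; rewrite pt_ltNle.
Qed.

Definition down_closed (lam : point -> bool) : Prop :=
  forall w, lam w -> lam (w - east) /\ lam (w - south).
Definition addable (lam : point -> bool) w :=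
  [&& ~~ lam w, lam (w - east) & lam (w - south)].
Definition removable (lam : point -> bool) w :=
  [&& lam w, ~~ lam (w + east) & ~~ lam (w + south)].
Definition sg (lam : point -> bool) w : int :=
  (addable lam w : nat)%:Z - (removable lam w : nat)%:Z.
Definition del (lam : point -> bool) (x : point) := fun w => lam w && (w != x).

(* Removing the node x either turns x + u from addable to neither, or x - v
   from neither to removable. *)
Definition side (u v : point) (lam : point -> bool) (x : point) : point :=
  if lam (x + u - v) then x + u else x - v.

Lemma down_closed_del lam x : down_closed lam -> removable lam x -> down_closed (del lam x).
Proof.
move=> sh /and3P[lx nE nS] w /andP[lw wx].
have [h1 h2] := sh _ lw; rewrite /del h1 h2 /=; split.
  apply/eqP => E; move: nE; rewrite -E.
  by rewrite (_ : w - east + east = w) ?lw //; vec.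
apply/eqP => E; move: nS; rewrite -E.
by rewrite (_ : w - south + south = w) ?lw //; vec.
Qed.

Lemma down_closed_unit u v lam w : unit_pair u v -> down_closed lam -> lam w ->
  lam (w - u) /\ lam (w - v).
Proof. by case=> -[-> ->] sh /sh[]. Qed.

Lemma addable_unit u v lam w : unit_pair u v ->
  addable lam w = [&& ~~ lam w, lam (w - u) & lam (w - v)].
Proof. by case=> -[-> ->] //; rewrite /addable (andbC (lam (w - south))). Qed.

Lemma removable_unit u v lam w : unit_pair u v ->
  removable lam w = [&& lam w, ~~ lam (w + u) & ~~ lam (w + v)].
Proof. by case=> -[-> ->] //; rewrite /removable (andbC (~~ lam (w + south))). Qed.

Lemma sg_del lam x w : down_closed lam -> removable lam x ->
  sg (del lam x) w = sg lam w + 2 * (w == x : nat)%:Z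
    - (w == side east south lam x : nat)%:Z - (w == side south east lam x : nat)%:Z.
Proof.
move=> sh rx; have /and3P[lx nE nS] := rx.
have [lxE lxS] := sh _ lx.
have E1 : x + east - east = x by vec.
have E2 : x + south - south = x by vec.
have E3 : x - east + east = x by vec.
have E4 : x - south + south = x by vec.
have E5 : x + south - east = x - east + south by vec.
have E6 : x + east - south = x - south + east by vec.
rewrite /sg /addable /removable /del /side.
case: (eqVneq w x) => [->|n0].
  rewrite lx lxE lxS (negbTE nE) (negbTE nS) ?eqxx /= ?andbF /=.
  have -> : x - east != x by ptneq.
  have -> : x - south != x by ptneq.
  have -> : (x == if lam (x + east - south) then x + east else x - south) = false.
    by case: ifP => _; ptneq.
  have -> : (x == if lam (x + south - east) then x + south else x - east) = false.
    by case: ifP => _; ptneq.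
  by [].
case: (eqVneq w (x + east)) => [->|n1].
  rewrite E1 eqxx (negbTE nE) lx /=.
  have -> : (x + east == if lam (x + south - east) then x + south else x - east) = false.
    by case: ifP => _; ptneq.
  case: ifP => _ /=; first by rewrite eqxx.
  by have -> : (x + east == x - south) = false by ptneq.
case: (eqVneq w (x + south)) => [->|n2].
  rewrite E2 eqxx (negbTE nS) lx /= !andbF andbT.
  have -> : (x + south == if lam (x + east - south) then x + east else x - south) = false.
    by case: ifP => _; ptneq.
  case: ifP => _ /=; first by rewrite eqxx.
  by have -> : (x + south == x - east) = false by ptneq.
case: (eqVneq w (x - south)) => [->|n3].
  rewrite E4 eqxx lxS lx /= ?andbF ?andbT -E6 /=.
  have -> : x + east - south != x by ptneq.
  have -> : (x - south == if lam (x + south - east) then x + south else x - east) = false.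
    by case: ifP => _; ptneq.
  rewrite /= andbT; case: ifP => _ /=; last by rewrite eqxx.
  by have -> : (x - south == x + east) = false by ptneq.
case: (eqVneq w (x - east)) => [->|n4].
  rewrite E3 eqxx lxE lx /= ?andbF ?andbT -E5 /=.
  have -> : x + south - east != x by ptneq.
  have -> : (x - east == if lam (x + east - south) then x + east else x - south) = false.
    by case: ifP => _; ptneq.
  rewrite /= andbT; case: ifP => _ /=; last by rewrite eqxx.
  by have -> : (x - east == x + south) = false by ptneq.
have -> : w - east != x by rewrite subr_eq.
have -> : w - south != x by rewrite subr_eq.
have -> : w + east != x by rewrite -[x](addrK east) addrAC (inj_eq (addIr _)).
have -> : w + south != x by rewrite -[x](addrK south) addrAC (inj_eq (addIr _)).
have -> : (w == if lam (x + east - south) then x + east else x - south) = false.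
  by case: ifP => _; apply: negbTE.
have -> : (w == if lam (x + south - east) then x + south else x - east) = false.
  by case: ifP => _; apply: negbTE.
rewrite !andbT /= mulr0; clear_props; lia.
Qed.
Variables (e N : nat).

Definition zrange : seq int := [seq k%:Z - N%:Z | k <- iota 0 (N.*2.+1)].
Definition box : seq point := [seq (a, b) | a <- zrange, b <- zrange].
Definition inb (k : nat) (w : point) : bool :=
  (`|w.1| + k%:Z <= N%:Z) && (`|w.2| + k%:Z <= N%:Z).

Definition edvd (a : int) : bool := (e %| a)%Z.

Lemma edvd0 : edvd 0. Proof. exact: dvdz0. Qed.
Lemma edvdN a : edvd (- a) = edvd a. Proof. by rewrite /edvd rpredN. Qed.
Lemma dvd_add (a b c : int) : edvd a -> edvd b -> c = a + b -> edvd c.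
Proof. by rewrite /edvd => ha hb ->; apply: rpredD. Qed.
Lemma dvd_sub (a b c : int) : edvd a -> edvd b -> c = a - b -> edvd c.
Proof. by rewrite /edvd => ha hb ->; apply: rpredB. Qed.
Lemma dvd_small (a b : int) : edvd a -> edvd b -> `|a - b| < e%:Z -> a = b.
Proof.
move=> ha hb lt; have : edvd (a - b) by exact: (dvd_sub ha hb).
rewrite /edvd dvdzE /= => /dvdn_leq h; case: (posnP `|a - b|%N) => [|/h]; first by lia.
by move: lt; lia.
Qed.

Lemma mem_zrange a : (a \in zrange) = (`|a| <= N%:Z).
Proof.
apply/mapP/idP => [[k]|h]; first by rewrite mem_iota => /andP[_ hk] ->; lia.
by exists `|(a + N%:Z)%R|%N; rewrite ?mem_iota; move: h; lia.
Qed.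

Lemma mem_box w : (w \in box) = inb 0 w.
Proof.
rewrite /inb !addr0 -!mem_zrange; apply/allpairsP/andP => [[[a b] [ha hb ->]]|[h1 h2]].
  by split.
by exists (w.1, w.2); split=> //; case: w {h1 h2}.
Qed.

Lemma uniq_box : uniq box.
Proof.
have uz : uniq zrange.
  by rewrite map_inj_uniq ?iota_uniq // => a b; lia.
by apply: allpairs_uniq => // -[a b] [c d].
Qed.

Definition inres (i : int) (w : point) : bool := edvd (content w - i).

(* Minus signs less plus signs in the i-signature read from its start down to
   z. The surviving minus signs are the records of this function, so its maximum
   eps counts them and its first maximum is the node removed by e_i. Nodes
   outside the box are ignored: N must be large compared with lam. *)
Definition ht (lam : point -> bool) (i : int) (z : point) : int :=
  - \sum_(w <- box | inres i w && (z ⪯ w)) sg lam w.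

Lemma sum_eq_pt (P : pred point) x : x \in box ->
  \sum_(w <- box | P w) (w == x : nat)%:Z = (P x : nat)%:Z.
Proof.
move=> xb; rewrite big_mkcond (bigD1_seq x) ?uniq_box //= eqxx big1 ?addr0.
  by case: (P x).
by move=> w /negbTE->; case: ifP.
Qed.

Lemma ht_split lam i z :
  ht lam i z = - \sum_(w <- box | inres i w && (z ≺ w)) sg lam w
     - (if (z \in box) && inres i z then sg lam z else 0).
Proof.
rewrite /ht -opprD; congr (- _).
have -> : \sum_(w <- box | inres i w && (z ⪯ w)) sg lam w =
  \sum_(w <- box | inres i w && (z ≺ w)) sg lam w +
  \sum_(w <- box | inres i w && (w == z)) sg lam w.
  rewrite big_mkcond [X in _ = X + _]big_mkcond [X in _ = _ + X]big_mkcond -big_split /=; apply: eq_bigr => w _.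
  rewrite /leq_pt; case: (inres i w) => //=; case: eqVneq => [->|n] /=.
    by rewrite pt_ltxx add0r.
  by rewrite addr0.
congr (_ + _); case: (boolP (z \in box)) => zb /=.
  rewrite big_mkcond (bigD1_seq z) ?uniq_box //= eqxx andbT big1 ?addr0 //.
  by move=> w /negbTE->; rewrite andbF.
rewrite big_seq_cond big1 // => w /and3P[wb _ /eqP E].
by move: zb; rewrite -E wb.
Qed.

Lemma ht_next lam i z :
  let h := - \sum_(w <- box | inres i w && (z ≺ w)) sg lam w in
  h = 0 \/ exists2 z', z' \in box & z ≺ z' /\ h = ht lam i z'.
Proof.
move=> h; pose s := [seq w <- box | z ≺ w].
case: (altP (s =P [::])) => [E|/min_seq [m]].
  left; rewrite /h big_seq_cond big1 ?oppr0 // => w /and3P[wb _ zw].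
  by have: w \in s; [rewrite mem_filter zw|rewrite E].
rewrite mem_filter => /andP[zm mb] mmin; right; exists m => //; split=> //.
rewrite /h /ht; congr (- _).
rewrite big_seq_cond [RHS]big_seq_cond; apply: eq_bigl => w.
case: (boolP (w \in box)) => //= wb; case: (inres i w) => //=.
apply/idP/idP => [zw|mw]; last exact: pt_lt_le_trans zm mw.
by apply: mmin; rewrite mem_filter zw.
Qed.

Lemma ht_box lam i z :
  ht lam i z = 0 \/ exists2 z', z' \in box & z ⪯ z' /\ ht lam i z = ht lam i z'.
Proof.
case: (boolP (z \in box)) => zb.
  by right; exists z => //; split=> //; apply: pt_lexx.
rewrite ht_split (negbTE zb) /= subr0.
have [|[z' zb' [zz' E]]] := ht_next lam i z; first by left.
by right; exists z' => //; split=> //; apply: pt_ltW.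
Qed.

Definition firstmax (h : point -> int) (x : point) : Prop :=
  (forall z, h z <= h x) /\ (forall z, x ≺ z -> h z < h x).

Definition good (lam : point -> bool) (i : int) (x : point) : Prop :=
  firstmax (ht lam i) x /\ 0 < ht lam i x.

Lemma good_removable lam i x : good lam i x ->
  [/\ x \in box, inres i x & removable lam x].
Proof.
case=> -[hm hf] hp.
have lt1 : - (\sum_(w <- box | inres i w && (x ≺ w)) sg lam w) < ht lam i x.
  have [->//|[z' _ [xz ->]]] := ht_next lam i x; exact: hf.
move: (ht_split lam i x); case: ifP => [/andP[xb ri] E|_ E]; last by lia.
split=> //; move: E lt1; rewrite /sg; case: (removable lam x) => //.
by case: (addable lam x); lia.
Qed.

Lemma good_strict lam i x : good lam i x ->
  - (\sum_(w <- box | inres i w && (x ≺ w)) sg lam w) = ht lam i x - 1.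
Proof.
move=> g; have [xb ri rx] := good_removable g.
rewrite ht_split xb ri /= /sg rx.
by have /and3P[lx _ _] := rx; rewrite /addable lx /=; lia.
Qed.

Lemma good_exists lam i z : 0 < ht lam i z -> exists2 x, good lam i x & ht lam i z <= ht lam i x.
Proof.
move=> hz; have [E|[z' zb [_ Ez]]] := ht_box lam i z; first by rewrite E in hz.
have [m [z0 [zb0 Em]] mmax] : exists2 m, exists z0, z0 \in box /\ ht lam i z0 = m &
    forall w, w \in box -> ht lam i w <= m.
  have : box != [::] by apply/eqP => E; rewrite E in zb.
  elim: (box) => // a s IH _; case: (altP (s =P [::])) => [->|/IH [m [w [ws Ew]] mm]].
    exists (ht lam i a); first by exists a; rewrite mem_head.
    by move=> w; rewrite inE => /eqP->.
  case: (leP (ht lam i a) m) => am.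
    exists m; first by exists w; rewrite inE ws orbT.
    by move=> w'; rewrite inE => /orP[/eqP->|/mm].
  exists (ht lam i a); first by exists a; rewrite mem_head.
  move=> w'; rewrite inE => /orP[/eqP->//|/mm]; lia.
pose s := [seq w <- box | ht lam i w == m].
have [|x] := @max_seq s.
  by apply/eqP => E; have: z0 \in s; [rewrite mem_filter Em eqxx|rewrite E].
rewrite mem_filter => /andP[/eqP Ex xb] xmax.
have mp : 0 < m by have := mmax _ zb; lia.
have bound w : ht lam i w <= m.
  have [->|[w' wb [_ ->]]] := ht_box lam i w; first by lia.
  exact: mmax.
exists x; last by rewrite Ex.
split; last by rewrite Ex.
split=> [w|w xw]; rewrite Ex //.
rewrite lt_neqAle bound andbT; apply/eqP => Ew.
have [E0|[w' wb [ww' Ew']]] := ht_box lam i w; first by lia.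
have : w' ⪯ x by apply: xmax; rewrite mem_filter -Ew' Ew eqxx.
by rewrite pt_leNlt (pt_lt_le_trans xw ww').
Qed.

Definition eps (lam : point -> bool) (i : int) : int :=
  \big[Num.max/0]_(z <- box) Num.max 0 (ht lam i z).

Lemma eps_ge0 lam i : 0 <= eps lam i.
Proof.
rewrite /eps; elim: (box) => [|a s IH]; first by rewrite big_nil.
by rewrite big_cons; lia.
Qed.

Lemma ht_le_eps lam i z : ht lam i z <= eps lam i.
Proof.
have [->|[z' zb [_ ->]]] := ht_box lam i z; first exact: eps_ge0.
rewrite /eps; elim: (box) zb => // a s IH; rewrite inE big_cons => /orP[/eqP->|/IH h].
  by rewrite !le_max lexx orbT.
by rewrite le_max h orbT.
Qed.

Lemma eps_cases lam i : eps lam i = 0 \/ exists2 z, z \in box & eps lam i = ht lam i z.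
Proof.
rewrite /eps; elim: (box) => [|a s IH]; first by left; rewrite big_nil.
rewrite big_cons.
case: IH => [->|[z zs ->]].
  case: (leP (ht lam i a) 0) => h; first by left; lia.
  by right; exists a; rewrite ?mem_head //; lia.
case: (leP (ht lam i a) (ht lam i z)) => h.
  case: (leP (ht lam i z) 0) => h0; first by left; lia.
  by right; exists z; rewrite ?inE ?zs ?orbT //; lia.
case: (leP (ht lam i a) 0) => h0; first by left; lia.
by right; exists a; rewrite ?mem_head //; lia.
Qed.

Lemma eps_good lam i x : good lam i x -> eps lam i = ht lam i x.
Proof.
case=> -[hm _] hp; apply/eqP; rewrite eq_le ht_le_eps andbT.
have [->|[z _ ->]] := eps_cases lam i; first exact: ltW.
exact: hm.
Qed.

Lemma good_of_eps lam i : 0 < eps lam i -> exists2 x, good lam i x & ht lam i x = eps lam i.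
Proof.
have [->//|[z _ E]] := eps_cases lam i; rewrite E => /good_exists[x gx _].
by exists x => //; rewrite -(eps_good gx).
Qed.

Lemma good_uniq lam i x y : good lam i x -> good lam i y -> x = y.
Proof.
move=> gx gy; have E := eps_good gx; rewrite (eps_good gy) in E.
case: gx gy => -[_ hx] _ [[_ hy] _].
by have [/hx|/hy|//] := pt_lt_or x y; rewrite E ltxx.
Qed.

Section Del.
Variables (lam : point -> bool) (x : point) (i : int).
Hypotheses (sh : down_closed lam) (rx : removable lam x) (ri : inres i x) (xb : inb 1 x).
Hypothesis e3 : (3 <= e)%N.

Lemma inb_unit u v k w : unit_pair u v -> inb k.+1 w ->
  [/\ inb k (w + u), inb k (w - u), inb k (w + v) & inb k (w - v)].
Proof. by case=> -[-> ->] h; split; move: h; rewrite /inb /east /south /=; clear_props; lia. Qed.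

Lemma inbW k w : inb k.+1 w -> inb k w.
Proof. by rewrite /inb; clear_props; lia. Qed.

Lemma side_box u v : unit_pair u v -> side u v lam x \in box.
Proof.
move=> uv; have [h1 h2 h3 h4] := inb_unit uv xb.
by rewrite mem_box /side; case: ifP.
Qed.

Lemma content_side u v : unit_pair u v -> content (side u v lam x) = content x + content u.
Proof. by case=> -[-> ->]; rewrite /side /content /east /south; case: ifP => _ /=; clear_props; lia. Qed.

Lemma ht_del_sum k z :
  ht (del lam x) k z = ht lam k z - 2 * (inres k x && (z ⪯ x) : nat)%:Z
   + (inres k (side east south lam x) && (z ⪯ side east south lam x) : nat)%:Z
   + (inres k (side south east lam x) && (z ⪯ side south east lam x) : nat)%:Z.
Proof.
rewrite /ht; have E w := sg_del w sh rx.
under eq_bigr do rewrite E.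
rewrite 2!sumrB big_split /= -mulr_sumr !sum_eq_pt.
- by move: (\sum_(w <- box | _) sg lam w) => S; clear_props; lia.
- by apply: side_box; right.
- by apply: side_box; left.
- by rewrite mem_box inbW.
Qed.

Lemma ht_del_self z : ht (del lam x) i z = ht lam i z - 2 * (z ⪯ x : nat)%:Z.
Proof.
rewrite ht_del_sum ri /=.
have -> : inres i (side east south lam x) = false.
  apply/negP; rewrite /inres content_side; last by left.
  by move/dvd_small => /(_ _ ri); rewrite /content /east /=; lia.
have -> : inres i (side south east lam x) = false.
  apply/negP; rewrite /inres content_side; last by right.
  by move/dvd_small => /(_ _ ri); rewrite /content /south /=; lia.
by rewrite /=; lia.
Qed.

Lemma ht_del_adj u v j z : unit_pair u v -> edvd (j - i - content u) ->
  ht (del lam x) j z = ht lam j z + (z ⪯ side u v lam x : nat)%:Z.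
Proof.
move=> uv ji; rewrite ht_del_sum.
have r1 : inres j (side u v lam x).
  by rewrite /inres content_side //; apply: dvd_sub ri ji _; lia.
have r2 : inres j (side v u lam x) = false.
  apply/negP; rewrite /inres content_side; last exact: unit_pair_sym.
  move/dvd_small => /(_ _ r1); rewrite content_side //.
  by case: uv => -[-> ->]; rewrite /content /east /south /=; lia.
have -> : inres j x = false.
  apply/negP => /dvd_small /(_ r1); rewrite content_side //.
  by case: uv {r1 r2 ji} => -[-> _]; rewrite /content /east /south /=; lia.
by case: uv r1 r2 {ji} => -[-> ->] r1 r2; rewrite r1 r2 /=; clear_props; lia.
Qed.

Lemma ht_del_far j z : ~~ edvd (j - i) -> ~~ edvd (j - i - 1) -> ~~ edvd (j - i + 1) ->
  ht (del lam x) j z = ht lam j z.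
Proof.
move=> n0 n1 n2; rewrite ht_del_sum.
have -> : inres j x = false.
  by apply: contraNF n0 => h; apply: dvd_sub ri h _; lia.
have -> : inres j (side east south lam x) = false.
  apply: contraNF n1; rewrite /inres content_side; last by left.
  by move=> h; apply: dvd_sub ri h _; rewrite /content /east /=; lia.
have -> : inres j (side south east lam x) = false.
  apply: contraNF n2; rewrite /inres content_side; last by right.
  by move=> h; apply: dvd_sub ri h _; rewrite /content /south /=; lia.
by rewrite /=; lia.
Qed.
End Del.

Definition diag : point := (1, 1).

(* The two consequences of A-regularity that govern the crystal structure;
   both are invariant under transposition and under lam |-> dual lam. *)
Record wregular (lam : point -> bool) : Prop := {
  wr_node s m : addable lam s -> removable lam m ->
    edvd (content s - content m) -> m ≺ s -> ~ (s - diag ≺ m);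
  wr_corner u v x z : unit_pair u v -> lam x -> ~~ lam (x + v) -> ~~ lam (x + u - v) ->
    ~~ lam (z - v) -> lam (z - v - v) -> lam (z - u) ->
    edvd (content z - content x) -> x ≺ z -> ~ (z - diag ≺ x) }.

Lemma del_del lam x y : del (del lam x) y = del (del lam y) x.
Proof. by apply: functional_extensionality => w; rewrite /del andbAC. Qed.

Definition step (i : int) (lam mu : point -> bool) : Prop :=
  exists2 x, good mu i x & lam = del mu x.

Definition fits (k : nat) (lam : point -> bool) : Prop :=
  forall w, addable lam w || removable lam w -> inb k w.

Lemma sg_neq0 lam w : (sg lam w != 0) = addable lam w || removable lam w.
Proof.
rewrite /sg; case: (boolP (addable lam w)) => [/and3P[nl _ _]|_] /=.
  by rewrite /removable (negbTE nl).
by case: (removable lam w).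
Qed.

Lemma fits_del k lam x : down_closed lam -> removable lam x -> fits k.+1 lam -> fits k (del lam x).
Proof.
move=> sh rx f w h.
have hx : inb k.+1 x by apply: f; rewrite rx orbT.
have [h1 h2 h3 h4] := inb_unit (or_introl (conj erefl erefl)) hx.
move: h; rewrite -sg_neq0 sg_del //; case: (eqVneq w x) => [-> _|n0]; first exact: inbW.
case: (eqVneq w (side east south lam x)) => [-> _|n1].
  by rewrite /side; case: ifP.
case: (eqVneq w (side south east lam x)) => [-> _|n2].
  by rewrite /side; case: ifP.
by rewrite mulr0 addr0 !subr0 sg_neq0 => h; apply/inbW/f.
Qed.

Lemma fitsW k lam : fits k.+1 lam -> fits k lam.
Proof. by move=> f w /f/inbW. Qed.

Lemma fits_removable k lam x : fits k lam -> removable lam x -> inb k x.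
Proof. by move=> f rx; apply: f; rewrite rx orbT. Qed.

Lemma ht_diff lam i z y : z ⪯ y ->
  ht lam i z = ht lam i y - \sum_(w <- box | inres i w && ((z ⪯ w) && (w ≺ y))) sg lam w.
Proof.
move=> zy; rewrite /ht -opprD; congr (- _).
rewrite big_mkcond [X in _ = X + _]big_mkcond [X in _ = _ + X]big_mkcond -big_split /=.
apply: eq_bigr => w _; case: (inres i w) => //=.
rewrite pt_ltNle; case: (boolP (y ⪯ w)) => yw /=; last by rewrite andbT add0r.
by rewrite (pt_le_trans zy yw) addr0.
Qed.

Lemma ht_mono lam i z y : z ⪯ y ->
  (forall w, z ⪯ w -> w ≺ y -> inres i w -> ~~ addable lam w) -> ht lam i y <= ht lam i z.
Proof.
move=> zy h; rewrite (ht_diff _ _ zy) lerBrDr gerDl.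
apply: sumr_le0 => w /and3P[rw zw wy].
by rewrite /sg (negbTE (h w zw wy rw)); lia_goal.
Qed.

Lemma ht_mono_strict lam i z y : z ≺ y -> z \in box -> inres i z -> removable lam z ->
  (forall w, w \in box -> inres i w -> z ≺ w -> w ≺ y -> ~~ addable lam w) ->
  ht lam i y < ht lam i z.
Proof.
move=> zy zb rz mz h; rewrite (ht_diff _ _ (pt_ltW zy)) ltrBrDr gtrDl.
rewrite big_mkcond (bigD1_seq z) ?uniq_box //= rz pt_lexx zy /=.
have -> : sg lam z = -1.
  by rewrite /sg mz; have /and3P[lz _ _] := mz; rewrite /addable lz.
rewrite -subr_gt0 sub0r opprD opprK big_seq_cond ltr_pwDl // oppr_ge0.
apply: sumr_le0 => w /andP[wb wz]; case: ifP => // /and3P[rw zw wy].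
have {}zw : z ≺ w by case/orP: zw => // /eqP E; rewrite E eqxx in wz.
by rewrite /sg (negbTE (h w wb rw zw wy)); lia_goal.
Qed.

Section Eps.
Hypothesis e3 : (3 <= e)%N.
Variables (lam : point -> bool) (i : int) (x : point).
Hypotheses (sh : down_closed lam) (f : fits 1 lam) (gx : good lam i x).

Lemma eps_del : eps (del lam x) i = eps lam i - 1.
Proof.
have [xb ri rx] := good_removable gx.
have bx := fits_removable f rx.
have H z := ht_del_self sh rx ri bx e3 z.
have E := eps_good gx; have := gx; case=> -[hm hf] hp.
apply/eqP; rewrite eq_le; apply/andP; split.
  have [->|[z _ ->]] := eps_cases (del lam x) i; first by rewrite E; lia.
  rewrite H E; case: (boolP (z ⪯ x)) => zx; first by have := hm z; lia.
  by have := hf z; rewrite pt_ltNle zx => /(_ isT); rewrite /=; lia.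
have := good_strict gx; have [->|[z zb [xz ->]]] := ht_next lam i x => h.
  by rewrite E -h eps_ge0.
rewrite E -h; have := ht_le_eps (del lam x) i z; rewrite H.
by move: xz; rewrite pt_ltNle => /negbTE->; rewrite /=; lia.
Qed.
End Eps.

Definition degree4 (i j : int) (y y1 y2 : point -> bool) : Prop :=
  exists a1 a2 b1 b2 z,
    [/\ step j a1 y1, step j a2 a1, step i z a2 & eps a2 i = eps y i] /\
    [/\ step i b1 y2, step i b2 b1, step j z b2 & eps b2 j = eps y j].

Definition commuting (i j : int) (y1 y2 : point -> bool) : Prop :=
  exists z, step j z y1 /\ step i z y2.

(** * Local relations *)

Section Local.
Hypothesis e3 : (3 <= e)%N.
Variable y : point -> bool.
Hypotheses (sh : down_closed y) (wr : wregular y) (fy : fits 4 y).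

(* Only nodes of residues i and j = i + content u are ever added or removed,
   and these do not affect which side is active. *)
Lemma side_del u v i w k lam x : unit_pair u v -> inres i x -> inres k w ->
  edvd (k - i) \/ edvd (k - i - content u) ->
  side u v (del lam w) x = side u v lam x.
Proof.
move=> uv rx rw ik; rewrite /side /del.
have -> : x + u - v != w; last by rewrite andbT.
apply/eqP => E; move: rw; rewrite -E /inres => rw.
have [h|h] := ik.
  have h1 : edvd (content (x + u - v) - content x).
    by apply: dvd_add (dvd_sub rw rx erefl) h _; lia.
  have h0 := edvd0.
  have := dvd_small h1 h0; move: e3; case: uv => -[-> ->]; rewrite /content /=; clear_props; lia.
have h1 : edvd (content (x + u - v) - content x - content u).
  by apply: dvd_add (dvd_sub rw rx erefl) h _; lia.
have h0 := edvd0.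
have := dvd_small h1 h0; move: e3; case: uv => -[-> ->]; rewrite /content /=; clear_props; lia.
Qed.

Section Pair.
Variables (u v : point) (i j : int).
Hypothesis uv : unit_pair u v.
Hypothesis ij : edvd (j - i - content u).

Lemma adjacent_sym : edvd (i - j - content v).
Proof.
have : edvd (- (j - i - content u)) by rewrite edvdN.
by move=> h; apply: dvd_add h edvd0 _; case: uv => -[-> ->]; rewrite /content /=; clear_props; lia.
Qed.

Lemma content_adjacent x w : inres i x -> inres j w -> edvd (content x + content u - content w).
Proof. by move=> rx rw; apply: dvd_sub (dvd_sub rx rw erefl) ij _; clear_props; lia. Qed.

Lemma pos_u : pos u. Proof. by case: uv => -[-> _]; case: O. Qed.
Lemma pos_v : pos v. Proof. by case: uv => -[_ ->]; case: O. Qed.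

Lemma addable_beside w : removable y w -> y (w + v - u) -> addable y (w + v).
Proof.
rewrite (removable_unit _ _ uv) (addable_unit _ _ uv) => /and3P[yw _ ->] h /=.
by rewrite h addrK yw.
Qed.

(* Removing m changes the signature of w's residue at [side u v y m], removing w
   that of m's residue at [side v u y w]; regularity makes the two comparisons
   agree. *)
Lemma side_le (lam' : point -> bool) w m : removable y w -> inres j w ->
  removable lam' m -> inres i m ->
  (forall a, lam' a -> y a) -> ~~ lam' w ->
  (forall a, y a -> ~~ lam' a -> a = w \/ inres i a) ->
  m ⪯ side v u y w -> side u v y m ⪯ w.
Proof.
move=> rw jw rm im sub nw rem; rewrite (removable_unit _ _ uv) in rm.
have /and3P[lm nu nv] := rm.
have := rw; rewrite (removable_unit _ _ uv) => /and3P[yw nwu nwv].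
rewrite /side; case: (boolP (y (w + v - u))) => [yq|nq]; case: (boolP (y (m + u - v))) => [yp|np].
- case/orP => [/eqP E|lt]; first by move: nwv; rewrite E sub.
  apply: contraT; rewrite -pt_ltNle => lt2; exfalso.
  have am : addable y (w + v) by exact: addable_beside.
  have nmu : ~~ y (m + u).
    apply/negP => h; have [E|h2] := rem _ h nu.
      by move: lt2; rewrite E pt_ltxx.
    have := dvd_small h2 im; move: e3; case: (uv) => -[-> _]; rewrite /content /=; clear_props; lia.
  have nmv : ~~ y (m + v).
    apply/negP => h; have [E|h2] := rem _ h nv.
      have := content_adjacent im jw; rewrite -E => h3; have h0 := edvd0.
      have := dvd_small h3 h0; move: e3; case: (uv) => -[-> ->]; rewrite /content /=; clear_props; lia.
    have := dvd_small h2 im; move: e3; case: (uv) => -[_ ->]; rewrite /content /=; clear_props; lia.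
  have rmy : removable y m by rewrite (removable_unit _ _ uv) sub // nmu nmv.
  apply: (wr_node wr am rmy _ lt); last first.
    by apply: pos_eq lt2 _; case: uv => -[-> ->]; rewrite /diag; vec.
  have h := content_adjacent im jw; rewrite -opprB edvdN; apply: dvd_add h edvd0 _.
  by case: uv => -[-> ->]; rewrite /content /=; clear_props; lia.
- case/orP => [/eqP E|lt]; first by move: nwv; rewrite E sub.
  by apply/pt_ltW; apply: pos_eq lt _; vec.
- case/orP => [/eqP E|lt].
    by apply/orP; left; apply/eqP; rewrite -E; vec.
  by apply/pt_ltW; apply: pos_eq lt _; vec.
case/orP => [/eqP E|lt].
  have [_ h] := down_closed_unit uv sh yw.
  by move: np; rewrite -E (_ : w - u + u - v = w - v) ?h //; vec.
by apply/pt_ltW; apply: (pos_add_eq lt (pos_add O pos_u pos_v)); vec.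
Qed.

End Pair.

Section Nodes.
Variables (u v : point) (i j : int).
Hypothesis uv : unit_pair u v.
Hypothesis ij : edvd (j - i - content u).
Variables x0 y0 : point.
Hypotheses (gx : good y i x0) (gy : good y j y0).
Let p := side u v y x0.
Let q := side v u y y0.
Let y1 := del y x0.
Let y2 := del y y0.

Let rx : removable y x0. Proof. by have [_ _ r] := good_removable gx. Qed.
Let ry : removable y y0. Proof. by have [_ _ r] := good_removable gy. Qed.
Let ix : inres i x0. Proof. by have [_ r _] := good_removable gx. Qed.
Let jy : inres j y0. Proof. by have [_ r _] := good_removable gy. Qed.
Let sh1 : down_closed y1. Proof. exact: down_closed_del. Qed.
Let sh2 : down_closed y2. Proof. exact: down_closed_del. Qed.
Let f1 : fits 3 y1. Proof. exact: fits_del. Qed.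
Let f2 : fits 3 y2. Proof. exact: fits_del. Qed.
Let bx : inb 4 x0. Proof. exact: fits_removable fy rx. Qed.
Let by0 : inb 4 y0. Proof. exact: fits_removable fy ry. Qed.
Let inb4 w : inb 4 w -> inb 1 w. Proof. by move=> /inbW/inbW/inbW. Qed.
Let inb3 w : inb 3 w -> inb 1 w. Proof. by move=> /inbW/inbW. Qed.
Let inb2 w : inb 2 w -> inb 1 w. Proof. by move=> /inbW. Qed.
Let vu : unit_pair v u. Proof. exact: unit_pair_sym. Qed.
Let ji' : edvd (i - j - content v). Proof. exact: adjacent_sym uv ij. Qed.

Lemma ht1i z : ht y1 i z = ht y i z - 2 * (z ⪯ x0 : nat)%:Z.
Proof. exact: (ht_del_self sh rx ix (inb4 bx) e3 z). Qed.
Lemma ht1j z : ht y1 j z = ht y j z + (z ⪯ p : nat)%:Z.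
Proof. exact: (ht_del_adj sh rx ix (inb4 bx) e3 z uv ij). Qed.
Lemma ht2j z : ht y2 j z = ht y j z - 2 * (z ⪯ y0 : nat)%:Z.
Proof. exact: (ht_del_self sh ry jy (inb4 by0) e3 z). Qed.
Lemma ht2i z : ht y2 i z = ht y i z + (z ⪯ q : nat)%:Z.
Proof. exact: (ht_del_adj sh ry jy (inb4 by0) e3 z vu ji'). Qed.

Lemma good1j : y0 ≺ p -> good y1 j y0.
Proof.
move=> lt; case: gy => -[hm hf] hp; split; last by rewrite ht1j (pt_ltW lt) /=; move: hp; lia_goal.
split=> z; rewrite !ht1j (pt_ltW lt); first by have := hm z; case: (z ⪯ p) => /=; lia_goal.
by move=> /hf; case: (z ⪯ p) => /=; lia_goal.
Qed.

Lemma consistent_case : y0 ≺ p -> q ≺ x0 ->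
  eps y1 j = eps y j + 1 /\
  ((eps y2 i = eps y i /\ commuting i j y1 y2) \/
   (eps y2 i = eps y i + 1 /\ degree4 i j y y1 y2)).
Proof.
move=> yp qx; have g1 := good1j yp.
have Ej : eps y1 j = eps y j + 1.
  by rewrite (eps_good g1) (eps_good gy) ht1j (pt_ltW yp).
split=> //.
have [[Xm Xf] Xp] := gx; have [[Ym Yf] Yp] := gy.
have nqx : (x0 ⪯ q) = false by exact: pt_lt_geF.
have [|x' gx' Ex'] := @good_of_eps y2 i.
  by apply: lt_le_trans (ht_le_eps y2 i x0); rewrite ht2i nqx addr0.
have le1 : ht y i x0 <= ht y2 i x'.
  by rewrite Ex'; apply: le_trans (ht_le_eps y2 i x0); rewrite ht2i nqx addr0.
have [[Xm' Xf'] Xp'] := gx'.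
case: (ltP (ht y i x0) (ht y2 i x')) => cmp; last first.
  left; have Ea : ht y2 i x' = ht y i x0 by apply/eqP; rewrite eq_le cmp le1.
  split; first by rewrite -Ex' Ea (eps_good gx).
  exists (del y1 y0); split; first by exists y0.
  exists x0; last by rewrite /y1 /y2 del_del.
  have Ex : ht y2 i x0 = ht y i x0 by rewrite ht2i nqx addr0.
  split; last by rewrite Ex.
  split=> z; rewrite Ex; first by rewrite -Ea.
  move=> xz; rewrite ht2i (pt_lt_geF (pt_lt_trans qx xz)) addr0; exact: Xf.
right.
have [x'q Ea] : x' ⪯ q /\ ht y i x' = ht y i x0.
  move: cmp (Xm x'); rewrite ht2i; case: (x' ⪯ q) => /=; last by lia_goal.
  by move=> h1 h2; split=> //; move: h1 h2; lia_goal.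
have Ex2 : ht y2 i x' = ht y i x0 + 1 by rewrite ht2i x'q Ea.
split; first by rewrite -Ex' Ex2 (eps_good gx).
have [_ ix' rx'] := good_removable gx'.
have bx' := fits_removable f2 rx'.
pose y3 := del y1 y0.
have r1y : removable y1 y0 by have [_ _ r] := good_removable g1.
have sh3 : down_closed y3 by exact: down_closed_del.
have f3 : fits 2 y3 by exact: fits_del.
have f1' : fits 1 y1 by do 2!apply: fitsW.
have E3 : eps y3 j = eps y j by rewrite (eps_del e3 sh1 f1' g1) Ej addrK.
have ebp : 0 < eps y j by rewrite (eps_good gy).
have [|y' gy' Ey'] := @good_of_eps y3 j; first by rewrite E3.
rewrite E3 (eps_good gy) in Ey'.
have ht3j z : ht y3 j z = ht y j z + (z ⪯ p : nat)%:Z - 2 * (z ⪯ y0 : nat)%:Z.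
  by rewrite (ht_del_self sh1 r1y jy (inb4 by0) e3) ht1j.
have ht3i z : ht y3 i z = ht y i z - 2 * (z ⪯ x0 : nat)%:Z + (z ⪯ q : nat)%:Z.
  rewrite (ht_del_adj sh1 r1y jy (inb4 by0) e3 _ vu ji') ht1i.
  by rewrite (side_del _ vu jy ix (or_intror ji')).
have [[Ym' Yf'] Yp'] := gy'.
have [_ jy' ry'] := good_removable gy'.
have by' := fits_removable f3 ry'.
have y'p : y' ⪯ p.
  apply: contraT; rewrite -pt_ltNle => lt; move: Ey'; rewrite ht3j.
  rewrite (pt_lt_geF lt) (pt_lt_geF (pt_lt_trans yp lt)) /=.
  by have := Yf _ (pt_lt_trans yp lt); lia_goal.
have yy' : y0 ≺ y'.
  rewrite pt_ltNle; apply/negP => le; move: Ey'; rewrite ht3j le.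
  by have := Ym y'; case: (y' ⪯ p) => /=; lia_goal.
pose q' := side v u y y'; pose p' := side u v y x'.
have sub2 a : y2 a -> y a by case/andP.
have sub3 a : y3 a -> y a by case/andP => /andP[].
have F3 : p' ⪯ y0.
  apply: (side_le uv ij ry jy rx' ix' sub2) => //; first by rewrite /y2 /del eqxx andbF.
  by move=> a ya; rewrite /y2 /del ya /= negbK => /eqP->; left.
have F2 : x' ⪯ q'.
  apply: contraT; rewrite -pt_ltNle => lt; exfalso.
  have := ry; rewrite (removable_unit _ _ uv) => /and3P[yy nyu nyv].
  have := rx'; rewrite (removable_unit _ _ uv) => /and3P[yx' nu nv].
  have qq' : q' ≺ q by exact: pt_lt_le_trans lt x'q.
  move: qq' lt x'q; rewrite /q /q' /side.
  case: (boolP (y (y0 + v - u))) => yq; case: (boolP (y (y' + v - u))) => yq' qq' lt x'q.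
  - by apply: (pos_sum2_neq0 yy' qq'); vec.
  - have am : addable y (y0 + v) by apply: (addable_beside uv).
    have lt2 : x' ≺ y0 + v.
      case/orP: x'q => // /eqP E; by move: nyv; rewrite E (sub2 _ yx').
    have rmy : removable y x'.
      rewrite (removable_unit _ _ uv) (sub2 _ yx') /=; apply/andP; split.
        apply/negP => h; move: nu; rewrite /y2 /del h /= negbK => /eqP E.
        by apply: (pos_sum2_neq0 yy' lt); rewrite -E; vec.
      apply/negP => h; move: nv; rewrite /y2 /del h /= negbK => /eqP E.
      have := content_adjacent ij ix' jy; rewrite -E => h3; have h0 := edvd0.
      by have := dvd_small h3 h0; move: e3; case: (uv) => -[-> ->]; rewrite /content /=; clear_props; lia.
    apply: (wr_node wr am rmy _ lt2); last first.
      by apply: pos_add_eq yy' lt _; case: uv => -[-> ->]; rewrite /diag; vec.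
    have h := content_adjacent ij ix' jy; rewrite -opprB edvdN; apply: dvd_add h edvd0 _.
    by case: uv => -[-> ->]; rewrite /content /=; clear_props; lia.
  - by apply: (pos_sum4_neq0 (pos_u uv) (pos_v uv) yy' qq'); vec.
  - by apply: (pos_sum2_neq0 yy' qq'); vec.
have F1 : q' ⪯ x0.
  apply: (side_le vu ji' rx ix ry' jy' sub3) => //.
    by rewrite /y3 /y1 /del eqxx !andbF.
  move=> a ya; rewrite /y3 /y1 /del ya /= negb_and !negbK.
  by case/orP => /eqP->; [left|right].
have x'x : x' ≺ x0 by exact: pt_le_lt_trans x'q qx.
pose a2 := del y3 y'.
have ht_a2 z : ht a2 i z = ht y i z - 2 * (z ⪯ x0 : nat)%:Z + (z ⪯ q : nat)%:Z + (z ⪯ q' : nat)%:Z.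
  rewrite (ht_del_adj sh3 ry' jy' (inb2 by') e3 _ vu ji') ht3i.
  rewrite (side_del _ vu jy' jy); last by left; rewrite subrr edvd0.
  by rewrite (side_del _ vu jy' ix (or_intror ji')).
have ga2 : good a2 i x'.
  have Ex : ht a2 i x' = ht y i x0 by rewrite ht_a2 (pt_ltW x'x) x'q F2 Ea /=; lia_goal.
  split; last by rewrite Ex.
  split=> z; rewrite Ex ht_a2.
    case: (boolP (z ⪯ x0)) => [_|nx].
      by have := Xm z; case: (z ⪯ q) => /=; case: (z ⪯ q') => /=; lia_goal.
    have xz : x0 ≺ z by rewrite pt_ltNle.
    rewrite (pt_lt_geF (pt_lt_trans qx xz)) (pt_lt_geF (pt_le_lt_trans F1 xz)) /=.
    by have := Xm z; lia_goal.
  move=> x'z; case: (boolP (z ⪯ x0)) => [_|nx].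
    have := Xf' _ x'z; rewrite Ex2 ht2i; case: (boolP (z ⪯ q)) => /=.
      by case: (z ⪯ q') => /=; lia_goal.
    by have := Xm z; case: (z ⪯ q') => /=; lia_goal.
  have xz : x0 ≺ z by rewrite pt_ltNle.
  rewrite (pt_lt_geF (pt_lt_trans qx xz)) (pt_lt_geF (pt_le_lt_trans F1 xz)) /=.
  by have := Xf _ xz; lia_goal.
pose b1 := del y2 x'.
have ht_b1 z : ht b1 i z = ht y i z + (z ⪯ q : nat)%:Z - 2 * (z ⪯ x' : nat)%:Z.
  by rewrite (ht_del_self sh2 rx' ix' (inb3 bx') e3) ht2i.
have gb1 : good b1 i x0.
  have Ex : ht b1 i x0 = ht y i x0.
    by rewrite ht_b1 nqx (pt_lt_geF x'x) /=; lia_goal.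
  split; last by rewrite Ex.
  split=> z; rewrite Ex ht_b1.
    case: (boolP (z ⪯ x')) => [_|nz].
      by have := Xm z; case: (z ⪯ q) => /=; lia_goal.
    by have := Xf' z; rewrite pt_ltNle nz Ex2 ht2i => /(_ isT) /=; lia_goal.
  move=> xz; rewrite (pt_lt_geF (pt_lt_trans qx xz)) (pt_lt_geF (pt_lt_trans x'x xz)) /=.
  by have := Xf _ xz; lia_goal.
pose b2 := del b1 x0.
have shb1 : down_closed b1 by exact: down_closed_del.
have rb1 : removable b1 x0 by have [_ _ r] := good_removable gb1.
have ht_b2 z : ht b2 j z = ht y3 j z + (z ⪯ p' : nat)%:Z.
  rewrite (ht_del_adj shb1 rb1 ix (inb4 bx) e3 _ uv ij).
  rewrite (ht_del_adj sh2 rx' ix' (inb3 bx') e3 _ uv ij) ht2j ht3j.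
  rewrite (side_del _ uv ix ix'); last by left; rewrite subrr edvd0.
  rewrite !(side_del _ uv _ jy (or_intror ij)) // -/p -/p'; lia_goal.
have gb2 : good b2 j y'.
  have np'y' : (y' ⪯ p') = false by apply: pt_lt_geF; apply: pt_le_lt_trans F3 yy'.
  have Ey : ht b2 j y' = ht y j y0 by rewrite ht_b2 np'y' addr0.
  split; last by rewrite Ey.
  split=> z; rewrite Ey ht_b2.
    case: (boolP (z ⪯ p')) => zp'.
      rewrite ht3j (pt_le_trans zp' F3); have := Ym z.
      by case: (z ⪯ p) => /=; lia_goal.
    by rewrite addr0 -Ey'.
  move=> y'z; have -> : (z ⪯ p') = false.
    by apply: pt_lt_geF; apply: pt_le_lt_trans F3 (pt_lt_trans yy' y'z).
  by rewrite addr0 -Ey'; exact: Yf'.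
exists y3, a2, b1, b2, (del a2 x').
split; split.
- by exists y0.
- by exists y'.
- by exists x'.
- by rewrite (eps_good ga2) (eps_good gx) ht_a2 (pt_ltW x'x) x'q F2 Ea /=; lia_goal.
- by exists x'.
- by exists x0.
- exists y' => //; apply: functional_extensionality => w.
  rewrite /a2 /b2 /b1 /y3 /y1 /y2 /del; case: (y w) => //=.
  by case: (w != x0); case: (w != y0); case: (w != x'); case: (w != y').
by rewrite (eps_good gb2) (eps_good gy) ht_b2 (pt_lt_geF (pt_le_lt_trans F3 yy')) addr0.
Qed.

(* Here the i-order and the j-order disagree on x0 and y0: removing either node
   makes p, respectively q, the next node to be removed. *)
Section Critical.
Hypotheses (py : p ≺ y0) (qx : q ≺ x0).

Lemma critical_sides : [/\ p = x0 - v, q = y0 - u, ~~ y (x0 + u - v) & ~~ y (y0 + v - u)].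
Proof.
move: py qx; rewrite /p /q /side.
case: ifP => hx; case: ifP => hy // h1 h2; exfalso.
- by apply: (pos_sum4_neq0 h1 h2 (pos_u uv) (pos_v uv)); vec.
- by apply: (pos_sum2_neq0 h1 h2); vec.
- by apply: (pos_sum2_neq0 h1 h2); vec.
Qed.

Lemma no_addable_between z : p ⪯ z -> z ≺ y0 -> inres j z -> ~~ addable y z.
Proof.
move=> pz zy jz; apply/negP => az.
have [Ep Eq nx ny] := critical_sides.
have := rx; rewrite (removable_unit _ _ uv) => /and3P[yx nxu nxv].
have := az; rewrite (addable_unit _ _ uv) => /and3P[nz zu zv].
have qx' : y0 - u ≺ x0 by rewrite -Eq.
have lt : p ≺ z.
  case/orP: pz => // /eqP E; have [_ h] := down_closed_unit uv sh yx.
  by move: nz; rewrite E Ep h.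
have [h|nh] := boolP (y (z + v - u)).
  apply: (@wr_corner _ wr u v x0 (z + v) uv yx nxv nx).
  - by rewrite addrK.
  - by rewrite addrK.
  - exact: h.
  - have h1 := content_adjacent ij ix jz; rewrite -opprB edvdN; apply: dvd_add h1 edvd0 _.
    by case: uv => -[-> ->]; rewrite /content /=; clear_props; lia.
  - by rewrite Ep in lt; apply: pos_eq lt _; vec.
  apply: (pos_add_eq zy qx').
  by case: uv => -[-> ->]; rewrite /diag; vec.
have rm : removable y (z - u).
  rewrite (removable_unit _ _ uv) zu subrK nz /=.
  by rewrite (_ : z - u + v = z + v - u) //; vec.
have im : inres i (z - u).
  rewrite /inres; apply: dvd_add jz ij _.
  by case: uv => -[-> _]; rewrite /content /=; clear_props; lia.
have mx : z - u ≺ x0.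
  by apply: (pos_add_eq zy qx'); vec.
have [[Xm Xf] Xp] := gx.
have mb : z - u \in box.
  rewrite mem_box; apply/inbW/inbW/inbW/inbW; exact: fits_removable fy rm.
have : has (fun w => [&& inres i w, z - u ≺ w, w ≺ x0 & addable y w]) box.
  apply: contraT; rewrite -all_predC => /allP noadd.
  have : ht y i x0 < ht y i (z - u).
    apply: ht_mono_strict => // w wb rw mw wx.
    by have := noadd w wb; rewrite /= rw mw wx.
  by rewrite ltNge Xm.
move=> /hasP[w wb /and4P[iw mw wx aw]].
apply: (wr_node wr aw rm _ mw).
  by apply: (dvd_sub iw im); clear_props; lia.
have h : w - diag ≺ x0 - v - u.
  apply: pos_eq wx _; case: uv => -[-> ->]; rewrite /diag; vec.
apply: (pt_lt_trans h); rewrite Ep in lt.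
by apply: pos_eq lt _; vec.
Qed.

Let rp1 : inres j p.
Proof.
rewrite /inres content_side //; apply: dvd_sub ix ij _; clear_props; lia.
Qed.

Lemma critical_half :
  (forall z, q ⪯ z -> z ≺ x0 -> inres i z -> ~~ addable y z) ->
  [/\ good y1 j p, eps y1 j = eps y j + 1, good (del y1 p) j y0,
      good (del (del y1 p) y0) i q & eps (del (del y1 p) y0) i = eps y i].
Proof.
move=> noq; have [Ep Eq nx ny] := critical_sides.
have [[Xm Xf] Xp] := gx; have [[Ym Yf] Yp] := gy.
have flat z : p ⪯ z -> z ⪯ y0 -> ht y j z = ht y j y0.
  move=> pz zy; apply/eqP; rewrite eq_le Ym /=; apply: ht_mono => // w zw wy jw.
  by apply: no_addable_between => //; apply: pt_le_trans zw.
have flatp := flat _ (pt_lexx p) (pt_ltW py).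
have E1p : ht y1 j p = ht y j y0 + 1 by rewrite ht1j pt_lexx flatp.
have g1 : good y1 j p.
  split; last by rewrite E1p; move: Yp; lia_goal.
  split=> z; rewrite E1p ht1j; first by have := Ym z; case: (z ⪯ p) => /=; lia_goal.
  by move=> pz; rewrite (pt_lt_geF pz) /=; have := Ym z; lia_goal.
have [_ _ r1p] := good_removable g1.
have bp := fits_removable f1 r1p.
have E2 z : ht (del y1 p) j z = ht y j z - (z ⪯ p : nat)%:Z.
  rewrite (ht_del_self sh1 r1p rp1 (inb3 bp) e3) ht1j.
  by move: (ht y j z); lia_goal.
have g2 : good (del y1 p) j y0.
  have Ey : ht (del y1 p) j y0 = ht y j y0 by rewrite E2 (pt_lt_geF py) subr0.
  split; last by rewrite Ey.
  split=> z; rewrite Ey E2; first by have := Ym z; case: (z ⪯ p) => /=; lia_goal.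
  by move=> /Yf; case: (z ⪯ p) => /=; lia_goal.
have [_ _ r2y] := good_removable g2.
have sh1' : down_closed (del y1 p) by exact: down_closed_del.
have E3 z : ht (del (del y1 p) y0) i z =
    ht y i z - (z ⪯ x0 : nat)%:Z + (z ⪯ q : nat)%:Z.
  rewrite (ht_del_adj sh1' r2y jy (inb4 by0) e3 _ vu ji').
  rewrite (ht_del_adj sh1 r1p rp1 (inb3 bp) e3 _ vu ji') ht1i.
  rewrite (side_del _ vu jy rp1); last by left; rewrite subrr edvd0.
  rewrite !(side_del _ vu _ ix (or_intror ji')) // -/q.
  have -> : side v u y p = x0.
    rewrite /side Ep (_ : x0 - v + v - u = x0 - u); last by vec.
    have := rx; rewrite (removable_unit _ _ uv) => /and3P[yx _ _].
    by have [-> _] := down_closed_unit uv sh yx; vec.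
  by move: (ht y i z); lia_goal.
have flatq : ht y i q = ht y i x0.
  by apply/eqP; rewrite eq_le Xm /=; apply: ht_mono => //; apply: pt_ltW.
have E3q : ht (del (del y1 p) y0) i q = ht y i x0.
  by rewrite E3 pt_lexx (pt_ltW qx) flatq /=; lia_goal.
have g3 : good (del (del y1 p) y0) i q.
  split; last by rewrite E3q.
  split=> z; rewrite E3q E3.
    case: (boolP (z ⪯ q)) => zq; last by have := Xm z; lia_goal.
    by rewrite (pt_le_trans zq (pt_ltW qx)) /=; have := Xm z; lia_goal.
  move=> qz; rewrite (pt_lt_geF qz) /=.
  case: (boolP (z ⪯ x0)) => zx /=; first by have := Xm z; lia_goal.
  by have := Xf z; rewrite pt_ltNle zx => /(_ isT); lia_goal.
split=> //.
  by rewrite (eps_good g1) (eps_good gy) E1p.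
by rewrite (eps_good g3) (eps_good gx) E3q.
Qed.
End Critical.

Lemma impossible_case : y0 ≺ p -> x0 ≺ q -> False.
Proof.
rewrite /p /q /side; case: ifP => hx; case: ifP => hy h1 h2.
- have am : addable y (y0 + v) by apply: (addable_beside uv).
  apply: (wr_node wr am rx _ h2).
    have h := content_adjacent ij ix jy; rewrite -opprB edvdN; apply: dvd_add h edvd0 _.
    by case: uv => -[-> ->]; rewrite /content /=; clear_props; lia.
  by apply: pos_eq h1 _; case: uv => -[-> ->]; rewrite /diag; vec.
- by apply: (pos_sum2_neq0 h1 h2); vec.
- by apply: (pos_sum2_neq0 h1 h2); vec.
- by apply: (pos_sum4_neq0 h1 h2 (pos_u uv) (pos_v uv)); vec.
Qed.

Lemma side_neq : p != y0.
Proof.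
have := rx; rewrite (removable_unit _ _ uv) => /and3P[yx nxu _].
have := ry; rewrite (removable_unit _ _ uv) => /and3P[yy nyu nyv].
apply/eqP; rewrite /p /side; case: ifP => h E.
  by move: nxu; rewrite E yy.
by move: nyv; rewrite -E subrK yx.
Qed.
End Nodes.

(* Stembridge's local relations for two adjacent residues. *)
Lemma local_adjacent u v i j x0 y0 : unit_pair u v -> edvd (j - i - content u) ->
  good y i x0 -> good y j y0 ->
  let y1 := del y x0 in let y2 := del y y0 in
  [\/ [/\ eps y1 j = eps y j + 1, eps y2 i = eps y i & commuting i j y1 y2],
      [/\ eps y1 j = eps y j, eps y2 i = eps y i + 1 & commuting i j y1 y2] |
      [/\ eps y1 j = eps y j + 1, eps y2 i = eps y i + 1 & degree4 i j y y1 y2]].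
Proof.
move=> uv ij gx gy y1 y2; have vu := unit_pair_sym uv; have ji' := adjacent_sym uv ij.
set p := side u v y x0; set q := side v u y y0.
have swap : degree4 j i y y2 y1 -> degree4 i j y y1 y2.
  move=> [a1 [a2 [b1 [b2 [z [h1 h2]]]]]].
  by exists b1, b2, a1, a2, z; split.
have [py|yp|E] := pt_lt_or p y0; have [qx|xq|E'] := pt_lt_or q x0.
- have noj := no_addable_between uv ij gx py qx.
  have noi := no_addable_between vu ji' gy qx py.
  have [g1 E1 g2 g3 E3] := critical_half uv ij gx gy py qx noi.
  have [h1 F1 h2 h3 F3] := critical_half vu ji' gy gx qx py noj.
  constructor 3; split=> //.
  exists (del y1 p), (del (del y1 p) y0), (del y2 q), (del (del y2 q) x0),
    (del (del (del y1 p) y0) q).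
  split; split=> //; [by exists p|by exists y0|by exists q|by exists q|by exists x0|].
  exists p => //; apply: functional_extensionality => w.
  rewrite /y1 /y2 /del; case: (y w) => //=.
  by case: (w != x0); case: (w != y0); case: (w != p); case: (w != q).
- have [E1 [[E2 c]|[E2 d]]] := consistent_case vu ji' gy gx xq py.
    by constructor 2; split=> //; case: c => z [? ?]; exists z.
  by constructor 3; split=> //; exact: swap d.
- by move: (side_neq vu gy gx); rewrite -/q E' eqxx.
- have [E1 [[E2 c]|[E2 d]]] := consistent_case uv ij gx gy yp qx.
    by constructor 1.
  by constructor 3.
- by case: (impossible_case uv ij gx gy yp xq).
- by move: (side_neq vu gy gx); rewrite -/q E' eqxx.
- by move: (side_neq uv gx gy); rewrite -/p E eqxx.
- by move: (side_neq uv gx gy); rewrite -/p E eqxx.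
- by move: (side_neq uv gx gy); rewrite -/p E eqxx.
Qed.

Lemma local_far i j x0 y0 : ~~ edvd (j - i) -> ~~ edvd (j - i - 1) ->
  ~~ edvd (j - i + 1) -> good y i x0 -> good y j y0 ->
  [/\ eps (del y x0) j = eps y j, eps (del y y0) i = eps y i
    & commuting i j (del y x0) (del y y0)].
Proof.
move=> n0 n1 n2 gx gy.
have [xb ix rx] := good_removable gx; have [yb jy ry] := good_removable gy.
have bx : inb 1 x0 by do 3!apply: inbW; exact: fits_removable rx.
have by0 : inb 1 y0 by do 3!apply: inbW; exact: fits_removable ry.
have H1 : ht (del y x0) j = ht y j.
  by apply: functional_extensionality => z; apply: (@ht_del_far _ _ i).
have H2 : ht (del y y0) i = ht y i.
  apply: functional_extensionality => z; apply: (@ht_del_far _ _ j) => //.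
  - by rewrite -edvdN opprB.
  - by rewrite -edvdN (_ : - _ = j - i + 1) //; lia_goal.
  - by rewrite -edvdN (_ : - _ = j - i - 1) //; lia_goal.
have g1 : good (del y x0) j y0.
  by rewrite /good H1.
have g2 : good (del y y0) i x0.
  by rewrite /good H2.
split; first by rewrite (eps_good g1) (eps_good gy) H1.
  by rewrite (eps_good g2) (eps_good gx) H2.
exists (del (del y x0) y0); split; first by exists y0.
by exists x0 => //; rewrite del_del.
Qed.
End Local.

Lemma good_addable_above lam i x m : good lam i x -> removable lam m -> inres i m ->
  m \in box -> m ≺ x -> exists w, [/\ inres i w, m ≺ w, w ≺ x & addable lam w].
Proof.
case=> -[hm _] _ rm im mb mx.
have : has (fun w => [&& inres i w, m ≺ w, w ≺ x & addable lam w]) box.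
  apply: contraT; rewrite -all_predC => /allP noadd.
  have : ht lam i x < ht lam i m.
    apply: ht_mono_strict => // w wb rw mw wx.
    by have := noadd w wb; rewrite /= rw mw wx.
  by rewrite ltNge hm.
by move=> /hasP[w _ /and4P[iw mw wx aw]]; exists w.
Qed.

Lemma good_removable_above lam i x s : good lam i x -> addable lam s -> inres i s ->
  s \in box -> x ≺ s -> exists w, [/\ inres i w, x ≺ w, w ≺ s & removable lam w].
Proof.
move=> gx as_ is_ sb xs; have [xb ix rx] := good_removable gx.
have [[hm hf] hp] := gx.
have : has (fun w => [&& inres i w, x ≺ w, w ≺ s & removable lam w]) box.
  apply: contraT; rewrite -all_predC => /allP norem; exfalso.
  have h1 : - \sum_(w <- box | inres i w && (s ≺ w)) sg lam w < ht lam i x.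
    by have [->|[z _ [sz ->]]] := ht_next lam i s => //; apply/hf/(pt_lt_trans xs).
  have := ht_split lam i s; rewrite sb is_ /= => Es.
  have sg1 : sg lam s = 1 by rewrite /sg as_ /removable; have /and3P[/negbTE-> _ _] := as_.
  have := ht_diff lam i (pt_ltW xs).
  rewrite big_mkcond (bigD1_seq x) ?uniq_box //= ix pt_lexx xs /=.
  have -> : sg lam x = -1.
    by rewrite /sg rx; have /and3P[lx _ _] := rx; rewrite /addable lx.
  rewrite big_seq_cond; set S := \sum_(_ <- _ | _) _.
  have S0 : 0 <= S.
    apply: sumr_ge0 => w /andP[wb wx]; case: ifP => // /and3P[iw xw ws].
    have {}xw : x ≺ w by case/orP: xw => // /eqP E; rewrite E eqxx in wx.
    have := norem w wb; rewrite /= iw xw ws /= /sg => /negbTE->; lia_goal.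
  move: S S0 h1 Es; rewrite sg1; move: (\sum_(w <- box | _) sg lam w) (ht lam i s) (ht lam i x).
  by lia_goal.
by move=> /hasP[w _ /and4P[iw mw wx aw]]; exists w.
Qed.

Lemma pos_diagn n : pos (n.+1%:Z, n.+1%:Z).
Proof.
have d1 : pos diag by apply: (pos_add_eq (pos_east O) (pos_south O)); rewrite /diag; vec.
elim: n => [|n IH]; first exact: pos_eq d1 _.
by apply: (pos_add_eq IH d1); rewrite /diag; vec.
Qed.

Lemma same_content x z : content x = content z -> x ≺ z -> z - diag ≺ x -> False.
Proof.
move=> E h1 h2; pose a := z.1 - x.1.
have Ez : z - x = (a, a) by apply: injective_projections => //=; move: E; rewrite /a /content; lia_goal.
case: (ltrP 0 a) => ha; last first.
  case: (eqVneq a 0) => a0; first by apply: (pos_neq0 h1); rewrite Ez a0.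
  have h3 := pos_diagn (`|a|.-1)%N.
  apply: (pos_sum2_neq0 h1 h3); rewrite Ez; apply: injective_projections => /=; move: ha a0; lia_goal.
case: (eqVneq a 1) => a1.
  apply: (pos_neq0 h2); rewrite (_ : x - (z - diag) = diag - (z - x)); last by vec.
  by rewrite Ez a1.
have h3 := pos_diagn (`|a|.-2)%N.
apply: (pos_sum2_neq0 h2 h3); rewrite (_ : x - (z - diag) = diag - (z - x)); last by vec.
by rewrite Ez; apply: injective_projections => /=; move: ha a1; lia_goal.
Qed.

(* x ends a row and z ends a column; content x - content z + 1 is the length of
   the hook from x to z, and the last two inequalities say that its arm length
   is the forbidden one. *)
Definition regular (lam : point -> bool) : Prop :=
  forall x z, lam x -> ~~ lam (x + east) -> lam z -> ~~ lam (z + south) ->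
    0 < content x - content z + 1 -> edvd (content x - content z + 1) ->
    z - east ≺ x -> x ≺ z + south -> False.

Lemma regular_unit u v lam x z : unit_pair u v -> regular lam ->
  lam x -> ~~ lam (x + u) -> lam z -> ~~ lam (z + v) ->
  0 < content u * (content x - content z) + 1 ->
  edvd (content u * (content x - content z) + 1) ->
  z - u ≺ x -> x ≺ z + v -> False.
Proof.
case=> -[-> ->] rg lx nx lz nz k0 ek h1 h2.
  apply: (rg x z) => //.
    by move: k0; rewrite {1}/content /=; lia_goal.
  by move: ek; rewrite {1}/content /= (_ : (1 - 0) * _ = content x - content z) //; lia_goal.
apply: (rg z x) => //.
- by move: k0; rewrite {1}/content /=; lia_goal.
- by move: ek; rewrite {1}/content /= (_ : (0 - 1) * _ = content z - content x) //; lia_goal.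
- by apply: pos_eq h2 _; vec.
by apply: pos_eq h1 _; vec.
Qed.

Lemma regular_wregular lam : down_closed lam -> regular lam -> wregular lam.
Proof.
move=> sh rg; split.
  move=> s m /and3P[ns sE sS] /and3P[lm mE mS] ed h1 h2.
  have [c|c|c] := ltrgtP (content s) (content m).
  - apply: (rg m (s - south)) => //.
    + by rewrite subrK.
    + by move: c; rewrite /content /=; lia_goal.
    + by rewrite -edvdN; apply: dvd_add ed edvd0 _; rewrite /content /=; lia_goal.
    + by apply: pos_eq h2 _; rewrite /diag; vec.
    by apply: pos_eq h1 _; vec.
  - apply: (rg (s - east) m) => //.
    + by rewrite subrK.
    + by move: c; rewrite /content /=; lia_goal.
    + by apply: dvd_add ed edvd0 _; rewrite /content /=; lia_goal.
    + by apply: pos_eq h1 _; vec.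
    by apply: pos_eq h2 _; rewrite /diag; vec.
  by apply: (same_content (esym c) h1 h2).
move=> u v x z uv lx nx nxu nz zv zu ed h1 h2.
have [xu xv] := down_closed_unit uv sh lx.
have cu : content u * content u = 1 by case: uv => -[-> _].
have cuv : content v = - content u by case: uv => -[-> ->].
have cB a b : content (a - b) = content a - content b by rewrite /content /=; lia_goal.
have [c|c|c] := ltrgtP 0 (content u * (content x - content z)).
- apply: (regular_unit (x := x - v) (z := z - v - v) uv rg) => //.
  + by rewrite (_ : x - v + u = x + u - v) //; vec.
  + by rewrite subrK.
  + rewrite !cB cuv; move: c cu; clear_props; nia.
  + have := ed; rewrite -edvdN => ed2.
    rewrite !cB cuv (_ : _ + 1 = content u * (content x - content z)); last first.
      by move: cu; clear_props; nia.
    rewrite /edvd; apply: dvdz_mull; move: ed2; rewrite opprB; exact.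
  + by apply: pos_eq h2 _; case: uv => -[-> ->]; rewrite /diag; vec.
  by apply: pos_eq h1 _; vec.
- apply: (regular_unit (x := z - u) (z := x) uv rg) => //.
  + rewrite subrK; apply: contra nz => lz; by have [_ ->] := down_closed_unit uv sh lz.
  + by rewrite !cB; move: c cu; clear_props; nia.
  + rewrite !cB (_ : _ + 1 = content u * (content z - content x)); last first.
      by move: cu; clear_props; nia.
    by rewrite /edvd; apply: dvdz_mull.
  + by apply: pos_eq h1 _; vec.
  by apply: pos_eq h2 _; case: uv => -[-> ->]; rewrite /diag; vec.
apply: (same_content _ h1 h2).
have : content u * (content u * (content x - content z)) = 0 by rewrite -c mulr0.
by rewrite mulrA cu mul1r; lia_goal.
Qed.

Section Closure.
Hypothesis e3 : (3 <= e)%N.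
Variables (mu : point -> bool) (i : int) (x : point).
Hypotheses (sh : down_closed mu) (f : fits 4 mu) (gx : good mu i x).

Let rx : removable mu x. Proof. by have [_ _ r] := good_removable gx. Qed.
Let ix : inres i x. Proof. by have [_ r _] := good_removable gx. Qed.
Let fbox w : addable mu w || removable mu w -> w \in box.
Proof. by rewrite mem_box => /f; do 4![move/inbW]. Qed.

Lemma edvd_content_unit u v a : unit_pair u v -> edvd (content u * a) -> edvd a.
Proof.
case=> -[-> _]; rewrite /content /= => h; first by apply: dvd_add h edvd0 _; lia_goal.
by rewrite -edvdN; apply: dvd_add h edvd0 _; lia_goal.
Qed.

Lemma regular_del_unit u v z : unit_pair u v -> regular mu -> wregular mu ->
  mu z -> ~~ mu (z + v) ->
  0 < content u * (content (x - u) - content z) + 1 ->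
  edvd (content u * (content (x - u) - content z) + 1) ->
  z - u ≺ x - u -> x - u ≺ z + v -> False.
Proof.
move=> uv rg wr mz nz k0 ek h1 h2.
have := rx; rewrite (removable_unit _ _ uv) => /and3P[mx nxu nxv].
have Ek : content u * (content (x - u) - content z) + 1 = content u * (content x - content z).
  by case: (uv) => -[-> _]; rewrite /content /=; lia_goal.
rewrite Ek in k0 ek.
have h1' : z ≺ x by apply: pos_eq h1 _; vec.
case: (boolP (mu (z + u))) => zu.
  apply: (regular_unit (x := x) (z := z + u) uv rg) => //.
  - apply: contra nz => h; have [+ _] := down_closed_unit uv sh h.
    by rewrite (_ : z + u + v - u = z + v) //; vec.
  - by move: k0; case: (uv) => -[-> _]; rewrite /content /=; lia_goal.
  - by apply: dvd_add ek edvd0 _; case: (uv) => -[-> _]; rewrite /content /=; lia_goal.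
  - by apply: pos_eq h1 _; vec.
  by apply: pos_eq h2 _; vec.
have rz : removable mu z by rewrite (removable_unit _ _ uv) mz zu.
have iz : inres i z.
  by have := edvd_content_unit uv ek => h; apply: dvd_sub ix h _; lia_goal.
have [|w [iw zw wx aw]] := good_addable_above gx rz iz _ h1'; first by apply: fbox; rewrite rz orbT.
apply: (wr_node wr aw rz _ zw); first by apply: dvd_sub iw iz _; lia_goal.
by apply: (pos_add_eq wx h2); case: uv => -[-> ->]; rewrite /diag; vec.
Qed.

Lemma regular_del : regular mu -> regular (del mu x).
Proof.
move=> rg a b /andP[ma ax] na /andP[mb bx] nb k0 ek h1 h2.
have wr := regular_wregular sh rg.
have opt c : ~~ del mu x c -> ~~ mu c \/ c = x.
  by rewrite /del negb_and negbK => /orP[|/eqP]; [left|right].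
case: (opt _ na) => [na'|Ea]; case: (opt _ nb) => [nb'|Eb].
- exact: (rg a b).
- have Eb' : b = x - south by rewrite -Eb addrK.
  subst b; apply: (regular_del_unit (or_intror (conj erefl erefl)) rg wr ma na').
  + by move: k0; rewrite /content /=; lia_goal.
  + by apply: dvd_add ek edvd0 _; rewrite /content /=; lia_goal.
  + by apply: pos_eq h2 _; vec.
  by apply: pos_eq h1 _; vec.
- have Ea' : a = x - east by rewrite -Ea addrK.
  subst a; apply: (regular_del_unit (or_introl (conj erefl erefl)) rg wr mb nb').
  + by move: k0; rewrite /content /=; lia_goal.
  + by apply: dvd_add ek edvd0 _; rewrite /content /=; lia_goal.
  + by apply: pos_eq h1 _; vec.
  by apply: pos_eq h2 _; vec.
have Ea' : a = x - east by rewrite -Ea addrK.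
have Eb' : b = x - south by rewrite -Eb addrK.
by move: k0; rewrite Ea' Eb' /content /=; lia_goal.
Qed.

Lemma regular_undel_unit u v z : unit_pair u v -> regular (del mu x) -> wregular (del mu x) ->
  mu z -> z != x -> ~~ mu (z + v) ->
  0 < content u * (content x - content z) + 1 ->
  edvd (content u * (content x - content z) + 1) ->
  z - u ≺ x -> x ≺ z + v -> False.
Proof.
move=> uv rg wr mz zx nz k0 ek h1 h2.
have := rx; rewrite (removable_unit _ _ uv) => /and3P[mx nxu nxv].
have [xu xv] := down_closed_unit uv sh mx; have [zu zv] := down_closed_unit uv sh mz.
have neu a : a - u != a by rewrite -[X in _ != X]subr0 (inj_eq (addrI a)) eqr_opp; case: uv => -[-> _].
case: (boolP (mu (z + v - u))) => [zvu|nzvu].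
  have nzvux : z + v - u != x.
    apply/eqP => E; have h0 := edvd0; have := dvd_small ek h0; move: e3.
    by rewrite -E; case: (uv) => -[-> ->]; rewrite /content /=; lia_goal.
  have az : addable mu (z + v) by rewrite (addable_unit _ _ uv) nz zvu addrK.
  have az' : addable (del mu x) (z + v).
    by rewrite (addable_unit _ _ uv) /del negb_and nz zvu addrK mz zx nzvux.
  have isv : inres i (z + v).
    have h : edvd (content u * (content x - content (z + v))).
      by apply: dvd_add ek edvd0 _; case: (uv) => -[-> ->]; rewrite /content /=; lia_goal.
    by apply: dvd_sub ix (edvd_content_unit uv h) _; lia_goal.
  have [|w [iw xw ws rw]] := good_removable_above gx az isv _ h2; first by apply: fbox; rewrite az.
  have rw' : removable (del mu x) w.
    have /and3P[mw n1 n2] := rw.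
    by rewrite /removable /del mw (negbTE n1) (negbTE n2) (pt_neq_gt xw).
  apply: (wr_node wr az' rw' _ ws); first by apply: dvd_sub isv iw _; lia_goal.
  by apply: (pos_add_eq h1 xw); case: uv => -[-> ->]; rewrite /diag; vec.
apply: (regular_unit (x := x - u) (z := z - u) uv rg).
- by rewrite /del xu neu.
- by rewrite /del subrK eqxx andbF.
- rewrite /del zu /=; apply/eqP => E; move: nxu; rewrite -E subrK mz //.
- rewrite /del negb_and (_ : z - u + v = z + v - u) ?nzvu //; vec.
- by move: k0; rewrite /content /=; case: (uv) => -[-> _] /=; lia_goal.
- by apply: dvd_add ek edvd0 _; case: (uv) => -[-> _]; rewrite /content /=; lia_goal.
- by apply: pos_eq h1 _; vec.
by apply: pos_eq h2 _; vec.
Qed.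

Lemma regular_undel : regular (del mu x) -> regular mu.
Proof.
move=> rg a b ma na mb nb k0 ek h1 h2.
have wr := regular_wregular (down_closed_del sh rx) rg.
have sub c : ~~ mu c -> ~~ del mu x c by apply: contra => /andP[].
case: (eqVneq a x) => ax; case: (eqVneq b x) => bx.
- have h0 := edvd0; have := dvd_small ek h0; rewrite ax bx; move: e3; lia_goal.
- apply: (regular_undel_unit (z := b) (or_introl (conj erefl erefl)) rg wr) => //.
  + by move: k0; rewrite ax /content /=; lia_goal.
  + by apply: dvd_add ek edvd0 _; rewrite ax /content /=; lia_goal.
  + by rewrite -ax.
  by rewrite -ax.
- apply: (regular_undel_unit (z := a) (or_intror (conj erefl erefl)) rg wr) => //.
  + by move: k0; rewrite bx /content /=; lia_goal.
  + by apply: dvd_add ek edvd0 _; rewrite bx /content /=; lia_goal.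
  + by rewrite -bx; apply: pos_eq h2 _; vec.
  by rewrite -bx; apply: pos_eq h1 _; vec.
apply: (rg a b) => //; rewrite /del ?ma ?mb //=; exact: sub.
Qed.
End Closure.

(* Unlike [good], this does not depend on whether x itself belongs to lam, and
   it is invariant under [dual]. *)
Definition balanced (lam : point -> bool) (i : int) (x : point) : Prop :=
  (forall z, x ≺ z -> \sum_(w <- box | inres i w && ((x ≺ w) && (w ⪯ z))) sg lam w <= 0) /\
  (forall z, z ≺ x -> 0 <= \sum_(w <- box | inres i w && ((z ⪯ w) && (w ≺ x))) sg lam w).

Lemma ht_diff_strict lam i x z : x ≺ z ->
  - \sum_(w <- box | inres i w && (x ≺ w)) sg lam w =
  - \sum_(w <- box | inres i w && (z ≺ w)) sg lam w
  - \sum_(w <- box | inres i w && ((x ≺ w) && (w ⪯ z))) sg lam w.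
Proof.
move=> xz; rewrite -opprD; congr (- _).
rewrite big_mkcond [X in _ = X + _]big_mkcond [X in _ = _ + X]big_mkcond -big_split /=.
apply: eq_bigr => w _; case: (inres i w) => //=.
rewrite (pt_leNlt w z); case: (boolP (z ≺ w)) => zw /=; last by rewrite andbT add0r.
by rewrite (pt_lt_trans xz zw) addr0.
Qed.

Lemma goodP lam i x : good lam i x <->
  [/\ removable lam x, inres i x, x \in box & balanced lam i x].
Proof.
split=> [g|[rx ix xb [bal1 bal2]]].
  have [xb ix rx] := good_removable g; split=> //.
  have Hs := good_strict g; case: g => -[hm hf] hp.
  split=> z zx; last by have := hm z; rewrite (ht_diff lam i (pt_ltW zx)) lerBlDr lerDl.
  have := ht_diff_strict lam i zx; rewrite Hs.
  have := ht_next lam i z; set U := - \sum_(_ <- _ | _) _; set W := \sum_(_ <- _ | _) _.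
  have : U < ht lam i x.
    have := ht_next lam i z; rewrite -/U.
    by case=> [->//|[z' _ [zz' ->]]]; apply/hf/(pt_lt_trans zx).
  by move: U W (ht lam i x); lia_goal.
have cut (P : pred point) : (forall w w', P w' -> w ⪯ w' -> x ≺ w -> P w) ->
    (forall w, P w -> x ≺ w) -> \sum_(w <- box | inres i w && P w) sg lam w <= 0.
  move=> dc up; case: (altP (filter P box =P [::])) => [E|/max_seq [m]].
    rewrite big_seq_cond big1 // => w /and3P[wb _ Pw].
    by have: w \in [seq w <- box | P w]; [rewrite mem_filter Pw|rewrite E].
  rewrite mem_filter => /andP[Pm mb] mmax.
  apply: le_trans (bal1 m (up m Pm)); rewrite le_eqVlt; apply/orP; left; apply/eqP.
  rewrite big_seq_cond [RHS]big_seq_cond; apply: eq_bigl => w.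
  case: (boolP (w \in box)) => //= wb; case: (inres i w) => //=.
  apply/idP/andP => [Pw|[xw wm]]; last exact: dc Pm wm xw.
  by split; [exact: up|apply: mmax; rewrite mem_filter Pw].
have Ex : ht lam i x = - \sum_(w <- box | inres i w && (x ≺ w)) sg lam w + 1.
  rewrite ht_split xb ix /= /sg rx; have /and3P[lx _ _] := rx.
  by rewrite /addable lx /=; lia_goal.
split; last first.
  have : \sum_(w <- box | inres i w && (x ≺ w)) sg lam w <= 0 by exact: cut.
  by rewrite Ex; move: (\sum_(w <- box | _) sg lam w); lia_goal.
have strict z : x ≺ z -> ht lam i z < ht lam i x.
  move=> xz.
  have E : \sum_(w <- box | inres i w && (x ≺ w)) sg lam w =
     \sum_(w <- box | inres i w && (z ⪯ w)) sg lam w +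
     \sum_(w <- box | inres i w && ((x ≺ w) && (w ≺ z))) sg lam w.
    rewrite big_mkcond [X in _ = X + _]big_mkcond [X in _ = _ + X]big_mkcond -big_split /=.
    apply: eq_bigr => w _; case: (inres i w) => //=.
    rewrite (pt_ltNle w z); case: (boolP (z ⪯ w)) => zw /=; last by rewrite andbT add0r.
    by rewrite (pt_lt_le_trans xz zw) addr0.
  have : \sum_(w <- box | inres i w && ((x ≺ w) && (w ≺ z))) sg lam w <= 0.
    apply: cut => [w w' /andP[_ wz] ww' xw|w /andP[]//].
    by rewrite xw (pt_le_lt_trans ww' wz).
  rewrite Ex E /ht.
  move: (\sum_(w <- box | inres i w && (z ⪯ w)) sg lam w).
  by move: (\sum_(w <- box | _) sg lam w); lia_goal.
split=> // z; have [zx|/strict/ltW//|->//] := pt_lt_or z x.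
by rewrite (ht_diff lam i (pt_ltW zx)) lerBlDr lerDl bal2.
Qed.

Lemma balanced_ext lam mu i x :
  (forall w, inres i w -> w != x -> sg lam w = sg mu w) -> balanced lam i x -> balanced mu i x.
Proof.
move=> E [b1 b2]; split=> z zx; [move: (b1 z zx)|move: (b2 z zx)];
  congr is_true; congr (_ <= _); rewrite big_mkcond [RHS]big_mkcond; apply: eq_bigr => w _;
  case: ifP => // /and3P[iw h1 h2]; apply: E => //; first by rewrite (pt_neq_gt h1).
by rewrite (pt_neq_lt h2).
Qed.

Lemma sg_del_same i lam x w : (3 <= e)%N -> down_closed lam -> removable lam x ->
  inres i x -> inres i w -> w != x -> sg (del lam x) w = sg lam w.
Proof.
move=> e3 sh rx ix iw /negbTE wx; rewrite sg_del // wx mulr0 addr0.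
have -> : (w == side east south lam x) = false.
  apply/eqP => E; have := dvd_small iw ix; rewrite E content_side; last by left.
  by move: e3; rewrite /content /east /=; lia_goal.
have -> : (w == side south east lam x) = false.
  apply/eqP => E; have := dvd_small iw ix; rewrite E content_side; last by right.
  by move: e3; rewrite /content /south /=; lia_goal.
by rewrite !subr0.
Qed.

Lemma stepP i lam mu : (3 <= e)%N -> down_closed mu -> step i lam mu <->
  exists x, [/\ removable mu x, inres i x, x \in box, balanced lam i x & lam = del mu x].
Proof.
move=> e3 sh; split=> [[x /goodP[rx ix xb bal] ->]|[x [rx ix xb bal E]]].
  exists x; split=> //; apply: balanced_ext bal => w iw wx.
  by rewrite (@sg_del_same i).
exists x => //; apply/goodP; split=> //; apply: balanced_ext bal => w iw wx.
by rewrite E (@sg_del_same i).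
Qed.

(* Rotating the complement by a half turn preserves the order and exchanges
   e_i with f_(-i). *)
Definition dual (lam : point -> bool) : point -> bool := fun w => ~~ lam (- w).

Lemma dualK lam : dual (dual lam) = lam.
Proof. by apply: functional_extensionality => w; rewrite /dual negbK opprK. Qed.

Lemma addable_dual lam w : addable (dual lam) w = removable lam (- w).
Proof. by rewrite /addable /removable /dual negbK !opprB !(addrC _ (- w)). Qed.
Lemma removable_dual lam w : removable (dual lam) w = addable lam (- w).
Proof. by rewrite /addable /removable /dual !negbK !opprD. Qed.
Lemma sg_dual lam w : sg (dual lam) w = - sg lam (- w).
Proof. by rewrite /sg addable_dual removable_dual opprB. Qed.

Lemma down_closed_dual lam : down_closed lam -> down_closed (dual lam).
Proof.
move=> sh w; rewrite /dual !opprB => nw; split; apply: contra nw => h.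
  by have [+ _] := sh _ h; rewrite (_ : east - w - east = - w) //; vec.
by have [_] := sh _ h; rewrite (_ : south - w - south = - w) //; vec.
Qed.

Lemma inb_opp k w : inb k (- w) = inb k w.
Proof. by rewrite /inb /= !normrN. Qed.

Lemma fits_dual k lam : fits k lam -> fits k (dual lam).
Proof. by move=> f w; rewrite addable_dual removable_dual orbC => /f; rewrite inb_opp. Qed.

Lemma content_opp w : content (- w) = - content w.
Proof. by rewrite /content /=; lia_goal. Qed.

Lemma inres_opp i w : inres (- i) (- w) = inres i w.
Proof. by rewrite /inres content_opp -edvdN opprD !opprK. Qed.

Lemma wregular_dual lam : wregular lam -> wregular (dual lam).
Proof.
move=> [w1 w2]; split.
  move=> s m; rewrite addable_dual removable_dual => rs am ed h1 h2.
  apply: (w1 _ _ am rs).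
  - by apply: dvd_add ed edvd0 _; rewrite !content_opp; lia_goal.
  - by apply: pos_eq h1 _; vec.
  by apply: pos_eq h2 _; rewrite /diag; vec.
move=> u v x z uv; rewrite /dual !negbK => lx xv xuv zv zvv zu ed h1 h2.
apply: (w2 u v (- z + v) (- x + v) uv).
- by rewrite (_ : - z + v = - (z - v)) //; vec.
- by rewrite (_ : - z + v + v = - (z - v - v)) //; vec.
- by rewrite (_ : - z + v + u - v = - (z - u)) //; vec.
- by rewrite addrK.
- by rewrite (_ : - x + v - v - v = - (x + v)) //; vec.
- by rewrite (_ : - x + v - u = - (x + u - v)) //; vec.
- by apply: dvd_add ed edvd0 _; rewrite /content /=; lia_goal.
- by apply: pos_eq h1 _; vec.
by apply: pos_eq h2 _; rewrite /diag; vec.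
Qed.

Lemma sum_opp (P : pred point) (F : point -> int) :
  \sum_(w <- box | P w) F w = \sum_(w <- box | P (- w)) F (- w).
Proof.
rewrite -(big_map (@GRing.opp _) P F); apply: perm_big.
apply: uniq_perm; first exact: uniq_box.
  by rewrite map_inj_uniq ?uniq_box //; apply: oppr_inj.
move=> w; rewrite mem_box; apply/idP/mapP => [h|[w' + ->]].
  by exists (- w); rewrite ?opprK // mem_box inb_opp.
by rewrite mem_box inb_opp.
Qed.

Lemma pt_le_opp x z : (- x ⪯ - z) = (z ⪯ x).
Proof. by rewrite /leq_pt eqr_opp opprK addrC eq_sym. Qed.

Lemma balanced_dual lam i x : balanced lam i x -> balanced (dual lam) (- i) (- x).
Proof.
have E1 a b : (- a ≺ - b) = (b ≺ a) by rewrite opprK addrC.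
have E2 a b : (- a ⪯ b) = (- b ⪯ a) by rewrite -pt_le_opp opprK.
have E3 a b : (a ⪯ - b) = (b ⪯ - a) by rewrite -pt_le_opp opprK.
case=> b1 b2; split=> z h; rewrite sum_opp.
  have h' : - z ≺ x by rewrite -E1 opprK.
  have := b2 _ h'; rewrite -oppr_le0 -sumrN; congr is_true; congr (_ <= _).
  apply: eq_big => w; last by rewrite sg_dual opprK.
  by rewrite inres_opp E1 E2 (andbC (w ≺ x)).
have h' : x ≺ - z by rewrite -E1 opprK.
have := b1 _ h'; rewrite -oppr_ge0 -sumrN; congr is_true; congr (_ <= _).
apply: eq_big => w; last by rewrite sg_dual opprK.
by rewrite inres_opp E1 (E3 z) (andbC (w ⪯ - z)).
Qed.

Lemma step_dual i lam mu : (3 <= e)%N -> down_closed mu -> down_closed lam -> step i lam mu ->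
  step (- i) (dual mu) (dual lam).
Proof.
move=> e3 sh shl /(stepP _ _ e3 sh)[x [rx ix xb bal El]].
apply/stepP => //; first exact: down_closed_dual.
exists (- x); split.
- rewrite removable_dual opprK El /addable /del eqxx andbF /=.
  have /and3P[mx _ _] := rx; have [-> ->] := sh _ mx.
  by apply/andP; split; ptneq.
- by rewrite inres_opp.
- by rewrite mem_box inb_opp -mem_box.
- apply: balanced_ext (balanced_dual bal) => w iw wx.
  rewrite !sg_dual El (@sg_del_same i) //; first by rewrite -inres_opp opprK.
  by rewrite eqr_oppLR.
apply: functional_extensionality => w; rewrite /dual El /del negb_and negbK.
rewrite andb_orl -eqr_oppLR; case: eqVneq => [->|_] /=; last by rewrite andbT orbF.
have /and3P[mx _ _] := rx; by rewrite mx.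
Qed.

Definition phi (lam : point -> bool) (i : int) : int := eps (dual lam) (- i).
Definition total_sg (lam : point -> bool) (i : int) : int :=
  \sum_(w <- box | inres i w) sg lam w.

Lemma total_dual lam i : total_sg (dual lam) (- i) = - total_sg lam i.
Proof.
rewrite /total_sg sum_opp -sumrN; apply: eq_big => w; first by rewrite inres_opp.
by rewrite sg_dual opprK.
Qed.

Lemma box_neq0 : box != [::].
Proof.
have : (0, 0) \in box by rewrite mem_box /inb /=; lia_goal.
by case: box.
Qed.

Lemma phi_le lam i : phi lam i <= eps lam i + total_sg lam i.
Proof.
rewrite /phi; have [->|[z _ ->]] := eps_cases (dual lam) (- i).
  have [m mb mmin] := min_seq box_neq0.
  have := ht_le_eps lam i m; rewrite /ht /total_sg.
  have -> : \sum_(w <- box | inres i w && (m ⪯ w)) sg lam w = \sum_(w <- box | inres i w) sg lam w.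
    rewrite big_seq_cond [RHS]big_seq_cond; apply: eq_bigl => w.
    by case: (boolP (w \in box)) => //= /mmin->; rewrite andbT.
  by move: (\sum_(w <- box | _) sg lam w) (eps lam i); lia_goal.
have -> : ht (dual lam) (- i) z = total_sg lam i - \sum_(w <- box | inres i w && (- z ≺ w)) sg lam w.
  rewrite /ht sum_opp -sumrN /total_sg.
  have -> : \sum_(w <- box | inres i w) sg lam w =
     \sum_(w <- box | inres i w && (w ⪯ - z)) sg lam w +
     \sum_(w <- box | inres i w && (- z ≺ w)) sg lam w.
    rewrite big_mkcond [X in _ = X + _]big_mkcond [X in _ = _ + X]big_mkcond -big_split /=.
    apply: eq_bigr => w _; case: (inres i w) => //=.
    by rewrite (pt_leNlt w); case: (- z ≺ w); rewrite /= ?addr0 ?add0r.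
  rewrite addrK; apply: eq_big => w; last by rewrite sg_dual !opprK.
  by rewrite inres_opp -pt_le_opp opprK.
rewrite [eps _ _ + _]addrC lerD2l.
have := ht_next lam i (- z) => -[->|[z' _ [_ ->]]]; [exact: eps_ge0|exact: ht_le_eps].
Qed.

Lemma phiE lam i : phi lam i = eps lam i + total_sg lam i.
Proof.
apply/eqP; rewrite eq_le phi_le /=.
have := phi_le (dual lam) (- i); rewrite {1}/phi dualK opprK total_dual /phi.
by move: (eps lam i) (total_sg lam i) (eps _ _); lia_goal.
Qed.

Lemma total_del lam x i k : (3 <= e)%N -> down_closed lam -> removable lam x -> inb 1 x -> inres i x ->
  total_sg (del lam x) k = total_sg lam k + 2 * (edvd (k - i) : nat)%:Z
    - (edvd (k - i - 1) : nat)%:Z - (edvd (k - i + 1) : nat)%:Z.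
Proof.
move=> e3 sh rx xb ix; rewrite /total_sg.
under eq_bigr do rewrite sg_del //.
rewrite 2!sumrB big_split /= -mulr_sumr !sum_eq_pt; try by apply: side_box; [left|right].
- have E w c : content w = content x + c -> inres k w = edvd (k - i - c).
    move=> Ew; rewrite /inres Ew; apply/idP/idP => h.
      by apply: dvd_sub ix h _; lia_goal.
    by apply: dvd_sub ix h _; lia_goal.
  have -> : inres k x = edvd (k - i) by rewrite (E x 0) ?addr0 ?subr0.
  rewrite (E (side east south lam x) 1); last by rewrite content_side; [|left].
  rewrite (E (side south east lam x) (-1)); last by rewrite content_side; [|right].
  by rewrite opprK.
- by apply: side_box => //; right.
- by apply: side_box => //; left.
by rewrite mem_box inbW.
Qed.

Lemma eps_gt0_of_removable lam x i : removable lam x -> inres i x -> x \in box ->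
  (forall s, addable lam s -> x ≺ s -> inres i s -> False) -> 0 < eps lam i.
Proof.
move=> rx ix xb noadd; apply: lt_le_trans (ht_le_eps lam i x).
rewrite ht_split xb ix /=.
have -> : sg lam x = -1.
  by rewrite /sg rx; have /and3P[lx _ _] := rx; rewrite /addable lx.
rewrite opprK ltr_pwDr // oppr_ge0; apply: sumr_le0 => w /andP[iw xw].
rewrite /sg; case: (boolP (addable lam w)) => [aw|_]; first by case: (noadd w aw xw iw).
by lia_goal.
Qed.

Section Steps.
Hypothesis e3 : (3 <= e)%N.

Lemma down_closed_step i lam mu : down_closed mu -> step i lam mu -> down_closed lam.
Proof. by move=> sh [x /good_removable[_ _ rx] ->]; apply: down_closed_del. Qed.

Lemma fits_step k i lam mu : down_closed mu -> fits k.+1 mu -> step i lam mu -> fits k lam.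
Proof. by move=> sh f [x /good_removable[_ _ rx] ->]; apply: fits_del. Qed.

Lemma eps_step i lam mu : down_closed mu -> fits 1 mu -> step i lam mu -> eps lam i = eps mu i - 1.
Proof. by move=> sh f [x gx ->]; apply: eps_del. Qed.

Definition cartan (k i : int) : int :=
  2 * (edvd (k - i) : nat)%:Z - (edvd (k - i - 1) : nat)%:Z - (edvd (k - i + 1) : nat)%:Z.

Lemma total_step i k lam mu : down_closed mu -> fits 1 mu -> step i lam mu ->
  total_sg lam k = total_sg mu k + cartan k i.
Proof.
move=> sh f [x gx ->]; have [xb ix rx] := good_removable gx.
rewrite (total_del k e3 sh rx _ ix); last by apply: fits_removable rx.
by rewrite /cartan; move: (total_sg _ _); lia_goal.
Qed.

Lemma cartan_adj i j : edvd (j - i - 1) \/ edvd (j - i + 1) -> cartan j i = -1.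
Proof.
move=> h; rewrite /cartan; case: h => h; rewrite h.
  have -> : edvd (j - i) = false.
    by apply/negP => h1; have := dvd_small h1 h; move: e3; lia_goal.
  have -> : edvd (j - i + 1) = false.
    by apply/negP => h1; have := dvd_small h1 h; move: e3; lia_goal.
  by [].
have -> : edvd (j - i) = false.
  by apply/negP => h1; have := dvd_small h1 h; move: e3; lia_goal.
have -> : edvd (j - i - 1) = false.
  by apply/negP => h1; have := dvd_small h1 h; move: e3; lia_goal.
by [].
Qed.

Lemma cartan_far i j : ~~ edvd (j - i) -> ~~ edvd (j - i - 1) -> ~~ edvd (j - i + 1) ->
  cartan j i = 0.
Proof. by move=> /negbTE h1 /negbTE h2 /negbTE h3; rewrite /cartan h1 h2 h3. Qed.

Lemma local_steps i j x1 x2 y : down_closed y -> wregular y -> fits 4 y -> ~~ edvd (j - i) ->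
  step i x1 y -> step j x2 y ->
  (commuting i j x1 x2 /\ (eps x1 j = eps y j \/ eps x2 i = eps y i) /\
     (eps x1 j = eps y j /\ cartan j i = 0 \/
      eps x1 j = eps y j + 1 /\ cartan j i = -1 \/
      eps x2 i = eps y i + 1 /\ cartan i j = -1)) \/
  ([/\ eps x1 j = eps y j + 1, eps x2 i = eps y i + 1, cartan j i = -1 & cartan i j = -1]
     /\ degree4 i j y x1 x2).
Proof.
move=> sh wr f ij [x gx ->] [x' gy ->].
have adj u v : unit_pair u v -> edvd (j - i - content u) -> cartan j i = -1 /\ cartan i j = -1.
  move=> uv h; have h' : edvd (- (j - i - content u)) by rewrite edvdN.
  split; apply: cartan_adj; case: uv h h' => -[-> _] h h'.
  - by left; apply: dvd_add h edvd0 _; rewrite /content /=; lia_goal.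
  - by right; apply: dvd_add h edvd0 _; rewrite /content /=; lia_goal.
  - by right; apply: dvd_add h' edvd0 _; rewrite /content /=; lia_goal.
  by left; apply: dvd_add h' edvd0 _; rewrite /content /=; lia_goal.
have main u v : unit_pair u v -> edvd (j - i - content u) ->
    (commuting i j (del y x) (del y x') /\
     (eps (del y x) j = eps y j \/ eps (del y x') i = eps y i) /\
     (eps (del y x) j = eps y j /\ cartan j i = 0 \/
      eps (del y x) j = eps y j + 1 /\ cartan j i = -1 \/
      eps (del y x') i = eps y i + 1 /\ cartan i j = -1)) \/
  ([/\ eps (del y x) j = eps y j + 1, eps (del y x') i = eps y i + 1,
       cartan j i = -1 & cartan i j = -1] /\ degree4 i j y (del y x) (del y x')).
  move=> uv h; have [c1 c2] := adj u v uv h.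
  have [[h1 h2 h3]|[h1 h2 h3]|[h1 h2 h3]] := local_adjacent e3 sh wr f uv h gx gy.
  - by left; split=> //; split; [right|right; left].
  - by left; split=> //; split; [left|right; right].
  by right.
have [h1|n1] := boolP (edvd (j - i - 1)).
  by apply: (main east south (or_introl (conj erefl erefl))).
have [h2|n2] := boolP (edvd (j - i + 1)).
  apply: (main south east (or_intror (conj erefl erefl))).
  by apply: dvd_add h2 edvd0 _; rewrite /content /=; lia_goal.
have [h1 h2 h3] := local_far e3 sh f ij n1 n2 gx gy.
left; split=> //; split; first by left.
by left; split=> //; apply: cartan_far.
Qed.

Lemma local_below i j x1 x2 y : down_closed y -> wregular y -> fits 5 y -> ~~ edvd (j - i) ->
  step i x1 y -> step j x2 y ->
  (exists z, [/\ step j z x1, step i z x2 & phi x2 j = phi z j \/ phi x1 i = phi z i]) \/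
  (exists z c1 c2 d1 d2, [/\ step i z c1, step j c1 c2 & step j c2 x1] /\
     [/\ step j z d1, step i d1 d2, step i d2 x2, phi c1 j <> phi z j & phi d1 i <> phi z i]).
Proof.
move=> sh wr f ij s1 s2.
have f4 : fits 4 y := fitsW f.
have f1y : fits 1 y by do 4!apply: fitsW.
have sh1 := down_closed_step sh s1; have sh2 := down_closed_step sh s2.
have g1 : fits 4 x1 := fits_step sh f s1; have g2 : fits 4 x2 := fits_step sh f s2.
have g1' : fits 1 x1 by do 3!apply: fitsW.
have g2' : fits 1 x2 by do 3!apply: fitsW.
have E1 := eps_step sh f1y s1; have E2 := eps_step sh f1y s2.
have [[[z [sz1 sz2]] [_ h]]|[[h1 h2 c1 c2] [a1 [a2 [b1 [b2 [z [[t1 t2 t3 Et] [r1 r2 r3 Er]]]]]]]]] :=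
    local_steps sh wr f4 ij s1 s2.
  left; exists z; split=> //; rewrite !phiE.
  have Ez1 := eps_step sh1 g1' sz1; have Ez2 := eps_step sh2 g2' sz2.
  have Tz1 := total_step i sh1 g1' sz1; have Tz2 := total_step j sh2 g2' sz2.
  by case: h => [[h c]|[[h c]|[h c]]]; [left|left|right];
    move: h c Ez1 Ez2 Tz1 Tz2 E1 E2; clear_props;
    move: (eps _ _) (eps _ _) (eps _ _) (eps _ _) (eps _ _) (eps _ _) (eps _ _); lia.
right; exists z, a2, a1, b2, b1.
have sa1 := down_closed_step sh1 t1; have sa2 := down_closed_step sa1 t2.
have sb1 := down_closed_step sh2 r1; have sb2 := down_closed_step sb1 r2.
have fa1 := fits_step sh1 g1 t1; have fb1 := fits_step sh2 g2 r1.
have fa2 := fits_step sa1 fa1 t2; have fb2 := fits_step sb1 fb1 r2.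
have ea1 := eps_step sh1 g1' t1.
have ea2 := eps_step sa1 (fitsW (fitsW fa1)) t2.
have eb1 := eps_step sh2 g2' r1.
have eb2 := eps_step sb1 (fitsW (fitsW fb1)) r2.
have ez1 := eps_step sa2 (fitsW fa2) t3.
have ez2 := eps_step sb2 (fitsW fb2) r3.
have Tz1 := total_step j sa2 (fitsW fa2) t3; have Tz2 := total_step i sb2 (fitsW fb2) r3.
by split; split=> //; rewrite !phiE;
  [move: ea1 ea2 ez2 Er h1 Tz1 c1; lia_goal|move: eb1 eb2 ez1 Et h2 Tz2 c2; lia_goal].
Qed.

Lemma step_dual_inv i lam mu : down_closed mu -> step (- i) mu (dual lam) -> down_closed lam ->
  step i lam (dual mu).
Proof.
move=> sh st shl.
have := step_dual e3 (down_closed_dual shl) sh st; rewrite dualK opprK; exact.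
Qed.

Lemma local_above i j z x1 x2 : down_closed z -> wregular z -> fits 5 z ->
  down_closed x1 -> down_closed x2 -> ~~ edvd (j - i) -> step i z x1 -> step j z x2 ->
  (phi x1 j = phi z j \/ phi x2 i = phi z i -> exists y, [/\ down_closed y, step j x1 y & step i x2 y]) /\
  (phi x1 j <> phi z j -> phi x2 i <> phi z i ->
    exists a1 a2 b1 b2 y, [/\ step j x1 a1, step j a1 a2 & step i a2 y] /\
      [/\ step i x2 b1, step i b1 b2 & step j b2 y] /\
      [/\ down_closed a1, down_closed a2, down_closed b1, down_closed b2 & down_closed y]).
Proof.
move=> sh wr f sh1 sh2 ij s1 s2.
have t1 := step_dual e3 sh1 sh s1; have t2 := step_dual e3 sh2 sh s2.
have ij' : ~~ edvd (- j - - i) by rewrite -edvdN opprB opprK addrC.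
have f4 : fits 4 (dual z) by apply/fitsW/fits_dual.
have := local_steps (down_closed_dual sh) (wregular_dual wr) f4 ij' t1 t2.
case=> [[[y [sy1 sy2]] [h _]]|[[h1 h2 _ _] [a1 [a2 [b1 [b2 [y [[r1 r2 r3 _] [u1 u2 u3 _]]]]]]]]].
  split; last by case: h => h n1 n2; rewrite /phi in n1 n2; [case: n1|case: n2].
  move=> _; have shy := down_closed_step (down_closed_dual sh1) sy1.
  by exists (dual y); split; [apply: down_closed_dual|apply: step_dual_inv|apply: step_dual_inv].
split; first by rewrite /phi => -[h|h]; move: h1 h2; rewrite h; lia_goal.
move=> _ _.
have sa1 := down_closed_step (down_closed_dual sh1) r1; have sa2 := down_closed_step sa1 r2.
have sb1 := down_closed_step (down_closed_dual sh2) u1; have sb2 := down_closed_step sb1 u2.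
have shy := down_closed_step sa2 r3.
exists (dual a1), (dual a2), (dual b1), (dual b2), (dual y).
split; first by split; apply: step_dual_inv; rewrite ?dualK //; apply: down_closed_dual.
split; last by split; apply: down_closed_dual.
by split; apply: step_dual_inv; rewrite ?dualK //; apply: down_closed_dual.
Qed.
End Steps.
End Order.

(** * Arm sequences and partitions *)

Section ArmOrder.
Variables (e : nat) (A : nat -> nat).

Definition threshold (s : int) : int :=
  if s == 0 then 1 else if 0 < s then (A `|s|%N)%:Z + 1 else - (A `|s|%N)%:Z.

(* For w of content e * t this compares - w.2 with A_|t|, as in the order on
   nodes; scaling by e extends that order to differences of any content. *)
Definition arm_pos (w : point) : bool := threshold (content w) <= e%:Z * w.2.

Lemma threshold_pos n : (0 < n)%N -> threshold n%:Z = (A n)%:Z + 1.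
Proof. by case: n. Qed.

Lemma threshold_neg n : (0 < n)%N -> threshold (- n%:Z) = - (A n)%:Z.
Proof. by case: n. Qed.

Lemma int_cases (s : int) :
  s = 0 \/ exists n, (0 < n)%N /\ (s = n%:Z \/ s = - n%:Z).
Proof.
case: (ltrgtP s 0) => h; last by left.
  by right; exists `|s|%N; split; [lia|right; lia].
by right; exists `|s|%N; split; [lia|left; lia].
Qed.

Hypothesis hA : arm_seq e A.

Lemma arm_add s t u : (0 < t)%N -> (0 < u)%N -> s = (t + u)%N ->
  (A t + A u <= A s <= (A t + A u).+1)%N.
Proof. by move=> ht hu ->; case: hA => _ /(_ t u ht hu) [] ->; lia. Qed.

Lemma arm_mul n t : (0 < n)%N -> (0 < t)%N -> (n * A t <= A (n * t) < n * (A t).+1)%N.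
Proof.
case: n => // n _ ht; elim: n => [|n IH]; first by rewrite !mul1n; lia.
have hn : (0 < n.+1 * t)%N by rewrite muln_gt0 ht.
have := arm_add ht hn (erefl _); rewrite -mulSn; move: IH.
rewrite [(n.+2 * A t)%N]mulSn [(n.+2 * (A t).+1)%N]mulSn.
by move: (A (n.+1 * t)) (A (n.+2 * t)) (n.+1 * A t)%N (n.+1 * (A t).+1)%N; lia.
Qed.

Lemma threshold_add s t : threshold (s + t) <= threshold s + threshold t.
Proof.
have t0 : threshold 0 = 1 by [].
have [->|[n [n0 hn]]] := int_cases s; first by rewrite add0r t0; lia.
have [->|[m [m0 hm]]] := int_cases t; first by rewrite addr0 t0; lia.
case: hn => ->; case: hm => ->; rewrite ?(threshold_pos n0) ?(threshold_pos m0) ?(threshold_neg n0) ?(threshold_neg m0).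
- rewrite -PoszD threshold_pos; last by lia.
  by have := arm_add n0 m0 (erefl _); lia.
- case: (ltngtP n m) => nm.
  + have -> : n%:Z - m%:Z = - (m - n)%N%:Z by lia.
    rewrite threshold_neg ?subn_gt0 //.
    by have := @arm_add m n (m - n)%N n0; lia.
  + have -> : n%:Z - m%:Z = (n - m)%N%:Z by lia.
    rewrite threshold_pos ?subn_gt0 //.
    by have := @arm_add n m (n - m)%N m0; lia.
  by rewrite nm subrr t0; lia.
- case: (ltngtP n m) => nm.
  + have -> : - n%:Z + m%:Z = (m - n)%N%:Z by lia.
    rewrite threshold_pos ?subn_gt0 //.
    by have := @arm_add m n (m - n)%N n0; lia.
  + have -> : - n%:Z + m%:Z = - (n - m)%N%:Z by lia.
    rewrite threshold_neg ?subn_gt0 //.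
    by have := @arm_add n m (n - m)%N m0; lia.
  by rewrite nm addNr t0; lia.
have -> : - n%:Z - m%:Z = - (n + m)%N%:Z by lia.
rewrite threshold_neg; last by lia.
by have := arm_add n0 m0 (erefl _); lia.
Qed.

Hypothesis e3 : (3 <= e)%N.

Lemma threshold_opp s : s != 0 -> threshold (- s) = 1 - threshold s.
Proof.
have [->//|[n [n0 [->|->]]] _] := int_cases s.
  by rewrite threshold_pos // threshold_neg //; lia.
by rewrite opprK threshold_pos // threshold_neg //; lia.
Qed.

Lemma arm_good_order : good_order arm_pos.
Proof.
have A1 : (A 1 <= e - 1)%N by case: hA => /(_ 1%N isT) /andP[_ +] _; rewrite muln1.
split.
- move=> a b; rewrite /arm_pos /= mulrDr.
  have -> : content (a + b) = content a + content b by rewrite /content /=; lia.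
  have := threshold_add (content a) (content b).
  by move: (e%:Z * a.2) (e%:Z * b.2); lia.
- move=> a a0; rewrite /arm_pos content_opp /= mulrN.
  case: (eqVneq (content a) 0) => [c0|n0]; last first.
    by rewrite threshold_opp //; move: (threshold _) (e%:Z * a.2); lia.
  rewrite c0 oppr0 /threshold eqxx.
  have : a.2 != 0.
    apply: contra a0 => /eqP a20; apply/eqP/injective_projections => //=.
    by move: c0; rewrite /content a20; lia.
  by move: (a.2) e3; clear; nia.
- by rewrite /arm_pos mulr0.
- by rewrite /arm_pos /east /content /= (@threshold_pos 1) // mulr1; lia.
by rewrite /arm_pos /south /content /= (@threshold_neg 1) // mulr0; lia.
Qed.

Lemma arm_pos_ge w t : (0 < t)%N -> content w = - (e%:Z * t%:Z) ->
  arm_pos w = (- w.2 <= (A t)%:Z).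
Proof.
move=> t0 Ew; rewrite /arm_pos Ew -PoszM threshold_neg ?muln_gt0 ?t0 ?andbT; last by lia.
have e0 : (0 < e)%N by lia.
have /andP[h1 h2] := arm_mul e0 t0.
apply/idP/idP => h; move: h1 h2 h e3; move: (A (e * t)) (A t) (w.2); clear; nia.
Qed.

Lemma arm_pos_lt w t : (0 < t)%N -> content w = e%:Z * t%:Z ->
  arm_pos w = ((A t)%:Z < w.2).
Proof.
move=> t0 Ew; rewrite /arm_pos Ew -PoszM threshold_pos ?muln_gt0 ?t0 ?andbT; last by lia.
have e0 : (0 < e)%N by lia.
have /andP[h1 h2] := arm_mul e0 t0.
apply/idP/idP => h; move: h1 h2 h e3; move: (A (e * t)) (A t) (w.2); clear; nia.
Qed.

Lemma arm_pos_diag w : content w = 0 -> arm_pos w = (0 < w.2).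
Proof.
move=> Ew; rewrite /arm_pos Ew /threshold eqxx; move: (w.2) e3; clear => a h.
by apply/idP/idP; nia.
Qed.

Definition to_point (x : nat * nat) : point := (x.1%:Z, x.2%:Z).

Lemma precE i x y : inres e i (to_point x) -> inres e i (to_point y) ->
  prec e A x y = leq_pt arm_pos (to_point x) (to_point y).
Proof.
case: x y => [r c] [s d] rx ry; rewrite /prec /leq_pt.
have Ec w : w = to_point (s, d) - to_point (r, c) -> content w = - (s%:Z - r%:Z + c%:Z - d%:Z).
  by move=> ->; rewrite /content /=; clear; lia.
have : edvd e (s%:Z - r%:Z + c%:Z - d%:Z).
  by apply: dvd_sub rx ry _; rewrite /content /=; clear; lia.
rewrite /edvd => /dvdzP[q]; set k := _ + _ - _ => Ek.
have e0 : e%:Z != 0 by apply/eqP; lia.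
have Ecq := Ec _ erefl; rewrite -/k Ek in Ecq.
have -> : (to_point (s, d) == to_point (r, c)) = (s == r) && (d == c) by [].
have Edk : k = s%:Z - r%:Z + c%:Z - d%:Z by [].
case: (ltrgtP q 0) => q0.
- have -> : (0 <= k) = false by apply/negbTE; rewrite -ltNge Ek pmulr_llt0 //; lia.
  have q1 : (0 < `|q|)%N by lia.
  have Eq : content (to_point (s, d) - to_point (r, c)) = e%:Z * `|q|%N%:Z.
    by rewrite Ecq abszE (ltr0_norm q0) mulrN mulrC.
  rewrite (arm_pos_lt q1 Eq) Ek -mulNr mulzK // abszN /Aext eqn0Ngt q1 /= -ltNge.
  rewrite orb_idl //.
  move=> /andP[/eqP E1 /eqP E2]; exfalso; move: Ek q0 e3; rewrite Edk E1 E2; clear; nia.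
- have -> : (0 <= k) by rewrite Ek mulr_ge0 //; lia.
  have q1 : (0 < `|q|)%N by lia.
  have Eq : content (to_point (s, d) - to_point (r, c)) = - (e%:Z * `|q|%N%:Z).
    by rewrite Ecq abszE (gtr0_norm q0) mulrC.
  rewrite (arm_pos_ge q1 Eq) Ek mulzK // /Aext eqn0Ngt q1 /= opprB.
  rewrite orb_idl //.
  move=> /andP[/eqP E1 /eqP E2]; exfalso; move: Ek q0 e3; rewrite Edk E1 E2; clear; nia.
rewrite arm_pos_diag; last by rewrite Ecq q0 mul0r oppr0.
have k0 : k = 0 by rewrite Ek q0 mul0r.
rewrite k0 lexx div0z /Aext /=; move: k0; rewrite Edk; clear; lia.
Qed.
End ArmOrder.

(* The complement of the positive quadrant is included, so that addable and
   removable nodes need no boundary cases. *)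
Definition shape_of (l : seq nat) : point -> bool :=
  fun w => [|| w.1 <= 0, w.2 <= 0 | w.2 <= (part l `|w.1|%N)%:Z].

Lemma part_size l r : (size l < r)%N -> part l r = 0%N.
Proof. by move=> h; rewrite /part nth_default //; lia. Qed.

Lemma part_pos l r : is_partition l -> (0 < r <= size l)%N -> (0 < part l r)%N.
Proof.
move=> /andP[_ /all_nthP h] hr; apply: h; lia.
Qed.

Lemma part_succ l r : is_partition l -> (0 < r)%N -> (part l r.+1 <= part l r)%N.
Proof.
move=> /andP[/(sortedP 0%N) h _] hr; case: (leqP (size l) r) => hs.
  by rewrite part_size // ltnS.
by case: r hr hs => // r _ hs; apply: h.
Qed.

Lemma part_mono l r s : is_partition l -> (0 < r <= s)%N -> (part l s <= part l r)%N.
Proof.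
move=> hl /andP[r0 /subnKC <-]; elim: (s - r)%N => [|k IH]; first by rewrite addn0.
by rewrite addnS; apply: leq_trans (part_succ hl _) IH; lia.
Qed.

Lemma partitionI l : (forall r, (0 < r < size l)%N -> (part l r.+1 <= part l r)%N) ->
  (forall r, (0 < r <= size l)%N -> (0 < part l r)%N) -> is_partition l.
Proof.
move=> h1 h2; apply/andP; split.
  by apply/(sortedP 0%N) => k hk; apply: (h1 k.+1).
by apply/(all_nthP 0%N) => k hk; apply: (h2 k.+1).
Qed.

Lemma partition_ext l m : is_partition l -> is_partition m ->
  (forall r, (0 < r)%N -> part l r = part m r) -> l = m.
Proof.
have sz l1 l2 : is_partition l2 -> (forall r, (0 < r)%N -> part l1 r = part l2 r) ->
    (size l2 <= size l1)%N.
  move=> h2 E; rewrite leqNgt; apply/negP => lt.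
  have := part_pos h2 (r := (size l1).+1) lt.
  by rewrite -E // part_size.
move=> hl hm E; apply: (@eq_from_nth _ 0%N) => [|k hk]; last by apply: (E k.+1).
by apply/eqP; rewrite eqn_leq !sz // => r r0; rewrite E.
Qed.

Lemma shape_ofE l r (c : int) : (0 < r)%N -> shape_of l (r%:Z, c) = (c <= (part l r)%:Z).
Proof. by move=> r0; rewrite /shape_of /=; apply/idP/idP; lia. Qed.

Lemma shape_of_inj l m : is_partition l -> is_partition m ->
  shape_of l = shape_of m -> l = m.
Proof.
move=> hl hm E; apply: partition_ext => // r r0.
have h c : (c <= (part l r)%:Z) = (c <= (part m r)%:Z) by rewrite -!shape_ofE // E.
by have := h (part l r)%:Z; have := h (part m r)%:Z; lia.
Qed.

Lemma shape_shape_of l : is_partition l -> down_closed (shape_of l).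
Proof.
move=> hl [a b]; rewrite /shape_of /east /south /= !subr0 => h; split.
  by apply/or3P; case/or3P: h => h; [constructor 1|constructor 2; lia|constructor 3; lia].
case/or3P: h => h; apply/or3P; [constructor 1; lia|constructor 2; lia|].
case: (lerP a 1) => a1; first by constructor 1; lia.
constructor 3; apply: le_trans h _; rewrite lez_nat; apply: part_mono => //; lia.
Qed.

Lemma addable_shape_of l w : is_partition l -> addable (shape_of l) w <->
  exists r, [/\ (0 < r)%N, w = to_point (r, (part l r).+1) &
    (r == 1%N) || (part l r < part l r.-1)%N].
Proof.
move=> hl; case: w => a b; rewrite /addable /shape_of /to_point /east /south /= !subr0; split.
  move=> /and3P[n1 n2 n3]; exists `|a|%N.
  have Ea : a = `|a|%N%:Z by lia.
  have Eb : b = (part l `|a|%N).+1%:Z by lia.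
  split; [by lia|by rewrite {1}Ea Eb|].
  case: eqP => //= a1; have Ea1 : `|(a - 1)%R|%N = (`|a|.-1)%N by lia.
  by move: n3; rewrite Ea1; lia.
move=> [r [r0 [-> ->] hr]] /=.
apply/and3P; split; [by lia|by lia|].
case/orP: hr => hr; first by lia.
have -> : `|(r%:Z - 1)%R|%N = r.-1 by lia.
by lia.
Qed.

Lemma removable_shape_of l w : is_partition l -> removable (shape_of l) w <->
  exists r, [/\ (0 < r <= size l)%N, w = to_point (r, part l r) & (part l r.+1 < part l r)%N].
Proof.
move=> hl; case: w => a b; rewrite /removable /shape_of /to_point /east /south /= !addr0; split.
  move=> /and3P[n1 n2 n3]; exists `|a|%N.
  have Ea : a = `|a|%N%:Z by lia.
  have Ea1 : `|(a + 1)%R|%N = `|a|.+1%N by lia.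
  rewrite Ea1 in n3.
  have Eb : b = (part l `|a|%N)%:Z by lia.
  have lt : (part l `|a|.+1 < part l `|a|)%N by lia.
  split => //; last by rewrite {1}Ea Eb.
  apply/andP; split; first by lia.
  by rewrite leqNgt; apply/negP => h; move: lt; rewrite (part_size h).
move=> [r [/andP[r0 rs] [-> ->] hr]].
have -> : `|(r%:Z + 1)%R|%N = r.+1 by lia.
by rewrite /=; apply/and3P; split; lia.
Qed.

Lemma part_incr l r s : (0 < r)%N -> (0 < s)%N ->
  part (incr_nth l r.-1) s = (part l s + (r == s))%N.
Proof.
move=> r0 s0; rewrite /part nth_incr_nth addnC; congr (_ + _)%N.
by case: r r0 => // r _; case: s s0 => // s _.
Qed.

Lemma partition_incr l r : is_partition l -> (0 < r)%N ->
  (r == 1%N) || (part l r < part l r.-1)%N -> is_partition (incr_nth l r.-1).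
Proof.
move=> hl r0 hr.
have rs : (r <= (size l).+1)%N.
  case/orP: hr => [/eqP->//|hr]; rewrite leqNgt; apply/negP => h.
  by move: hr; rewrite (@part_size l r.-1) //; lia.
have Es : size (incr_nth l r.-1) = maxn (size l) r.
  by rewrite size_incr_nth; case: ltnP => h; lia.
apply: partitionI => s; rewrite Es => hs.
  rewrite !part_incr //; last by lia.
  have := part_succ hl (r := s); case: (eqVneq r s.+1) => [E|n]; last by lia.
  have -> : (r == s) = false by lia.
  by case/orP: hr => [|hr]; [lia|move: hr; rewrite E /=; lia].
rewrite part_incr //; last by lia.
case: (leqP s (size l)) => h; last by have -> : r = s by [lia]; rewrite eqxx addn1.
by have := part_pos hl (r := s); lia.
Qed.

Lemma sumn_incr l k : sumn (incr_nth l k) = (sumn l).+1.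
Proof.
elim: l k => [|x l IH] [|k] //=; first by elim: k => //= k ->.
by rewrite IH addnS.
Qed.

Lemma del_incr l r : is_partition l -> (0 < r)%N ->
  (r == 1%N) || (part l r < part l r.-1)%N ->
  let x := to_point (r, (part l r).+1) in
  removable (shape_of (incr_nth l r.-1)) x /\
  shape_of l = del (shape_of (incr_nth l r.-1)) x.
Proof.
move=> hl r0 hr x; have hm := partition_incr hl r0 hr.
have Er : part (incr_nth l r.-1) r = (part l r).+1 by rewrite part_incr // eqxx addn1.
split.
  apply/removable_shape_of => //; exists r; split; last 1 first.
  - rewrite Er part_incr //; have -> : (r == r.+1) = false by lia.
    by have := part_succ hl r0; lia.
  - rewrite r0 /= leqNgt; apply/negP => /part_size; rewrite Er //.
  by rewrite Er.
apply: functional_extensionality => -[a b]; rewrite /del /shape_of /x /to_point xpair_eqE /=.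
case: (ltrP 0 a) => a0; last first.
  by rewrite /=; have -> : (a == r%:Z) = false by lia.
rewrite part_incr //; last by lia.
case: (eqVneq a r%:Z) => [->|n] /=.
  by rewrite ?absz_nat eqxx; apply/idP/idP; lia.
have -> : (r == `|a|%N) = false by lia.
by rewrite addn0 andbT.
Qed.

Lemma partition_of_fun (f : nat -> nat) n : f n = 0%N ->
  (forall k, (f k.+1 <= f k)%N) ->
  exists l, is_partition l /\ forall r, (0 < r)%N -> part l r = f r.-1.
Proof.
move=> fn fm.
have ex : exists k, f k == 0%N by exists n; rewrite fn.
have [k0 /eqP fk kmin] := ex_minnP ex.
have f0 k : (k0 <= k)%N -> f k = 0%N.
  by move=> /subnKC <-; elim: (k - k0)%N => [|j IH]; rewrite ?addn0 // addnS; have := fm (k0 + j)%N; lia.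
have P r : (0 < r)%N -> part (mkseq f k0) r = f r.-1.
  move=> r0; rewrite /part; case: (ltnP r.-1 k0) => h; first by rewrite nth_mkseq.
  by rewrite nth_default ?size_mkseq // f0.
exists (mkseq f k0); split=> //; apply: partitionI => r; rewrite size_mkseq => hr.
  by rewrite !P //; [case: r hr => // r _; exact: fm|lia].
rewrite P; last by lia.
rewrite lt0n; apply/negP => h; have := kmin _ h; lia.
Qed.

Lemma del_partition m x : is_partition m -> removable (shape_of m) x ->
  exists l, is_partition l /\ shape_of l = del (shape_of m) x.
Proof.
move=> hm /removable_shape_of-/(_ hm)[r [/andP[r0 rs] -> lt]].
have [||l [hl P]] := @partition_of_fun (fun k => (part m k.+1 - (k.+1 == r))%N) (size m).
- by rewrite part_size.
- move=> k; have := part_succ hm (r := k.+1) isT.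
  case: (eqVneq k.+1 r) => [E|n]; last by lia.
  by rewrite E; have -> : (r.+1 == r) = false by [lia]; lia.
exists l; split=> //.
apply: functional_extensionality => -[a b]; rewrite /del /shape_of /to_point xpair_eqE /=.
case: (ltrP 0 a) => a0; last first.
  by rewrite /=; have -> : (a == r%:Z) = false by lia.
rewrite P; last by lia.
have -> : (`|a|.-1.+1)%N = `|a|%N by lia.
case: (eqVneq a r%:Z) => [->|n] /=.
  by rewrite ?absz_nat eqxx; have := part_pos hm (r := r); rewrite r0 rs => /(_ isT) h; apply/idP/idP; lia.
have -> : (`|a|%N == r) = false by lia.
by rewrite subn0 andbT.
Qed.

Lemma add_partition l mu x : is_partition l -> down_closed mu -> removable mu x ->
  shape_of l = del mu x ->
  exists m, [/\ is_partition m, mu = shape_of m, sumn m = (sumn l).+1 &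
    exists r, [/\ (0 < r)%N, x = to_point (r, (part l r).+1), m = incr_nth l r.-1 &
      (r == 1%N) || (part l r < part l r.-1)%N]].
Proof.
move=> hl sh rx E; have /and3P[mx nE nS] := rx; have [xE xS] := sh _ mx.
have ax : addable (shape_of l) x.
  rewrite E /addable /del eqxx andbF xE xS /=.
  by apply/andP; split; ptneq.
have /(addable_shape_of _ hl)[r [r0 Ex hr]] := ax.
exists (incr_nth l r.-1); split.
- exact: partition_incr.
- have [rx' E'] := del_incr hl r0 hr; rewrite -Ex in rx' E'.
  apply: functional_extensionality => w; have := congr1 (fun f => f w) E'.
  have := congr1 (fun f => f w) E; rewrite /del => -> h.
  case: (eqVneq w x) h => [->|_]; last by rewrite !andbT.
  by move=> _; rewrite mx; have /and3P[-> _ _] := rx'.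
- exact: sumn_incr.
by exists r.
Qed.

Lemma part_le_sumn l r : (0 < r)%N -> (part l r <= sumn l)%N.
Proof.
case: r => // r _; rewrite /part /=; elim: l r => [|x l IH] [|r] //=; first by lia.
by have := IH r; lia.
Qed.

Lemma size_le_sumn l : is_partition l -> (size l <= sumn l)%N.
Proof. by move=> /andP[_]; elim: l => //= x l IH /andP[x0 /IH]; lia. Qed.

Lemma fits_shape_of N k l : is_partition l -> (sumn l + k < N)%N -> fits N k (shape_of l).
Proof.
move=> hl hN w; have h1 := size_le_sumn hl.
case/orP => [/(addable_shape_of _ hl)|/(removable_shape_of _ hl)] [r [r0 -> h]].
  have h2 := part_le_sumn l r0.
  have : (r <= (size l).+1)%N.
    case/orP: h => [/eqP->//|h]; rewrite leqNgt; apply/negP => h3.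
    by move: h; rewrite (@part_size l r.-1) //; lia.
  by rewrite /inb /=; lia.
have h2 := @part_le_sumn l r; rewrite /inb /=; lia.
Qed.

Lemma conjp_le l r c : is_partition l -> (0 < r)%N -> (0 < c)%N ->
  (r <= conjp l c)%N = (c <= part l r)%N.
Proof.
move=> /andP[+ _]; rewrite /conjp /part; elim: l r => [|x l IH] r srt r0 c0.
  by rewrite /= nth_nil; lia.
have srt' : sorted geq l by case: l srt {IH} => //= y l /andP[].
have bound : all (fun y => y <= x)%N l.
  by move: srt; rewrite /= path_sortedE => [/andP[]//|a b d /= h1 h2]; apply: leq_trans h2 h1.
case: r r0 => // -[|r] _ /=.
  case: (leqP c x) => h; first by rewrite add1n.
  rewrite add0n; apply/negbTE; rewrite -leqNgt leqn0 -/(conjp _ _).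
  rewrite eqn0Ngt -has_count; apply/hasPn => y /(allP bound) /= hy; lia.
rewrite -(IH r.+1) //; case: (leqP c x) => h; first by rewrite add1n.
rewrite add0n; have -> : count (fun y => c <= y)%N l = 0%N; last by [].
by apply/eqP; rewrite eqn0Ngt -has_count; apply/hasPn => y /(allP bound) /= hy; lia.
Qed.

Section Regularity.
Variables (e : nat) (A : nat -> nat).
Hypotheses (hA : arm_seq e A) (e3 : (3 <= e)%N).

Lemma hook_points l r d : let x := to_point (r, part l r) in
  let z := to_point (conjp l d, d) in
  content x - content z + 1 = hook_len l r d.
Proof. by rewrite /content /hook_len /=; lia. Qed.

Lemma arm_eqP l r d t : (0 < t)%N -> hook_len l r d = (e * t)%N%:Z -> (d <= part l r)%N ->
  let x := to_point (r, part l r) in let z := to_point (conjp l d, d) in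
  arm_len l r d = A t <-> (arm_pos e A (x - (z - east)) /\ arm_pos e A (z + south - x)).
Proof.
move=> t0 Eh dp x z.
have E1 : content (x - (z - east)) = e%:Z * t%:Z.
  by rewrite -PoszM -Eh -hook_points /content /=; lia.
have E2 : content (z + south - x) = - (e%:Z * t%:Z).
  by rewrite -PoszM -Eh -hook_points /content /=; lia.
rewrite (arm_pos_lt hA e3 t0 E1) (arm_pos_ge hA e3 t0 E2) /arm_len /=.
by split=> [h|[]]; [split|]; lia.
Qed.

Lemma A_regular_shape l : A_regular e A l <-> is_partition l /\ regular (arm_pos e A) e (shape_of l).
Proof.
split=> -[hl h]; split=> //.
  move=> x z lx nx lz nz k0 ek h1 h2.
  have x1 : 0 < x.1.
    by rewrite ltNge; apply: contra nx => hx; apply/or3P; constructor 1; rewrite /= addr0.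
  have Ex : x = to_point (`|x.1|%N, part l `|x.1|%N).
    apply: injective_projections => /=; first by lia.
    by move: lx nx; rewrite /shape_of /= addr0; lia.
  have z2 : 0 < z.2.
    by rewrite ltNge; apply: contra nz => hz; apply/or3P; constructor 2; rewrite /= addr0.
  have z1 : 0 <= z.1.
    rewrite leNgt; apply: contra nz => hz; apply/or3P; constructor 1; rewrite /=; lia.
  have Ez : z = to_point (conjp l `|z.2|%N, `|z.2|%N).
    apply: injective_projections => /=; last by lia.
    have d0 : (0 < `|z.2|)%N by lia.
    have P r : (0 < r)%N -> (r <= conjp l `|z.2|)%N = (`|z.2| <= part l r)%N.
      by move=> r0; apply: conjp_le.
    have := P `|z.1|.+1 isT.
    have E : `|(z.1 + 1)%R|%N = `|z.1|.+1%N by lia.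
    move: nz; rewrite /shape_of /= addr0 E => n1.
    case: (posnP `|z.1|%N) => z10; first by lia.
    have := P `|z.1|%N z10; move: lz; rewrite /shape_of => n2; lia.
  move: Ex Ez; set r := `|x.1|%N; set d := `|z.2|%N => Ex Ez.
  have r0 : (0 < r)%N by rewrite /r; lia.
  have d0 : (0 < d)%N by rewrite /d; lia.
  have Eh := hook_points l r d; rewrite /= -Ex -Ez in Eh.
  rewrite Eh in k0 ek.
  have dp : (d <= part l r)%N.
    rewrite leqNgt; apply/negP => lt.
    have : (conjp l d < r)%N by rewrite ltnNge conjp_le // -ltnNge.
    by move: k0; rewrite /hook_len; lia.
  move: ek; rewrite /edvd => /dvdzP[q Eq].
  have q0 : 0 < q by move: k0; rewrite Eq pmulr_lgt0 //; lia.
  have t0 : (0 < `|q|)%N by lia.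
  have Eh2 : hook_len l r d = (e * `|q|)%N%:Z by rewrite Eq PoszM abszE gtr0_norm // mulrC.
  apply: (h r d _ `|q|%N t0); first by rewrite /is_node; split; lia.
  split=> //; apply/(arm_eqP t0 Eh2 dp); rewrite -Ex -Ez; split=> //.
move=> r d [r0 /andP[d0 dp]] t t0 [Eh Ea].
have [h1 h2] := (arm_eqP t0 Eh dp).1 Ea.
apply: (h _ _ _ _ _ _ _ _ h1 h2).
- by rewrite /to_point shape_ofE.
- rewrite /to_point (_ : _ + east = (r%:Z, (part l r)%:Z + 1)); last by vec.
  by rewrite shape_ofE //; lia.
- rewrite /to_point /shape_of /=; case: (posnP (conjp l d)) => [->//|c0].
  by rewrite lez_nat -conjp_le // leqnn !orbT.
- rewrite /to_point (_ : _ + south = ((conjp l d).+1%:Z, d%:Z)); last by vec.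
  by rewrite shape_ofE // lez_nat -conjp_le // ltnn.
- by rewrite hook_points Eh; lia.
by rewrite hook_points Eh /edvd PoszM dvdz_mulr.
Qed.
End Regularity.

(** * Signatures *)

Section Words.
Variable T : Type.
Implicit Types (w u v : seq (bool * T)) (x y : bool * T).

Definition charge w : int := \sum_(x <- w) (if x.1 then 1 else -1).

Lemma charge_cat u v : charge (u ++ v) = charge u + charge v.
Proof. by rewrite /charge big_cat. Qed.
Lemma charge_cons x u : charge (x :: u) = (if x.1 then 1 else -1) + charge u.
Proof. by rewrite /charge big_cons. Qed.
Lemma charge_nil : charge [::] = 0. Proof. by rewrite /charge big_nil. Qed.

Definition suffix_le0 u := forall a b, u = a ++ b -> charge b <= 0.
Definition prefix_ge0 v := forall a b, v = a ++ b -> 0 <= charge a.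

(* x survives the cancellation of all pairs +- and is the first such plus. *)
Definition first_plus w x := exists u v,
  [/\ w = u ++ x :: v, x.1, suffix_le0 u & prefix_ge0 v].

Lemma cat_cases (S : Type) (a b c d : seq S) : a ++ b = c ++ d ->
  (exists m, a = c ++ m /\ d = m ++ b) \/ (exists m, c = a ++ m /\ b = m ++ d).
Proof.
elim: a c => [|x a IH] [|y c] /=.
- by move=> ->; left; exists [::].
- by move=> ->; right; exists (y :: c).
- by move=> <-; left; exists (x :: a).
by move=> [-> /IH [[m [-> ->]]|[m [-> ->]]]]; [left|right]; exists m.
Qed.

Lemma first_plus_uniq w x x' : first_plus w x -> first_plus w x' -> x = x'.
Proof.
have aux u v y u' v' y' m : y.1 -> u' = u ++ m -> y :: v = m ++ y' :: v' ->
    suffix_le0 u' -> prefix_ge0 v -> y = y'.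
  case: m => [|z m] py E; first by rewrite /= => -[].
  move=> [Ez Ev] s p; exfalso.
  have h1 : charge (y :: m) <= 0 by apply: (s u); rewrite E Ez.
  have h2 := p _ _ Ev; move: h1; rewrite charge_cons py; lia.
move=> [u [v [-> px su pv]]] [u' [v' [E px' su' pv']]].
have [[m [E1 E2]]|[m [E1 E2]]] := cat_cases E.
  by apply/esym; apply: (aux u' v' x' u v x m).
by apply: (aux u v x u' v' x' m).
Qed.

Definition no_cancel w := forall a x y b, w = a ++ x :: y :: b -> ~~ (x.1 && ~~ y.1).
End Words.

Lemma del_pm_cases w : (del_pm w = w /\ no_cancel w) \/
  exists a x y b, [/\ w = a ++ x :: y :: b, x.1, ~~ y.1 & del_pm w = a ++ b].
Proof.
elim: w => [|x w IH]; first by left; split=> // -[|? [|? ?]] *.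
case: w IH => [|y w] IH.
  by left; split=> // -[|? [|? [|? ?]]] ? ? ? // [].
have -> : del_pm (x :: y :: w) = if x.1 && ~~ y.1 then w else x :: del_pm (y :: w) by [].
case: (boolP (x.1 && ~~ y.1)) => [/andP[px ny]|n].
  by right; exists [::], x, y, w.
case: IH => [[-> nc]|[a [x' [y' [b [E px ny ->]]]]]].
  left; split=> // -[|z a] x' y' b /=; first by move=> [<- <- _].
  by move=> [_ E]; apply: nc E.
by right; exists (x :: a), x', y', b; rewrite E.
Qed.

Lemma suffix_uncancel (T : Type) (a b : seq (bool * T)) (x y : bool * T) : x.1 -> ~~ y.1 ->
  suffix_le0 (a ++ b) -> suffix_le0 (a ++ x :: y :: b).
Proof.
move=> px /negbTE ny h c d E.
have [[m [E1 E2]]|[m [E1 E2]]] := cat_cases E.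
  have := h c (m ++ b); rewrite E1 catA => /(_ erefl); rewrite E2 !charge_cat !charge_cons px ny.
  by lia.
case: m E1 E2 => [|z [|z' m]] E1 E2.
- have := h c b; rewrite E1 cats0 => /(_ erefl); move: E2; rewrite cat0s => <-.
  by rewrite !charge_cons px ny; lia.
- case: E2 => Ez <-; have := h a b erefl.
  by rewrite charge_cons ny; lia.
case: E2 => _ _ E2; apply: (h (a ++ m)); by rewrite E2 catA.
Qed.

Lemma prefix_uncancel (T : Type) (a b : seq (bool * T)) (x y : bool * T) : x.1 -> ~~ y.1 ->
  prefix_ge0 (a ++ b) -> prefix_ge0 (a ++ x :: y :: b).
Proof.
move=> px /negbTE ny h c d E.
have [[m [E1 E2]]|[m [E1 E2]]] := cat_cases E.
  by apply: (h c (m ++ b)); rewrite E1 catA.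
case: m E1 E2 => [|z [|z' m]] E1 E2.
- by apply: (h c b); rewrite E1 cats0.
- case: E2 => Ez E2; have := h a b erefl.
  by rewrite E1 charge_cat charge_cons charge_nil -Ez px; lia.
case: E2 => Ez Ez' E2; have := h (a ++ m) d; rewrite E2 catA => /(_ erefl).
by rewrite E1 !charge_cat !charge_cons -Ez -Ez' px ny; lia.
Qed.

Lemma first_plus_uncancel (T : Type) (a b : seq (bool * T)) (x y z : bool * T) : x.1 -> ~~ y.1 ->
  first_plus (a ++ b) z -> first_plus (a ++ x :: y :: b) z.
Proof.
move=> px ny [u [v [E pz su pv]]].
have [[m [E1 E2]]|[m [E1 E2]]] := cat_cases E.
  case: m E1 E2 => [|z' m] E1 E2.
    exists (u ++ [:: x; y]), v; split=> //.
    - by rewrite E1 cats0 -catA /= E2.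
    - by apply: suffix_uncancel => //; rewrite cats0.
  case: E2 => Ez E2; exists u, (m ++ x :: y :: b); split=> //.
    by rewrite E1 -catA /= Ez.
  by apply: prefix_uncancel => //; rewrite -E2.
exists (a ++ x :: y :: m), v; split=> //; first by rewrite E2 -catA.
by apply: suffix_uncancel => //; rewrite -E1.
Qed.

Lemma iter_del_fix n w : (size w <= n)%N -> del_pm (iter n del_pm w) = iter n del_pm w.
Proof.
elim: n w => [|n IH] w hw; first by case: w hw.
rewrite iterSr; have [[E _]|[a [x [y [b [Ew _ _ E]]]]]] := del_pm_cases w.
  rewrite E; elim: {IH hw} n => //= n IHn; by rewrite IHn.
apply: IH; rewrite E; move: hw; rewrite Ew !size_cat /=; lia.
Qed.

Lemma no_cancel_plus (T : Type) (w : seq (bool * T)) (x : bool * T) : no_cancel (x :: w) -> x.1 -> all fst w.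
Proof.
elim: w x => // y w IH x nc px.
have py : y.1 by have := nc [::] x y w erefl; rewrite px /= negbK.
rewrite /= py; apply: (IH y) => // a x' y' b E; apply: (nc (x :: a)); by rewrite E.
Qed.

Lemma reduce_first_plus w : match [seq x <- reduce_word w | x.1] with
  | x :: _ => first_plus w x | [::] => forall x, ~ first_plus w x end.
Proof.
have nc : no_cancel (reduce_word w).
  have E := iter_del_fix (leqnn (size w)).
  have [[_ //]|[a [x [y [b [E1 _ _ E2]]]]]] := del_pm_cases (reduce_word w).
  move: E2; rewrite /reduce_word E -/(reduce_word w) E1 => /(congr1 size).
  by rewrite !size_cat /=; lia.
have back n z : first_plus (iter n del_pm w) z -> first_plus w z.
  elim: n => //= n IH h; apply: IH.
  have [[E _]|[a [x [y [b [E px ny E2]]]]]] := del_pm_cases (iter n del_pm w).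
    by rewrite E in h.
  by rewrite E; apply: first_plus_uncancel => //; rewrite -E2.
have backs n : suffix_le0 (iter n del_pm w) -> suffix_le0 w.
  elim: n => //= n IH h; apply: IH.
  have [[E _]|[a [x [y [b [E px ny E2]]]]]] := del_pm_cases (iter n del_pm w).
    by rewrite E in h.
  by rewrite E; apply: suffix_uncancel => //; rewrite -E2.
have allneg (s : seq (bool * (nat * nat))) : all (fun x => ~~ x.1) s -> suffix_le0 s.
  move=> h a b E; move: h; rewrite E all_cat => /andP[_]; elim: b {E} => [|y b IH].
    by rewrite charge_nil.
  by move=> /= /andP[/negbTE ny /IH]; rewrite charge_cons ny; lia.
case E : [seq x <- reduce_word w | x.1] => [|x s].
  move=> x [u [v [Ew px su pv]]].
  have : suffix_le0 w.
    apply: (backs (size w)); apply: allneg; apply/allP => y yw; apply/negP => py.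
    have : y \in [seq x <- reduce_word w | x.1] by rewrite mem_filter py.
    by rewrite E.
  move=> /(_ u (x :: v) Ew); have := pv v [::]; rewrite cats0 => /(_ erefl).
  by rewrite charge_cons px; lia.
apply: (back (size w)); rewrite -/(reduce_word w).
have [u [v [Es nu px]]] : exists u v,
    [/\ reduce_word w = u ++ x :: v, all (fun y => ~~ y.1) u & x.1].
  elim: (reduce_word w) E => //= y r IH; case: ifP => py.
    by move=> [<- _]; exists [::], r.
  by move=> /IH [u [v [-> h ?]]]; exists (y :: u), v; rewrite /= py.
exists u, v; split=> //; first exact: allneg.
have pv : all fst v.
  apply: (no_cancel_plus (x := x)) => // a x' y' b Ea.
  by apply: (nc (u ++ a)); rewrite Es Ea catA.
move=> a b Ea; move: pv; rewrite Ea all_cat => /andP[+ _].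
elim: a {Ea} => [|y a IH]; first by rewrite charge_nil.
by move=> /= /andP[py /IH]; rewrite charge_cons py; lia.
Qed.

Section Arrows.
Variables (e : nat) (A : nat -> nat).
Hypotheses (hA : arm_seq e A) (e3 : (3 <= e)%N).
Let pos := arm_pos e A.
Let O : good_order pos. Proof. exact: arm_good_order. Qed.

Lemma resE (i : 'I_e) x : (res e x == (i : nat)%:Z) = inres e i (to_point x).
Proof.
rewrite /res /inres /edvd -eqz_mod_dvd /content /=.
rewrite [((i : nat)%:Z %% _)%Z]modz_small //.
by rewrite ltz_nat ltn_ord.
Qed.

Section Signature.
Variables (i : 'I_e) (l : seq nat).
Hypothesis hl : is_partition l.
Let S := shape_of l.
Let pt (x : bool * (nat * nat)) := to_point x.2.

Lemma pt_inj x y : x.1 = y.1 -> pt x = pt y -> x = y.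
Proof. by case: x y => [p [a b]] [q [c d]] /= -> [-> ->]. Qed.

Lemma mem_signature x : (x \in signature A i l) =
  (if x.1 then addable S (pt x) else removable S (pt x)) && inres e i (pt x).
Proof.
rewrite mem_sort mem_cat; case: x => -[] [r c] /=.
  apply/idP/andP => [/orP[/mapP[r']|/mapP[r']]|[/(addable_shape_of _ hl)[r' [r0 [Er Ec] h]] hi]] //.
    rewrite mem_filter resE mem_iota => /andP[/andP[h1 h2] h3] [-> ->]; split=> //.
    by apply/addable_shape_of => //; exists r'; split=> //; lia.
  have Er' : r = r' by move: Er; lia.
  have Ec' : c = (part l r').+1 by move: Ec; lia.
  subst; apply/orP; left; apply/mapP; exists r' => //.
  rewrite mem_filter h resE hi mem_iota /=.
  case/orP: h => [/eqP->//|h]; rewrite r0 add1n ltnS leqNgt; apply/negP => h3.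
  by move: h; rewrite (@part_size l r'.-1) //; lia.
apply/idP/andP => [/orP[/mapP[r']|/mapP[r']]|[/(removable_shape_of _ hl)[r' [r0 [Er Ec] h]] hi]] //.
  rewrite mem_filter resE mem_iota => /andP[/andP[h1 h2] h3] [-> ->]; split=> //.
  by apply/removable_shape_of => //; exists r'; split=> //; lia.
have Er' : r = r' by move: Er; lia.
have Ec' : c = part l r' by move: Ec; lia.
subst; apply/orP; right; apply/mapP; exists r' => //.
by rewrite mem_filter h resE hi mem_iota /= add1n ltnS.
Qed.

Lemma uniq_signature : uniq (signature A i l).
Proof.
rewrite sort_uniq cat_uniq !map_inj_in_uniq ?filter_uniq ?iota_uniq //=.
- rewrite andbT; apply/hasPn => x /mapP[r _ ->]; apply/negP => /mapP[r' _] //.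
- by move=> r r' _ _ [].
by move=> r r' _ _ [].
Qed.

Lemma pt_signature_inj : {in signature A i l &, injective pt}.
Proof.
move=> x y; rewrite !mem_signature => /andP[hx _] /andP[hy _] E.
apply: pt_inj => //; move: hx hy; rewrite E.
case: (x.1); case: (y.1) => //.
  by move=> /and3P[nl _ _] /and3P[l1 _ _]; rewrite l1 in nl.
by move=> /and3P[l1 _ _] /and3P[nl _ _]; rewrite l1 in nl.
Qed.

Lemma sg_signature x : x \in signature A i l -> sg S (pt x) = if x.1 then 1 else -1.
Proof.
rewrite mem_signature /sg => /andP[+ _]; case: (x.1) => h.
  by rewrite h /removable; have /and3P[/negbTE-> _ _] := h.
by rewrite h /addable; have /and3P[-> _ _] := h.
Qed.

Variable N : nat.
Hypothesis hN : (sumn l + 1 < N)%N.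

Lemma signature_box x : x \in signature A i l -> pt x \in box N.
Proof.
rewrite mem_signature mem_box => /andP[h _].
have f : fits N 0 S by apply: fits_shape_of => //; lia.
by apply: f; case: (x.1) h => ->; rewrite ?orbT.
Qed.

Lemma sum_signature (Q : pred point) :
  \sum_(w <- box N | inres e i w && Q w) sg S w =
  charge [seq x <- signature A i l | Q (pt x)].
Proof.
rewrite /charge big_filter.
have -> : \sum_(x <- signature A i l | Q (pt x)) (if x.1 then 1 else -1) =
    \sum_(w <- map pt (signature A i l) | Q w) sg S w.
  rewrite big_map big_seq_cond [RHS]big_seq_cond; apply: eq_bigr => x /andP[xs _].
  by rewrite sg_signature.
have P : perm_eq (map pt (signature A i l))
    [seq w <- box N | inres e i w && (addable S w || removable S w)].
  apply: uniq_perm; first by rewrite map_inj_in_uniq ?uniq_signature //; exact: pt_signature_inj.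
    by rewrite filter_uniq // uniq_box.
  move=> w; rewrite mem_filter; apply/mapP/andP => [[x xs ->]|[/andP[iw aw] wb]].
    split; last exact: signature_box.
    by move: xs; rewrite mem_signature => /andP[h ->]; case: (x.1) h => ->; rewrite ?orbT.
  have [x [Ex hx]] : exists x : bool * (nat * nat), w = pt x /\ (if x.1 then addable S w else removable S w).
    case/orP: aw => h.
      by have /(addable_shape_of _ hl)[r [_ Ew _]] := h; exists (true, (r, (part l r).+1)).
    by have /(removable_shape_of _ hl)[r [_ Ew _]] := h; exists (false, (r, part l r)).
  by exists x => //; rewrite mem_signature -Ex hx iw.
rewrite [RHS](perm_big _ P) -[RHS]big_filter -filter_predI big_filter /= big_mkcond [RHS]big_mkcond.
apply: eq_bigr => w _; case: (inres e i w) => //=; case: (Q w); rewrite ?andbF ?andbT //=.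
by case: ifP => // /negbT; rewrite -sg_neq0 negbK => /eqP.
Qed.

Local Notation "x ⪯ y" := (leq_pt pos x y) (at level 70).
Local Notation "x ≺ y" := (pos (y - x)) (at level 70).

Lemma signature_sorted : pairwise (fun x y => pt y ≺ pt x) (signature A i l).
Proof.
pose leT := fun x y : bool * (nat * nat) => prec e A y.2 x.2.
pose P := [pred x : bool * (nat * nat) | inres e i (pt x)].
have E : {in P &, forall x y, leT x y = (pt y ⪯ pt x)}.
  by move=> x y ix iy; apply: (precE hA e3 iy ix).
have all1 : all P (signature A i l).
  by apply/allP => x; rewrite mem_signature => /andP[].
have tot : {in P &, total leT}.
  move=> x y ix iy; rewrite !E //.
  by have [h|h|->] := pt_lt_or O (pt x) (pt y); rewrite ?(pt_ltW h) ?pt_lexx ?orbT.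
have tr : {in P & &, transitive leT}.
  by move=> y x z iy ix iz; rewrite !E // => h1 h2; apply: (pt_le_trans O h2 h1).
have srt : sorted leT (signature A i l).
  by apply: (sort_sorted_in tot); have := all1; rewrite all_sort.
have pw : pairwise leT (signature A i l) by rewrite -(sorted_pairwise_in tr).
have : pairwise [rel x y | leT x y && (x != y)] (signature A i l).
  by rewrite pairwise_relI pw /= -uniq_pairwise uniq_signature.
apply: (sub_in_pairwise (P := mem (signature A i l))); last by apply/allP.
move=> x y xs ys /= /andP[]; have ix := allP all1 _ xs; have iy := allP all1 _ ys.
rewrite E // => /orP[/eqP /pt_signature_inj E'|] // nxy.
by rewrite E' ?eqxx // in nxy.
Qed.

Lemma filter_suffix (u : seq (bool * (nat * nat))) z : pairwise (fun x y => pt y ≺ pt x) u ->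
  exists a, u = a ++ [seq x <- u | pt x ⪯ z].
Proof.
elim: u => [|y u IH] /=; first by exists [::].
move=> /andP[/allP h /IH [a Ea]]; case: ifP => yz; last by exists (y :: a); rewrite {1}Ea.
exists [::] => /=; congr (_ :: _); apply/esym/all_filterP/allP => x /h xy.
exact/pt_ltW/(pt_lt_le_trans O xy yz).
Qed.

Lemma filter_prefix (u : seq (bool * (nat * nat))) z : pairwise (fun x y => pt y ≺ pt x) u ->
  exists b, u = [seq x <- u | z ⪯ pt x] ++ b.
Proof.
elim: u => [|y u IH] /=; first by exists [::].
move=> /andP[/allP h /IH [a Ea]]; case: ifP => yz; first by exists a; rewrite {1}Ea.
exists (y :: u); have -> : [seq x <- u | z ⪯ pt x] = [::]; last by [].
apply/eqP; rewrite -[_ == _]negbK -has_filter; apply/hasPn => x /h xy.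
rewrite -(pt_ltNle O); apply: (pt_lt_trans O xy).
by rewrite (pt_ltNle O) yz.
Qed.

Lemma first_plus_balanced x : first_plus (signature A i l) x <->
  [/\ x \in signature A i l, x.1 & balanced pos e N S i (pt x)].
Proof.
have split3 u v : signature A i l = u ++ x :: v ->
    [/\ pairwise (fun x y => pt y ≺ pt x) u, pairwise (fun x y => pt y ≺ pt x) v,
        forall y, y \in u -> pt x ≺ pt y & forall y, y \in v -> pt y ≺ pt x].
  move=> E; have := signature_sorted; rewrite E pairwise_cat /= => /and3P[r pu /andP[/allP pv1 pv2]].
  by split=> // y yu; move/allrelP: r => r; apply: r => //; apply: mem_head.
have sumu u v z : signature A i l = u ++ x :: v ->
    [seq y <- signature A i l | (pt x ≺ pt y) && (pt y ⪯ z)] = [seq y <- u | pt y ⪯ z].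
  move=> E; have [_ _ hu hv] := split3 _ _ E; rewrite E filter_cat /= (pt_ltxx O) /=.
  have -> : [seq y <- v | (pt x ≺ pt y) && (pt y ⪯ z)] = [::].
    apply/eqP; rewrite -[_ == _]negbK -has_filter; apply/hasPn => y /hv h.
    by rewrite negb_and -(pt_leNlt O) (pt_ltW h).
  by rewrite cats0; apply: eq_in_filter => y /hu ->.
have sumv u v z : signature A i l = u ++ x :: v ->
    [seq y <- signature A i l | (z ⪯ pt y) && (pt y ≺ pt x)] = [seq y <- v | z ⪯ pt y].
  move=> E; have [_ _ hu hv] := split3 _ _ E; rewrite E filter_cat /= (pt_ltxx O) andbF /=.
  have -> : [seq y <- u | (z ⪯ pt y) && (pt y ≺ pt x)] = [::].
    apply/eqP; rewrite -[_ == _]negbK -has_filter; apply/hasPn => y /hu h.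
    by rewrite negb_and -(pt_leNlt O) (pt_ltW h) orbT.
  by apply: eq_in_filter => y /hv ->; rewrite andbT.
split=> [[u [v [E px su pv]]]|[xs px [b1 b2]]].
  have [pu pv' hu hv] := split3 _ _ E.
  split=> //; first by rewrite E mem_cat mem_head orbT.
  split=> z hz; rewrite sum_signature.
    by rewrite (sumu _ _ _ E); have [a Ea] := filter_suffix z pu; apply: su Ea.
  by rewrite (sumv _ _ _ E); have [a Ea] := filter_prefix z pv'; apply: pv Ea.
have [u [v E]] : exists u v, signature A i l = u ++ x :: v.
  by case/splitPr: xs => u v; exists u, v.
have [pu pv hu hv] := split3 _ _ E.
exists u, v; split=> //.
  move=> a [|y b] Eu; first by rewrite charge_nil.
  have yu : y \in u by rewrite Eu mem_cat mem_head orbT.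
  have := b1 _ (hu _ yu); rewrite sum_signature (sumu _ _ _ E).
  have -> : [seq z <- u | pt z ⪯ pt y] = y :: b; last by [].
  move: pu; rewrite Eu pairwise_cat /= => /and3P[/allrelP r _ /andP[/allP pb _]].
  rewrite filter_cat /= pt_lexx.
  have -> : [seq z <- a | pt z ⪯ pt y] = [::].
    apply/eqP; rewrite -[_ == _]negbK -has_filter; apply/hasPn => z za.
    by rewrite -(pt_ltNle O); apply: r => //; exact: mem_head.
  by congr (_ :: _); apply/all_filterP/allP => z /pb /pt_ltW.
move=> a b Ev; case: (lastP a) Ev => [|{}a y] Ev; first by rewrite charge_nil.
have yv : y \in v by rewrite Ev mem_cat mem_rcons mem_head.
have := b2 _ (hv _ yv); rewrite sum_signature (sumv _ _ _ E).
have -> : [seq z <- v | pt y ⪯ pt z] = rcons a y; last by [].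
move: pv; rewrite Ev cat_rcons pairwise_cat /= => /and3P[/allrelP r _ /andP[/allP pb _]].
rewrite filter_cat /= pt_lexx -cats1; congr (_ ++ _).
  by apply/all_filterP/allP => z za; apply/pt_ltW/r => //; exact: mem_head.
congr (_ :: _); apply/eqP; rewrite -[_ == _]negbK -has_filter; apply/hasPn => z /pb h.
by rewrite -(pt_ltNle O).
Qed.
End Signature.

Lemma fop_step (i : 'I_e) l m N : is_partition l -> (sumn l + 1 < N)%N ->
  fop A i l = Some m <-> is_partition m /\ step pos e N i (shape_of l) (shape_of m).
Proof.
move=> hl hN; have := reduce_first_plus (signature A i l).
rewrite /fop; case E : [seq x <- reduce_word (signature A i l) | x.1] => [|x s] fp.
  split=> // -[hm /(stepP O _ _ _ e3 (shape_shape_of hm))[w [rw iw wb bal Ew]]].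
  have [m' [hm' Em _ [r [r0 Er _ hr]]]] := add_partition hl (shape_shape_of hm) rw Ew.
  case: (fp (true, (r, (part l r).+1))).
  apply/(first_plus_balanced _ hl hN); rewrite -Er; split=> //.
  rewrite mem_signature //= -Er iw andbT Er; apply/addable_shape_of => //.
  by exists r.
have /(first_plus_balanced _ hl hN)[xs px bal] := fp.
have := xs; rewrite mem_signature // px => /andP[/(addable_shape_of _ hl)[r [r0 Ex hr]] ix].
have Er : x.2.1 = r by case: Ex; lia.
split=> [[<-]|[hm /(stepP O _ _ _ e3 (shape_shape_of hm))[w [rw iw wb bal' Ew]]]].
  have [rx Es] := del_incr hl r0 hr; rewrite -Ex in rx Es.
  rewrite Er; have hm := partition_incr hl r0 hr; split=> //.
  apply/stepP => //; first exact: shape_shape_of.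
  exists (to_point x.2); split=> //; exact: (signature_box hl hN xs).
have [m' [hm' Em _ [r' [r0' Er' Em' hr']]]] := add_partition hl (shape_shape_of hm) rw Ew.
have Emm := shape_of_inj hm hm' Em.
have fp' : first_plus (signature A i l) (true, (r', (part l r').+1)).
  apply/(first_plus_balanced _ hl hN); rewrite -Er'; split=> //.
  rewrite mem_signature //= -Er' iw andbT Er'; apply/addable_shape_of => //.
  by exists r'.
by have -> := first_plus_uniq fp fp'; rewrite /= Emm Em'.
Qed.
End Arrows.

Section RegularPartitions.
Variables (e : nat) (A : nat -> nat).
Hypotheses (hA : arm_seq e A) (e3 : (3 <= e)%N).
Let pos := arm_pos e A.
Let O : good_order pos. Proof. exact: arm_good_order. Qed.
Local Notation V := (A_regular e A).

Lemma A_regular_wregular l : V l -> wregular pos e (shape_of l).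
Proof.
move=> /(A_regular_shape hA e3)[hl rg].
by apply: (regular_wregular O) => //; apply: shape_shape_of.
Qed.

Lemma arrow_size (i : 'I_e) l m : is_partition l -> crystal_arrow A i l m -> sumn m = (sumn l).+1.
Proof.
move=> hl a; have hN : (sumn l + 1 < sumn l + 2)%N by lia.
have [hm /(stepP O _ _ _ e3 (shape_shape_of hm))[w [rw _ _ _ Ew]]] := (fop_step hA e3 i m hl hN).1 a.
have [m' [hm' Em sz _]] := add_partition hl (shape_shape_of hm) rw Ew.
by rewrite (shape_of_inj hm hm' Em).
Qed.

Lemma step_below (i : 'I_e) N l mu : V l -> (sumn l + 6 < N)%N -> step pos e N i mu (shape_of l) ->
  exists k, [/\ V k, mu = shape_of k, crystal_arrow A i k l & sumn l = (sumn k).+1].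
Proof.
move=> Vl hN st; have [hl rg] := (A_regular_shape hA e3 l).1 Vl.
have sl := shape_shape_of hl.
have f : fits N 4 (shape_of l) by apply: fits_shape_of => //; lia.
have [x gx Emu] := st; have [_ _ rx] := good_removable O gx.
have [k [hk Ek]] := del_partition hl rx.
have [m [hm Em sz _]] := add_partition hk sl rx Ek.
rewrite -(shape_of_inj hl hm Em) in sz.
exists k; split=> //.
- apply/(A_regular_shape hA e3); split=> //; rewrite Ek.
  exact: (regular_del O sl f gx rg).
- by rewrite Emu Ek.
apply/(fop_step hA e3 i l hk (N := N)); first by lia.
by split=> //; rewrite Ek -Emu.
Qed.

Lemma step_above (i : 'I_e) N l mu : V l -> (sumn l + 6 < N)%N -> down_closed mu ->
  step pos e N i (shape_of l) mu ->
  exists m, [/\ V m, mu = shape_of m, crystal_arrow A i l m & sumn m = (sumn l).+1].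
Proof.
move=> Vl hN smu st; have [hl rg] := (A_regular_shape hA e3 l).1 Vl.
have [x gx El] := st; have [_ _ rx] := good_removable O gx.
have [m [hm Em sz _]] := add_partition hl smu rx El.
exists m; split=> //.
- apply/(A_regular_shape hA e3); split=> //.
  have sm := shape_shape_of hm.
  have f : fits N 4 (shape_of m) by apply: fits_shape_of => //; lia.
  rewrite Em in gx El; apply: (regular_undel O e3 sm f gx); by rewrite -El.
apply/(fop_step hA e3 i m hl (N := N)); first by lia.
by split=> //; rewrite -Em.
Qed.

Lemma arrow_step (i : 'I_e) N l m : V l -> (sumn l + 1 < N)%N -> crystal_arrow A i l m ->
  step pos e N i (shape_of l) (shape_of m).
Proof. by move=> [hl _] hN /(fop_step hA e3 i m hl hN)[]. Qed.

Lemma arrow_A_regular (i : 'I_e) l m : V l -> crystal_arrow A i l m -> V m.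
Proof.
move=> Vl a; have [hl _] := Vl.
have hN : (sumn l + 1 < sumn l + 7)%N by lia.
have [hm st] := (fop_step hA e3 i m hl hN).1 a.
have [|m' [Vm Em _ _]] := step_above Vl _ (shape_shape_of hm) st; first by lia.
have [hm' _] := Vm.
by rewrite (shape_of_inj hm hm' Em).
Qed.

Lemma residues_neq (i j : 'I_e) : i != j -> ~~ edvd e (j%:Z - i%:Z).
Proof.
apply: contra => h; have h0 := edvd0 e; have := dvd_small h h0.
have := ltn_ord i; have := ltn_ord j; rewrite -val_eqE /=; lia.
Qed.

(* The maximal node of a nonempty partition is removable, and by regularity no
   addable node of its residue comes before it in the signature. *)
Lemma removable_good_exists l N : V l -> (0 < sumn l)%N -> (sumn l + 6 < N)%N ->
  exists i : 'I_e, 0 < eps pos e N (shape_of l) i.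
Proof.
move=> Vl l0 hN; have [hl rg] := (A_regular_shape hA e3 l).1 Vl.
have wr := A_regular_wregular Vl.
have size0 : (0 < size l)%N by case: (l) l0.
have p1 : (0 < part l 1)%N := part_pos (r := 1%N) hl size0.
pose inq (w : point) := [&& shape_of l w, 0 < w.1 & 0 < w.2].
have inbox w : inq w -> w \in box N.
  move=> /and3P[lw w1 w2]; rewrite mem_box /inb.
  have lw' : w.2 <= (part l `|w.1|%N)%:Z by move: lw; rewrite /shape_of; lia.
  have h1 : (part l `|w.1| <= sumn l)%N by apply: part_le_sumn; lia.
  have h2 : (`|w.1| <= size l)%N.
    by rewrite leqNgt; apply/negP => h; rewrite (part_size h) in lw'; lia.
  have h3 := size_le_sumn hl; lia.
have [|x] := @max_seq _ O [seq w <- box N | inq w].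
  have q1 : inq (1, 1) by rewrite /inq /shape_of /=; move: p1; lia.
  apply/eqP => E; have : (1, 1) \in [seq w <- box N | inq w] by rewrite mem_filter q1 inbox.
  by rewrite E.
rewrite mem_filter => /andP[qx xb] xmax.
have xm w : inq w -> leq_pt pos w x by move=> qw; apply: xmax; rewrite mem_filter qw inbox.
have /and3P[lx x1 x2] := qx.
have rx : removable (shape_of l) x.
  rewrite /removable lx /=; apply/andP; split; apply/negP => h.
    have q : inq (x + east) by rewrite /inq h /=; apply/andP; split; lia.
    have := xm _ q; rewrite (pt_leNlt O) => /negP; apply.
    by apply: (pos_eq (pos_east O)); vec.
  have q : inq (x + south) by rewrite /inq h /=; apply/andP; split; lia.
  have := xm _ q; rewrite (pt_leNlt O) => /negP; apply.
  by apply: (pos_eq (pos_south O)); vec.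
have e0 : 0 < e%:Z by lia.
have mlt : (`|(content x %% e%:Z)%Z| < e)%N.
  by have := ltz_pmod (content x) e0; have := modz_ge0 (content x) (lt0r_neq0 e0); lia.
exists (Ordinal mlt) => /=.
have ix : inres e `|(content x %% e%:Z)%Z|%N%:Z x.
  rewrite /inres abszE ger0_norm ?modz_ge0 ?lt0r_neq0 // /edvd.
  by rewrite -eqz_mod_dvd modz_mod.
apply: (eps_gt0_of_removable O rx ix xb) => s as_ xs is_.
have nlt : ~ pos (x - (s - diag)).
  by apply: (wr_node wr as_ rx) => //; apply: dvd_sub is_ ix _; lia_goal.
have le : leq_pt pos x (s - diag) by rewrite (pt_leNlt O); apply/negP.
have := as_; rewrite (addable_shape_of _ hl) => -[r [r0 Es hr]].
have /and3P[_ sE sS] := as_.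
have contra_q w : inq w -> pos (w - (s - diag)) -> False.
  move=> /xm qw h; have := pt_lt_le_trans O h qw; rewrite (pt_ltNle O) le //.
case: (eqVneq r 1%N) => [r1|rn1].
  apply: (contra_q (s - east)).
    by rewrite /inq sE Es r1 /=; move: p1; lia_goal.
  by apply: (pos_eq (pos_south O)); rewrite /diag; vec.
apply: (contra_q (s - south)).
  by rewrite /inq sS Es /=; move: r0 rn1; lia_goal.
by apply: (pos_eq (pos_east O)); rewrite /diag; vec.
Qed.

Lemma crystal_axioms_A_regular n : let N := (n + 20)%N in
  crystal_axioms (fun i j : 'I_e => cartan e i j) n [::] V sumn (@crystal_arrow e A)
    (fun i l => eps pos e N (shape_of l) (i : nat)%:Z)
    (fun i l => phi pos e N (shape_of l) (i : nat)%:Z).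
Proof.
move=> N.
have P l : V l -> is_partition l by case.
have SH l : V l -> down_closed (shape_of l) by move=> /P /shape_shape_of.
have F l k : V l -> (sumn l <= n + 4)%N -> (k < 10)%N -> fits N k (shape_of l).
  by move=> /P hl h hk; apply: fits_shape_of => //; rewrite /N; lia.
have ST (i : 'I_e) l m : V l -> (sumn l <= n + 4)%N -> crystal_arrow A i l m ->
    step pos e N (i : nat)%:Z (shape_of l) (shape_of m).
  by move=> Vl h a; apply: arrow_step => //; rewrite /N; lia.
have DN (i : 'I_e) l mu : V l -> (sumn l <= n + 4)%N -> step pos e N i mu (shape_of l) ->
    exists k, [/\ V k, mu = shape_of k, crystal_arrow A i k l & sumn l = (sumn k).+1].
  by move=> Vl h; apply: step_below => //; rewrite /N; lia.
have UP (i : 'I_e) l mu : V l -> (sumn l <= n + 4)%N -> down_closed mu ->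
    step pos e N i (shape_of l) mu ->
    exists k, [/\ V k, mu = shape_of k, crystal_arrow A i l k & sumn k = (sumn l).+1].
  by move=> Vl h; apply: step_above => //; rewrite /N; lia.
have SZ (i : 'I_e) l m : V l -> crystal_arrow A i l m -> sumn m = (sumn l).+1.
  by move=> /P; apply: arrow_size.
split.
- by split=> // r c [r0]; rewrite /part nth_nil; lia.
- by [].
- move=> x Vx x0; have := size_le_sumn (P _ Vx); rewrite x0; by case: (x).
- by move=> i x y z; rewrite /crystal_arrow => -> [].
- move=> i x y z Vy Vz ay az.
  have sy := SZ _ _ _ Vy ay; have sz := SZ _ _ _ Vz az.
  have Vx := arrow_A_regular Vy ay.
  have [|w gw Ew] := arrow_step (N := sumn x + 5) Vy _ ay; first by lia.
  have [|w' gw' Ew'] := arrow_step (N := sumn x + 5) Vz _ az; first by lia.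
  apply: shape_of_inj; [exact: P|exact: P|].
  by rewrite Ew Ew' (good_uniq O gw gw').
- by move=> i x y; apply: arrow_A_regular.
- by move=> i x y; apply: SZ.
- move=> x Vx /andP[x0 xn].
  have [|i /(good_of_eps O)[w gw _]] := removable_good_exists (N := N) Vx x0.
    by rewrite /N; lia.
  have hs : (sumn x <= n + 4)%N by lia.
  have st : step pos e N (i : nat)%:Z (del (shape_of x) w) (shape_of x) by exists w.
  have [k [Vk _ ak _]] := DN i x _ Vx hs st.
  by exists i, k.
- by move=> i x; apply: eps_ge0.
- move=> i x Vx xn /= /(good_of_eps O)[w gw _].
  have hs : (sumn x <= n + 4)%N by lia.
  have st : step pos e N (i : nat)%:Z (del (shape_of x) w) (shape_of x) by exists w.
  have [k [Vk _ ak _]] := DN i x _ Vx hs st.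
  by exists k.
- move=> i x y Vx a yn; have sy := SZ _ _ _ Vx a; have Vy := arrow_A_regular Vx a.
  have f1 : fits N 1 (shape_of y) by apply: F => //; lia.
  have st : step pos e N (i : nat)%:Z (shape_of x) (shape_of y) by apply: ST => //; lia.
  by rewrite (eps_step O e3 (SH _ Vy) f1 st) subrK.
- move=> i x Vx xn /= /(good_of_eps O)[w gw _].
  have sd := down_closed_dual (SH _ Vx).
  have [_ _ rw] := good_removable O gw.
  have sdel : down_closed (del (dual (shape_of x)) w) by exact: down_closed_del.
  have st0 : step pos e N (- (i : nat)%:Z) (del (dual (shape_of x)) w) (dual (shape_of x)).
    by exists w.
  have st := step_dual O e3 sd sdel st0; rewrite dualK opprK in st.
  have [|k [Vk _ ak _]] := UP i x _ Vx _ (down_closed_dual sdel) st; first by lia.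
  by exists k.
- move=> i x y Vx a xn; have sy := SZ _ _ _ Vx a; have Vy := arrow_A_regular Vx a.
  have st : step pos e N (i : nat)%:Z (shape_of x) (shape_of y) by apply: ST => //; lia.
  have [w gw _] := step_dual O e3 (SH _ Vy) (SH _ Vx) st.
  by rewrite /phi (eps_good O gw); case: gw.
- move=> i j x y Vx a yn; have sy := SZ _ _ _ Vx a; have Vy := arrow_A_regular Vx a.
  have f1 : fits N 1 (shape_of y) by apply: F => //; lia.
  have st : step pos e N (j : nat)%:Z (shape_of x) (shape_of y) by apply: ST => //; lia.
  rewrite !(phiE O) (total_step O e3 (i : nat)%:Z (SH _ Vy) f1 st); lia.
- move=> i j x1 x2 y ij V1 V2 yn a1 a2.
  have Vy := arrow_A_regular V1 a1; have s1 := SZ _ _ _ V1 a1; have s2 := SZ _ _ _ V2 a2.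
  have st1 : step pos e N (i : nat)%:Z (shape_of x1) (shape_of y) by apply: ST => //; lia.
  have st2 : step pos e N (j : nat)%:Z (shape_of x2) (shape_of y) by apply: ST => //; lia.
  have f5 : fits N 5 (shape_of y) by apply: F => //; lia.
  have [[z [z1 z2 h]]|[z [c1 [c2 [d1 [d2 [[g1 g2 g3] [h1 h2 h3 n1 n2]]]]]]]] :=
    local_below O e3 (SH _ Vy) (A_regular_wregular Vy) f5 (residues_neq ij) st1 st2.
    have [|k [Vk Ek ak _]] := DN j x1 z V1 _ z1; first by lia.
    have [|k' [Vk' Ek' ak' _]] := DN i x2 z V2 _ z2; first by lia.
    have E : k = k' by apply: shape_of_inj; [exact: P|exact: P|rewrite -Ek -Ek'].
    by left; exists k; split=> //; [rewrite E|rewrite -Ek].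
  right.
  have [|p2 [Vp2 Ep2 ap2 sp2]] := DN j x1 c2 V1 _ g3; first by lia.
  rewrite Ep2 in g2; have [|p1 [Vp1 Ep1 ap1 sp1]] := DN j p2 c1 Vp2 _ g2; first by lia.
  rewrite Ep1 in g1; have [|p [Vp Ep ap sp]] := DN i p1 z Vp1 _ g1; first by lia.
  have [|q2 [Vq2 Eq2 aq2 sq2]] := DN i x2 d2 V2 _ h3; first by lia.
  rewrite Eq2 in h2; have [|q1 [Vq1 Eq1 aq1 sq1]] := DN i q2 d1 Vq2 _ h2; first by lia.
  rewrite Eq1 in h1; have [|q [Vq Eq aq sq]] := DN j q1 z Vq1 _ h1; first by lia.
  have E : p = q by apply: shape_of_inj; [exact: P|exact: P|rewrite -Ep -Eq].
  exists p, p1, p2, q1, q2; split; split=> //; first by rewrite E.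
    by rewrite -Ep -Ep1.
  by rewrite -Ep -Eq1.
- move=> i j z x1 x2 ij Vz zn a1 a2 h.
  have V1 := arrow_A_regular Vz a1; have V2 := arrow_A_regular Vz a2.
  have s1 := SZ _ _ _ Vz a1; have s2 := SZ _ _ _ Vz a2.
  have st1 : step pos e N (i : nat)%:Z (shape_of z) (shape_of x1) by apply: ST => //; lia.
  have st2 : step pos e N (j : nat)%:Z (shape_of z) (shape_of x2) by apply: ST => //; lia.
  have f5 : fits N 5 (shape_of z) by apply: F => //; lia.
  have [/(_ h)[y [dy y1 y2]] _] := local_above O e3 (SH _ Vz) (A_regular_wregular Vz) f5
    (SH _ V1) (SH _ V2) (residues_neq ij) st1 st2.
  have [|k [Vk Ek ak _]] := UP j x1 y V1 _ dy y1; first by lia.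
  have [|k' [Vk' Ek' ak' _]] := UP i x2 y V2 _ dy y2; first by lia.
  have E : k = k' by apply: shape_of_inj; [exact: P|exact: P|rewrite -Ek -Ek'].
  by exists k; split=> //; rewrite E.
move=> i j z x1 x2 ij Vz zn a1 a2 h1 h2.
have V1 := arrow_A_regular Vz a1; have V2 := arrow_A_regular Vz a2.
have s1 := SZ _ _ _ Vz a1; have s2 := SZ _ _ _ Vz a2.
have st1 : step pos e N (i : nat)%:Z (shape_of z) (shape_of x1) by apply: ST => //; lia.
have st2 : step pos e N (j : nat)%:Z (shape_of z) (shape_of x2) by apply: ST => //; lia.
have f5 : fits N 5 (shape_of z) by apply: F => //; lia.
have [_ /(_ h1 h2)[c1 [c2 [d1 [d2 [y [[g1 g2 g3] [[t1 t2 t3] [k1 k2 k3 k4 k5]]]]]]]]] :=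
  local_above O e3 (SH _ Vz) (A_regular_wregular Vz) f5
    (SH _ V1) (SH _ V2) (residues_neq ij) st1 st2.
have [|p1 [Vp1 Ep1 ap1 sp1]] := UP j x1 c1 V1 _ k1 g1; first by lia.
rewrite Ep1 in g2; have [|p2 [Vp2 Ep2 ap2 sp2]] := UP j p1 c2 Vp1 _ k2 g2; first by lia.
rewrite Ep2 in g3; have [|p [Vp Ep ap sp]] := UP i p2 y Vp2 _ k5 g3; first by lia.
have [|q1 [Vq1 Eq1 aq1 sq1]] := UP i x2 d1 V2 _ k3 t1; first by lia.
rewrite Eq1 in t2; have [|q2 [Vq2 Eq2 aq2 sq2]] := UP i q1 d2 Vq1 _ k4 t2; first by lia.
rewrite Eq2 in t3; have [|q [Vq Eq aq sq]] := UP j q2 y Vq2 _ k5 t3; first by lia.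
have E : p = q by apply: shape_of_inj; [exact: P|exact: P|rewrite -Ep -Eq].
by exists p1, p2, q1, q2, p; split; split=> //; rewrite E.
Qed.
End RegularPartitions.

Local Close Scope ring_scope.

Theorem mainTheorem10 (e : nat) (A B : nat -> nat) :
  3 <= e -> arm_seq e A -> arm_seq e B ->
  (forall n : nat,
     crystal_iso (RAn_vert e A n) (RAn_vert e B n)
                 (@crystal_arrow e A) (@crystal_arrow e B)) /\
  crystal_iso (RA_vert e A) (RA_vert e B)
              (@crystal_arrow e A) (@crystal_arrow e B).
Proof.
move=> e3 hA hB.
have [n|f [g [hf hg gf fg fE]]] := @crystal_iso_of_axioms 'I_e
    (fun i j : 'I_e => cartan e i j) [::] sumn (A_regular e A) (A_regular e B)
    (@crystal_arrow e A) (@crystal_arrow e B).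
  have CA := crystal_axioms_A_regular hA e3 n; have CB := crystal_axioms_A_regular hB e3 n.
  do 4!eexists; split; [exact: CA|exact: CB|].
  move=> i; rewrite /= !(phiE (arm_good_order hA e3)) !(phiE (arm_good_order hB e3)); lia.
split.
  move=> n; exists f, g; split; first by move=> l [/hf [V sz] h]; split=> //; rewrite sz.
  split; first by move=> l [/hg [V sz] h]; split=> //; rewrite sz.
  split; first by move=> l [/gf].
  split; first by move=> l [/fg].
  by move=> i l m [Vl _] [Vm _]; apply: fE.
exists f, g; split; first by move=> l /hf[].
split; first by move=> l /hg[].
by split=> //; split.
Qed.
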